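(* Let $d \ge 2$, $t>0$, $\gamma \in \mathbb{R}^d$, and let $\Theta \in \mathfrak{so}(d)$ be a real skew-symmetric $d\times d$ matrix. Let $B$ be a standard $d$-dimensional Brownian motion and $\mathbf{A}_t$ its matrix of Lévy areas. Then $$ \mathbb{E}\left[\exp\left(i \sum_{j<k} \Theta_{j,k}\mathbf{A}_t^{j,k} + i \sum_{j}\gamma_j B_t^j\right)\right] = \mathbb{E}\left[\exp\left(\tfrac{i}{2}\operatorname{tr}(\Theta^\top \mathbf{A}_t) + i\langle \gamma, B_t\rangle\right)\right] $$ $$ = \det\left(\cosh\left(\tfrac t2|\Theta|\right)\right)^{-1/2}\exp\left(-\tfrac t2\,\gamma^\top \operatorname{sinch}\left(\tfrac t2|\Theta|\right)\cosh\left(\tfrac t2|\Theta|\right)^{-1}\gamma\right). $$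
   Context: $B=(B^1,\dots,B^d)$ is a standard $d$-dimensional Brownian motion started at $0$. Its Lévy area matrix $\mathbf{A}_t$ is the skew-symmetric $d\times d$ random matrix with entries $\mathbf{A}_t^{j,k}=\frac12\left(\int_0^t B_s^j\,dB_s^k-\int_0^t B_s^k\,dB_s^j\right)$ (Itô integrals). $|\Theta|=\sqrt{\Theta^\top\Theta}$ is the matrix modulus, $\operatorname{sinch}(x)=\sinh(x)/x$ with $\operatorname{sinch}(0)=1$, and $\cosh$, $\operatorname{sinch}$ are applied to the symmetric matrix $\frac t2|\Theta|$ by functional calculus. *)

(* Defs.v *)
From HB Require Import structures.
From mathcomp Require Import all_boot all_order all_algebra.
From mathcomp Require Import all_classical all_reals all_analysis.
From mathcomp.real_closed Require Import complex.

Set Implicit Arguments.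
Unset Strict Implicit.
Unset Printing Implicit Defensive.

Import Order.TTheory GRing.Theory Num.Theory numFieldNormedType.Exports.

Local Open Scope classical_set_scope.
Local Open Scope ring_scope.
Local Open Scope complex_scope.

Section ComplexExpectation.
Context {d : measure_display} {T : measurableType d} {R : realType}.

Definition cexp (z : R[i]) : R[i] :=
  (expR (complex.Re z))%:C * (cos (complex.Im z) +i* sin (complex.Im z)).

Definition cexpectation (P : probability T R) (Z : T -> R[i]) : R[i] :=
  fine 'E_P[fun w => complex.Re (Z w)] +i* fine 'E_P[fun w => complex.Im (Z w)].

End ComplexExpectation.

Section FunctionalCalculus.
Context {R : realType}.

Definition cosh (x : R) : R := (expR x + expR (- x)) / 2.

Definition sinh (x : R) : R := (expR x - expR (- x)) / 2.

Definition sinch (x : R) : R := if x == 0 then 1 else sinh x / x.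

(* For symmetric [S], [mxfun f S = Q^T diag (f l_1, ..., f l_n) Q] whenever
   [S = Q^T diag (l_1, ..., l_n) Q] with [Q] orthogonal; the choice of [Q] and
   [l] is irrelevant, see [mxfunE]. The value is 0 if [S] is not symmetric. *)
Definition mxfun n (f : R -> R) (S : 'M[R]_n) : 'M[R]_n :=
  xget 0 [set M : 'M[R]_n | exists (Q : 'M[R]_n) (l : 'rV[R]_n),
    [/\ Q *m Q^T = 1%:M, S = Q^T *m diag_mx l *m Q
      & M = Q^T *m diag_mx (map_mx f l) *m Q]].

Lemma mxfunE n (f : R -> R) (Q : 'M[R]_n) (l : 'rV[R]_n) :
  Q *m Q^T = 1%:M ->
  mxfun f (Q^T *m diag_mx l *m Q) = Q^T *m diag_mx (map_mx f l) *m Q.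
Proof.
move=> QQ; rewrite /mxfun; case: xgetP => [M _ [Q1 [l1 [QQ1 eqS ->]]]|].
  have Q1Q := mulmx1C QQ1; have Q'Q := mulmx1C QQ.
  pose W := Q *m Q1^T.
  have eqW : diag_mx l *m W = W *m diag_mx l1.
    have := congr1 (fun X => Q *m X *m Q1^T) eqS.
    by rewrite /W !mulmxA QQ mul1mx -!mulmxA QQ1 mulmx1 !mulmxA.
  have eqfW : diag_mx (map_mx f l) *m W = W *m diag_mx (map_mx f l1).
    apply/matrixP => i j; move/matrixP: eqW => /(_ i j).
    rewrite !mul_diag_mx !mul_mx_diag !mxE mulrC => /eqP.
    rewrite -subr_eq0 -mulrBr mulf_eq0 => /orP[/eqP->|].
      by rewrite mulr0 mul0r.
    by rewrite subr_eq0 => /eqP->; rewrite mulrC.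
  have := congr1 (fun X => Q^T *m X *m Q1) eqfW.
  by rewrite /W !mulmxA Q'Q mul1mx -!mulmxA Q1Q mulmx1 !mulmxA => ->.
by move=> /(_ (Q^T *m diag_mx (map_mx f l) *m Q)); case; exists Q, l.
Qed.

Definition mxmodulus n (M : 'M[R]_n) : 'M[R]_n := mxfun Num.sqrt (M^T *m M).

End FunctionalCalculus.

Section BrownianMotion.
Context {disp : measure_display} {T : measurableType disp} {R : realType}.
Variable P : probability T R.

(* As some of the [A i] may be [setT], the product rule for the full index type
   entails the product rule for every subfamily. *)
Definition mutually_independent (I : finType) (X : I -> T -> R) : Prop :=
  forall A : I -> set R, (forall i, measurable (A i)) ->
    P (\bigcap_i (X i @^-1` A i)) = (\prod_i P (X i @^-1` A i))%E.

Definition increment (X : R -> T -> R) (u v : R) (w : T) : R := X v w - X u w.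

(* Independence over the pairs (time interval, coordinate) expresses at once
   that the vector increments over disjoint intervals are independent and that
   each of them has independent coordinates, i.e. has law N(0, (v - u) I_d). *)
Record brownian_motion d (B : 'I_d -> R -> {RV P >-> R}) : Prop := {
  bm_start : {ae P, forall w, forall j, B j 0 w = 0} ;
  bm_indep : forall (n : nat) (s : nat -> R), 0 <= s 0%N ->
    (forall i, (i < n)%N -> s i < s i.+1) ->
    mutually_independent (fun ij : 'I_n * 'I_d =>
      increment (fun r => B ij.2 r) (s ij.1) (s ij.1.+1)) ;
  bm_normal : forall (j : 'I_d) (u v : R), 0 <= u -> u < v ->
    forall A : set R, measurable A ->
      P (increment (fun r => B j r) u v @^-1` A)
      = normal_prob 0 (Num.sqrt (v - u)) A ;
  bm_continuous : {ae P, forall w, forall j,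
    {within `[0, +oo[, continuous (fun s : R => B j s w)}} }.

Definition natural_filtration d (B : 'I_d -> R -> T -> R) (s : R) :
    set (set T) :=
  <<s [set E | exists (j : 'I_d) (u : R) (A : set R),
         [/\ 0 <= u, u <= s, measurable A & E = B j u @^-1` A]] >>.

Definition measurable_wrt (G : set (set T)) (f : T -> R) : Prop :=
  forall A : set R, measurable A -> G (f @^-1` A).

End BrownianMotion.

Section ItoIntegral.
Context {disp : measure_display} {T : measurableType disp} {R : realType}.
Variables (P : probability T R) (F : R -> set (set T)).

(* An elementary process is the sum over i < el_size of the F_(s_i)-measurable,
   square integrable coefficient xi_i times the indicator of the left-open
   interval from s_i to s_(i+1), where 0 <= s_0 <= s_1 <= ... <= t. *)
Record elementary (t : R) := Elementary {
  el_size : nat ;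
  el_time : nat -> R ;
  el_coef : nat -> T -> R ;
  el_time_ge0 : 0 <= el_time 0 ;
  el_time_incr : forall i, (i < el_size)%N -> el_time i <= el_time i.+1 ;
  el_time_le : el_time el_size <= t ;
  el_coef_L2 : forall i, (i < el_size)%N -> el_coef i \in Lfun P 2%:E ;
  el_coef_adapted : forall i, (i < el_size)%N ->
    measurable_wrt (F (el_time i)) (el_coef i) }.

Definition elementary_process t (H : elementary t) (s : R) (w : T) : R :=
  \sum_(i < el_size H)
    el_coef H i w * \1_(`]el_time H i, el_time H i.+1]%classic) s.

Definition elementary_integral t (H : elementary t) (W : R -> T -> R) (w : T) :
    R :=
  \sum_(i < el_size H)
    el_coef H i w * increment W (el_time H i) (el_time H i.+1) w.

(* The squared norm of L^2([0, t] x T, ds (x) P). *)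
Definition sqnorm_process (t : R) (X : R -> T -> R) : \bar R :=
  (\int[P]_w \int[lebesgue_measure]_(s in `[0%R, t]) ((X s w) ^+ 2)%:E)%E.

Record ito_integrand (t : R) (X : R -> T -> R) : Prop := {
  ii_measurable : measurable_fun (`[0, t] `*` [set: T])
    (fun z : R * T => X z.1 z.2) ;
  ii_adapted : forall s, 0 <= s -> s <= t -> measurable_wrt (F s) (X s) ;
  ii_L2 : (sqnorm_process t X < +oo)%E }.

(* [I] is (a version of) [\int_0^t X_s dW_s]; the Ito integral is only defined
   up to almost sure equality, hence a relation. *)
Definition is_ito_integral (t : R) (W X : R -> T -> R) (I : T -> R) : Prop :=
  [/\ ito_integrand t X, I \in Lfun P 2%:E &
    exists H : nat -> elementary t,
      (fun n => sqnorm_process t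
         (fun s w => elementary_process (H n) s w - X s w)) @ \oo --> 0%E
      /\ (fun n => 'E_P[fun w => ((elementary_integral (H n) W w - I w) ^+ 2)%R])%E
           @ \oo --> 0%E ].

End ItoIntegral.

Section LevyArea.
Context {T : Type} {R : realType}.

(* [I j k] stands for [\int_0^t B^j dB^k]. *)
Definition levy_area d (I : 'I_d -> 'I_d -> T -> R) (w : T) : 'M[R]_d :=
  \matrix_(j, k) (2^-1 * (I j k w - I k j w)).

End LevyArea.

(* Main.v *)
(* Let [u] be the function of time-to-go [tau], of the area functional [J] and
   of the position [b] given by [exp (expo tau b) * cos (phase J b)], where
   [expo tau b = - 1/2 sum_k ln (cosh (tau lam_k / 2)) - 1/4 sum_k T_k tau y_k^2],
   the [lam_k] are the eigenvalues of [|Theta|], [T_k tau = tanh (tau lam_k / 2) / lam_k]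
   and the [y_k] are the coordinates of [Theta^T b + 2 gamma] in an orthonormal
   eigenbasis. It solves the backward equation of [(J, B)] with
   [dJ = <Theta^T B, dB>], so that [u (t - s, J_s, B_s)] is a martingale: its value
   at [s = 0] is the closed formula and its value at [s = t] is the cosine of the
   phase. The equation [T' = (1 - lam^2 T^2) / 2] is what makes the drift vanish,
   together with the orthogonality of [grad_b (expo tau b)] and [Theta^T b + 2 gamma],
   which comes from the skewness of [Theta].

   No Ito formula is needed. By the Ito isometry the Ito integrals are within
   [O(sqrt h)] in L^2 of the left Riemann sums of mesh [h], and along these sums
   the expectation of [u] moves by at most [O(h^(3/2))] at each step, by a third
   order Taylor expansion and Gaussian moment bounds. The real and imaginary parts
   of the characteristic function are obtained from the constant phases [0] and
   [- pi / 2]. *)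
Require Import Defs.
From HB Require Import structures.
From mathcomp Require Import all_boot all_order all_algebra.
From mathcomp Require Import all_classical all_reals all_analysis measurable_realfun.
From mathcomp.real_closed Require Import complex.
From mathcomp Require Import ring lra.
Set Implicit Arguments.
Unset Strict Implicit.
Unset Printing Implicit Defensive.

Import Order.TTheory GRing.Theory Num.Theory numFieldNormedType.Exports.
Local Open Scope classical_set_scope.
Local Open Scope ring_scope.

(** * Spectral decomposition *)

(** [is_ito_integral] only provides some sequence of elementary processes on unspecified
    subdivisions, whereas the expansion runs along equally spaced left sums; the isometry is
    therefore proved for arbitrary finite families of intervals. Conditional expectations are
    replaced by product rules: a weight measurable for the past, multiplied by an increment or by a
    centred product of two increments, has expectation zero. The profile is bounded by 1, but its
    exponent varies by amounts that grow with the position; the amplitude has to absorb the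
    exponential in the Taylor remainder, so that the errors grow only polynomially and Gaussian
    moments control them. Over [N = t / h] steps the local errors add up to [O(sqrt h)], the order
    of the Riemann sum error as well, and letting [N] grow identifies two numbers independent of
    [N]. As for the shift [2 gamma]: moving [(J, b)] by [(<Theta^T b, xi>, xi)] changes
    [J / 2 + <gamma, b>] by [<Theta^T b + 2 gamma, xi> / 2], so that area and position act through a
    single vector, in which the exponent is quadratic. *)

Section RealSpectral.
Variable R : realType.

(* Over [R[i]] the matrix is Hermitian, so that its eigenvalues are real. *)
Lemma symmetric_real_eigenvalue n (S : 'M[R]_n.+1) : S^T = S ->
  exists a : R, eigenvalue S a.
Proof.
move=> symS; pose f := real_complex R.
pose A := map_mx f S.
have hermA : A \is hermsymmx.
  apply/is_hermitianmxP; rewrite expr0 scale1r.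
  apply/matrixP => i j; rewrite !mxE.
  rewrite -{1}symS mxE; apply/esym/CrealP/complex_realP; by exists (S j i).
have /hermitian_normalmx/orthomx_spectralP := hermA.
have /mxOverP/(_ 0 0) := hermitian_spectral_diag_real hermA.
move=> /complex_realP[a ea] eA; exists a.
rewrite -(eigenvalue_map f) -/A; apply/eigenvalueP.
set P := spectralmx A in eA.
have uP : P \in unitmx by exact: spectral_unit.
exists (row 0 P).
  rewrite [X in _ *m X]eA !mulmxA -row_mul mulmxV// row1.
  by rewrite -rowE row_diag_mx ea -scalemxAl -rowE.
apply/negP => /eqP r0; move: (row_free_unit P); rewrite uP => /row_freeP[B PB].
have := congr1 (row 0) PB; rewrite row_mul r0 mul0mx => /rowP/(_ 0)/eqP.
by rewrite !mxE eqxx eq_sym oner_eq0.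
Qed.

(* The Householder reflection exchanging the first basis vector and [v]. *)
Lemma orthogonal_first_row n (v : 'rV[R]_n.+1) : v *m v^T = 1%:M ->
  exists H : 'M[R]_n.+1, H *m H^T = 1%:M /\ delta_mx 0 0 *m H = v.
Proof.
move=> vv; pose e : 'rV[R]_n.+1 := delta_mx 0 0.
have ee : e *m e^T = 1%:M by rewrite trmx_delta mul_delta_mx; apply/matrixP=> i j; rewrite !ord1 !mxE.
have [->|nev] := eqVneq v e.
  by exists 1%:M; rewrite trmx1 !mulmx1.
pose w := e - v; pose c := v 0 0.
have evT : v *m e^T = c%:M.
  apply/matrixP => i j; rewrite !ord1 trmx_delta -colE !mxE.
  by rewrite mulr1n.
have veT : e *m v^T = c%:M by rewrite -(trmxK (e *m v^T)) trmx_mul trmxK evT tr_scalar_mx.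
have eqw : w *m w^T = (2 * (1 - c))%:M.
  rewrite /w linearB/= mulmxBl !mulmxBr ee evT veT vv.
  by rewrite -!raddfB/=; congr (_%:M); ring.
have c1 : 1 - c != 0.
  apply/negP => /eqP c0; move: eqw; rewrite c0 mulr0 => /matrixP/(_ 0 0).
  rewrite !mxE mulr1n => /eqP; rewrite psumr_eq0; last by move=> i _; rewrite !mxE -expr2 sqr_ge0.
  move=> /allP h; move/eqP: nev; apply; apply/rowP => i.
  have := h i (mem_index_enum _); rewrite !mxE mulf_eq0 orbb subr_eq0.
  by move/eqP.
have ew : e *m w^T = (1 - c)%:M by rewrite /w linearB/= mulmxBr ee veT -raddfB.
have wE : w = e - v by [].
clearbody w.
(* Since [w *m w^T] is [2 * (1 - c)], this is the usual reflection [1 - 2 w^T w / |w|^2]. *)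
pose H := 1%:M - (1 - c)^-1 *: (w^T *m w).
have HT : H^T = H by rewrite /H linearB/= trmx1 linearZ/= trmx_mul trmxK.
exists H; split.
  rewrite HT {1}/H mulmxBl mul1mx /H mulmxBr mulmx1 -scalemxAl -scalemxAr.
  rewrite mulmxA -[w^T *m w *m _]mulmxA eqw -mulmxA mul_scalar_mx -scalemxAr !scalerA.
  rewrite -scalerBl -addrA -opprD -scalerDl [X in X *: _](_ : _ = 0).
    by rewrite scale0r subr0.
  by field.
rewrite -/e /H mulmxBr mulmx1 -scalemxAr mulmxA ew.
by rewrite mul_scalar_mx scalerA mulVf// scale1r wE opprB addrC subrK.
Qed.

(** Deflation: in an orthonormal basis starting with a normalised eigenvector, symmetry clears the
    rest of the first row and of the first column, and the remaining block is again symmetric. *)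
Theorem symmetric_spectral n (S : 'M[R]_n) : S^T = S ->
  exists (Q : 'M[R]_n) (l : 'rV[R]_n),
    Q *m Q^T = 1%:M /\ S = Q^T *m diag_mx l *m Q.
Proof.
elim: n S => [S _|n IH S symS].
  by exists 0, 0; split; apply/matrixP => -[].
have [a /eigenvalueP[v0 v0S v00]] := symmetric_real_eigenvalue symS.
pose c : R := (v0 *m v0^T) 0 0.
have c0 : 0 < c.
  rewrite /c mxE lt_neqAle eq_sym; apply/andP; split; last first.
    by apply: sumr_ge0 => i _; rewrite mxE -expr2 sqr_ge0.
  apply/negP; rewrite psumr_eq0; last by move=> i _; rewrite mxE -expr2 sqr_ge0.
  move=> /allP h; move/eqP: v00; apply; apply/rowP => i.
  by have := h i (mem_index_enum _); rewrite !mxE mulf_eq0 orbb => /eqP.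
pose v := (Num.sqrt c)^-1 *: v0.
have vv : v *m v^T = 1%:M.
  rewrite /v linearZ/= -scalemxAl -scalemxAr scalerA -invfM -expr2 sqr_sqrtr ?ltW//.
  apply/matrixP => i j; by rewrite !ord1 mxE -/c mxE mulVf ?eqxx// gt_eqF.
have vS : v *m S = a *: v by rewrite /v -scalemxAl v0S !scalerA mulrC.
have [H [HH eH]] := orthogonal_first_row vv.
have HH' := mulmx1C HH.
pose S' : 'M[R]_(1 + n) := H *m S *m H^T.
have symS' : S'^T = S' by rewrite /S' !trmx_mul trmxK symS mulmxA.
have r0 : delta_mx 0 0 *m S' = a *: (delta_mx 0 0 : 'rV_(1 + n)).
  by rewrite /S' !mulmxA eH vS -scalemxAl -eH -mulmxA HH mulmx1.
have S'E i : S' 0 i = a * (i == 0)%:R.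
  by move/rowP: r0 => /(_ i); rewrite -rowE !mxE.
have S'E' i : S' i 0 = a * (i == 0)%:R by rewrite -symS' mxE S'E.
have S'def : S' = H *m S *m H^T by [].
clearbody S'; pose S1 := drsubmx S'.
have l0 (i : 'I_1) : lshift n i = 0 :> 'I_n.+1.
  by apply/val_inj; rewrite /= ord1.
have eS' : S' = block_mx a%:M 0 0 S1.
  rewrite -[LHS]submxK; congr block_mx.
  - apply/matrixP => i j; rewrite !mxE.
    by rewrite !l0 S'E eqxx mulr1 !ord1.
  - apply/matrixP => i j; rewrite !mxE.
    by rewrite l0 S'E -val_eqE/= mulr0.
  - apply/matrixP => i j; rewrite !mxE.
    by rewrite l0 S'E' -val_eqE/= mulr0.
have symS1 : S1^T = S1 by rewrite /S1 trmx_drsub symS'.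
have [Q1 [l1 [QQ1 eS1]]] := IH S1 symS1.
pose Q0 : 'M[R]_(1 + n) := block_mx 1%:M 0 0 Q1.
have Q0Q0 : Q0 *m Q0^T = 1%:M.
  by rewrite /Q0 tr_block_mx mulmx_block !trmx1 !trmx0 !mulmx0 !mul0mx !mulmx1 !addr0 !add0r QQ1 -scalar_mx_block.
exists (Q0 *m H), (row_mx a%:M l1); split.
  by rewrite trmx_mul mulmxA -(mulmxA Q0) HH mulmx1 Q0Q0.
have -> : diag_mx (row_mx a%:M l1) = block_mx a%:M 0 0 (diag_mx l1).
  rewrite diag_mx_row; congr block_mx.
  by apply/matrixP => i j; rewrite !ord1 !mxE.
have -> : S = H^T *m S' *m H.
  by rewrite S'def -!mulmxA HH' mulmx1 !mulmxA HH' mul1mx.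
rewrite trmx_mul -!mulmxA; congr (_ *m _); rewrite !mulmxA; congr (_ *m _).
rewrite eS'; set D := block_mx a%:M _ _ (diag_mx l1).
have -> : Q0^T = block_mx 1%:M 0 0 Q1^T by rewrite /Q0 tr_block_mx !trmx1 !trmx0.
suff e : block_mx a%:M 0 0 S1 = block_mx 1%:M 0 0 Q1^T *m D *m Q0 by exact: e.
rewrite /D /Q0 !mulmx_block !mulmx0 !mul0mx !mulmx1 !mul1mx !addr0 !add0r.
by rewrite mul0mx -eS1.
Qed.

End RealSpectral.

(** * Spectral data of a skew-symmetric matrix *)

Section SkewSpectral.
Variables (R : realType) (d : nat) (Theta Q : 'M[R]_d) (l : 'rV[R]_d).
Hypothesis skewTheta : Theta^T = - Theta.
Hypothesis QQ : Q *m Q^T = 1%:M.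
Hypothesis spec : Theta^T *m Theta = Q^T *m diag_mx l *m Q.

Let G := Q *m Theta^T.

(** The rows of [G] are thus orthogonal, with the eigenvalues as squared lengths. This gives the
    sign of the eigenvalues, and later the norm of the gradient and the trace of the Hessian. *)
Lemma spectral_gram : G *m G^T = diag_mx l.
Proof.
rewrite /G trmx_mul trmxK mulmxA -(mulmxA Q) spec !mulmxA QQ mul1mx.
by rewrite -mulmxA QQ mulmx1.
Qed.

Lemma spectral_gramE k k' : \sum_j G k j * G k' j = l 0 k *+ (k == k').
Proof.
move/matrixP: spectral_gram => /(_ k k'); rewrite mxE [in RHS]mxE => <-.
by apply: eq_bigr => j _; rewrite [G^T _ _]mxE.
Qed.

Lemma spectral_ge0 k : 0 <= l 0 k.
Proof.
have := spectral_gramE k k; rewrite eqxx mulr1n => <-.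
by apply: sumr_ge0 => j _; rewrite -expr2 sqr_ge0.
Qed.

Lemma mxmodulus_spectral :
  mxmodulus Theta = Q^T *m diag_mx (map_mx Num.sqrt l) *m Q.
Proof. by rewrite /mxmodulus spec mxfunE. Qed.

Lemma mxfun_modulus (f : R -> R) (c : R) :
  mxfun f (c *: mxmodulus Theta) =
  Q^T *m diag_mx (map_mx (fun x => f (c * Num.sqrt x)) l) *m Q.
Proof.
rewrite mxmodulus_spectral.
have -> : c *: (Q^T *m diag_mx (map_mx Num.sqrt l) *m Q) =
    Q^T *m diag_mx (map_mx (fun x => c * Num.sqrt x) l) *m Q.
  rewrite scalemxAl scalemxAr; congr (_ *m _ *m _).
  by apply/matrixP => i j; rewrite !mxE mulrnAr.
rewrite mxfunE//; congr (_ *m diag_mx _ *m _).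
by apply/matrixP => i j; rewrite !mxE.
Qed.

Lemma det_spectral (m : 'rV[R]_d) :
  \det (Q^T *m diag_mx m *m Q) = \prod_k m 0 k.
Proof.
rewrite !det_mulmx det_diag mulrAC -det_mulmx (mulmx1C QQ).
by rewrite det1 mul1r.
Qed.

Lemma quad_spectral_div (m1 m2 : 'rV[R]_d) (g : 'cV[R]_d) :
  (forall k, m2 0 k != 0) ->
  (g^T *m ((Q^T *m diag_mx m1 *m Q) *m invmx (Q^T *m diag_mx m2 *m Q)) *m g) 0 0
  = \sum_k m1 0 k / m2 0 k * ((Q *m g) k 0) ^+ 2.
Proof.
move=> m20; pose m3 : 'rV[R]_d := \row_k (m2 0 k)^-1.
have m23 : diag_mx m2 *m diag_mx m3 = 1%:M.
  rewrite mulmx_diag; apply/matrixP => i j; rewrite !mxE.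
  by rewrite divff.
have inv : (Q^T *m diag_mx m2 *m Q) *m (Q^T *m diag_mx m3 *m Q) = 1%:M.
  rewrite !mulmxA -(mulmxA (Q^T *m _)) QQ mulmx1 -(mulmxA Q^T) m23 mulmx1.
  exact: mulmx1C.
have -> : invmx (Q^T *m diag_mx m2 *m Q) = Q^T *m diag_mx m3 *m Q.
  have [uM _] := mulmx1_unit inv.
  by rewrite -[RHS](mulKmx uM) inv mulmx1.
rewrite !mulmxA -(mulmxA (g^T *m Q^T *m diag_mx m1)) QQ mulmx1.
rewrite -(mulmxA (g^T *m Q^T)) mulmx_diag -mulmxA -trmx_mul mxE.
apply: eq_bigr => k _; rewrite mul_mx_diag !mxE.
by ring.
Qed.

(* [Theta] commutes with the functions of [Theta^T Theta] and is skew, so that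
   this is a quadratic form with a skew matrix. *)
Lemma spectral_cross (f : R -> R) (y : 'I_d -> R) :
  \sum_j (\sum_k y k * f (l 0 k) * G k j) * (\sum_k Q k j * y k) = 0.
Proof.
pose Y : 'rV[R]_d := \row_k y k; pose D := diag_mx (map_mx f l).
pose Om := G *m Q^T.
have skewOm : Om^T = - Om.
  by rewrite /Om /G !trmx_mul !trmxK mulmxA skewTheta mulmxN mulNmx opprK.
(* [Om] is [Theta^T] written in the eigenbasis; its square is diagonal and it commutes with its own
   square. *)
have OmOm : Om *m Om = - diag_mx l.
  rewrite -[X in _ *m X]opprK -skewOm mulmxN; congr (- _).
  by rewrite /Om trmx_mul trmxK mulmxA -(mulmxA G) (mulmx1C QQ) mulmx1 spectral_gram.
have OmE : Om = G *m Q^T by [].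
clearbody Om.
have commOm : diag_mx l *m Om = Om *m diag_mx l.
  by rewrite -[diag_mx l]opprK -OmOm !mulNmx mulmxN mulmxA.
(* Commuting with [diag_mx l] means that [Om i j] vanishes unless [l 0 i = l 0 j], so commutation
   extends to every function of [l]. *)
have commD : D *m Om = Om *m D.
  apply/matrixP => i j; move/matrixP: commOm => /(_ i j).
  rewrite !mul_diag_mx !mul_mx_diag !mxE mulrC => /eqP.
  rewrite -subr_eq0 -mulrBr mulf_eq0 => /orP[/eqP->|].
    by rewrite mulr0 mul0r.
  by rewrite subr_eq0 => /eqP->; rewrite mulrC.
have skewX : (D *m Om)^T = - (D *m Om).
  by rewrite trmx_mul skewOm tr_diag_mx mulNmx commD.
have -> : \sum_j (\sum_k y k * f (l 0 k) * G k j) * (\sum_k Q k j * y k)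
    = (Y *m (D *m Om) *m Y^T) 0 0.
  rewrite OmE; move: (G) => G'; rewrite !mulmxA -(mulmxA _ Q^T) mxE; apply: eq_bigr => j _.
  congr (_ * _).
    rewrite mxE; apply: eq_bigr => k _.
    by rewrite mul_mx_diag !mxE.
  by rewrite mxE; apply: eq_bigr => k _; rewrite !mxE.
set x := _ 0 0.
have : (Y *m (D *m Om) *m Y^T)^T 0 0 = - x.
  by rewrite !trmx_mul trmxK mulmxA -trmx_mul skewX mulmxN mulNmx mxE.
rewrite mxE -/x; lra.
Qed.

End SkewSpectral.

(** * Taylor bounds and the Riccati equation *)

Section ElementaryBounds.
Variable R : realType.
Implicit Types (f df : R -> R) (a b h p q x : R).

Lemma MVT_le f df a b : a <= b -> (forall x, is_derive x 1 f (df x)) ->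
  exists2 c, a <= c <= b & f b - f a = df c * (b - a).
Proof.
move=> ab fdf; have fc : {within `[a, b], continuous f}.
  apply: derivable_within_continuous => x _.
  by apply: ex_derive; exact: fdf.
have [c cab fab] := MVT_segment ab (fun x _ => fdf x) fc.
by exists c.
Qed.

(** The derivative of each Taylor remainder below is, up to sign, a remainder of lower order, so
    every use gains a factor [|x|]. The bound by [Num.max 0 x] keeps [expR c] under control without
    absolute values. *)
Lemma MVT0 f df x : (forall x, is_derive x 1 f (df x)) -> f 0 = 0 ->
  exists2 c, `|c| <= `|x| /\ c <= Num.max 0 x & f x = df c * x.
Proof.
move=> fdf f0; have [x0|x0] := leP 0 x.
  have [c /andP[c0 cx]] := MVT_le x0 fdf.
  by rewrite f0 !subr0 => ->; exists c; rewrite // !ger0_norm.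
have [c /andP[c0 cx]] := MVT_le (ltW x0) fdf.
rewrite f0 !sub0r mulrN => /eqP; rewrite eqr_opp => /eqP ->; exists c => //.
by rewrite !ler0_norm ?(ltW x0)// lerN2.
Qed.

(** Preferred to [expR |q|] because of [amplitude_le]: a weight [a] with [a <= 1] and
    [a * expR q <= 1] makes [a * M q] at most 1, however large [|q|] is. *)
Let M q := Num.max 1 (expR q).

Let expR_leM c q : c <= Num.max 0 q -> expR c <= M q.
Proof.
rewrite /M le_max => /orP[c0|cq]; rewrite le_max.
  by rewrite -[X in _ <= X]expR0 ler_expR c0.
by rewrite ler_expR cq orbT.
Qed.

Let M_le c q : c <= Num.max 0 q -> M c <= M q.
Proof. by move=> cq; rewrite ge_max expR_leM// /M le_max lexx. Qed.

Let M0 q : 0 <= M q. Proof. by rewrite /M le_max ler01. Qed.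

Lemma expR_taylor1 q : `|expR q - 1| <= `|q| * M q.
Proof.
have d x : is_derive x 1 (fun q => expR q - 1) (expR x).
  by apply: is_derive_eq; rewrite subr0.
have [|c [cq cM] ->] := MVT0 q d; first by rewrite expR0 subrr.
by rewrite normrM mulrC ler_wpM2l// ger0_norm ?expR_ge0// expR_leM.
Qed.

Lemma expR_taylor2 q : `|expR q - 1 - q| <= `|q| ^+ 2 * M q.
Proof.
have d x : is_derive x 1 (fun q => expR q - 1 - q) (expR x - 1).
  by apply: is_derive_eq; rewrite subr0.
have [|c [cq cM] ->] := MVT0 q d; first by rewrite expR0 subrr subr0.
rewrite normrM mulrC expr2 -mulrA ler_wpM2l//.
by rewrite (le_trans (expR_taylor1 c))// ler_pM// M_le.
Qed.

Lemma expR_taylor3 q : `|expR q - 1 - q - q ^+ 2 / 2| <= `|q| ^+ 3 * M q.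
Proof.
have d x : is_derive x 1 (fun q => expR q - 1 - q - q ^+ 2 / 2) (expR x - 1 - x).
  by apply: is_derive_eq; rewrite /GRing.scale/=; field.
have [|c [cq cM] ->] := MVT0 q d.
  by rewrite expR0 subrr expr0n/= mul0r !subr0.
rewrite normrM mulrC exprS -mulrA ler_wpM2l//.
rewrite (le_trans (expR_taylor2 c))// ler_pM// ?M_le//.
by rewrite ler_pXn2r// nnegrE.
Qed.

Lemma cos_taylor1 p : `|cos p - 1| <= `|p|.
Proof.
have d x : is_derive x 1 (fun q : R => cos q - 1) (- sin x).
  by apply: is_derive_eq; rewrite subr0.
have [|c _ ->] := MVT0 p d; first by rewrite cos0 subrr.
by rewrite normrM normrN ler_piMl// ler_norml sin_geN1 sin_le1.
Qed.

Lemma sin_taylor2 p : `|sin p - p| <= `|p| ^+ 2.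
Proof.
have d x : is_derive x 1 (fun q : R => sin q - q) (cos x - 1).
  by apply: is_derive_eq.
have [|c [cp _] ->] := MVT0 p d; first by rewrite sin0 subrr.
by rewrite normrM expr2 ler_wpM2r// (le_trans (cos_taylor1 c)).
Qed.

Lemma sin_taylor1 p : `|sin p| <= `|p|.
Proof.
have [|c [cp _] ->] := @MVT0 (@sin R) (@cos R) p _; last 1 first.
- by rewrite normrM ler_piMl// ler_norml cos_geN1 cos_le1.
- by rewrite sin0.
Qed.

Lemma cos_taylor2 p : `|cos p - 1| <= `|p| ^+ 2.
Proof.
have d x : is_derive x 1 (fun q : R => cos q - 1) (- sin x).
  by apply: is_derive_eq; rewrite subr0.
have [|c [cp _] ->] := MVT0 p d; first by rewrite cos0 subrr.
by rewrite normrM normrN expr2 ler_wpM2r// (le_trans (sin_taylor1 c)).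
Qed.

Lemma sin_taylor3 p : `|sin p - p| <= `|p| ^+ 3.
Proof.
have d x : is_derive x 1 (fun q : R => sin q - q) (cos x - 1).
  by apply: is_derive_eq.
have [|c [cp _] ->] := MVT0 p d; first by rewrite sin0 subrr.
rewrite normrM exprSr ler_wpM2r// (le_trans (cos_taylor2 c))//.
by rewrite ler_pXn2r// nnegrE.
Qed.

Lemma cos_taylor3 p : `|cos p - 1 + p ^+ 2 / 2| <= `|p| ^+ 3.
Proof.
have d x : is_derive x 1 (fun q : R => cos q - 1 + q ^+ 2 / 2) (- (sin x - x)).
  by apply: is_derive_eq; rewrite /GRing.scale/=; field.
have [|c [cp _] ->] := MVT0 p d.
  by rewrite cos0 subrr expr0n/= mul0r addr0.
rewrite normrM normrN exprSr ler_wpM2r// (le_trans (sin_taylor2 c))//.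
by rewrite ler_pXn2r// nnegrE.
Qed.

Lemma cos_le_norm1 p : `|cos p| <= 1 :> R.
Proof. by rewrite ler_norml cos_geN1 cos_le1. Qed.

Lemma sin_le_norm1 p : `|sin p| <= 1 :> R.
Proof. by rewrite ler_norml sin_geN1 sin_le1. Qed.

(** When [p] and [q] are of order [sqrt h], the subtracted part collects everything up to order [h],
    including the mixed term [q * p]. *)
Lemma expR_cos_taylor psi p q :
  `|expR q * cos (psi + p)
    - (cos psi * (1 + q + q ^+ 2 / 2 - p ^+ 2 / 2) - sin psi * (p + q * p))|
  <= 4 * (`|q| + `|p|) ^+ 3 * Num.max 1 (expR q).
Proof.
rewrite -/(M q).
have -> : expR q * cos (psi + p)
    - (cos psi * (1 + q + q ^+ 2 / 2 - p ^+ 2 / 2) - sin psi * (p + q * p)) =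
  cos psi * (expR q * (cos p - 1 + p ^+ 2 / 2) + (expR q - 1 - q - q ^+ 2 / 2)
      - p ^+ 2 / 2 * (expR q - 1))
  - sin psi * (expR q * (sin p - p) + p * (expR q - 1 - q)).
  by rewrite cosD; field.
have MR : expR q <= M q by rewrite expR_leM// le_max lexx orbT.
have e1 : `|expR q * (cos p - 1 + p ^+ 2 / 2)| <= `|p| ^+ 3 * M q.
  by rewrite normrM mulrC ler_pM// ?cos_taylor3// ger0_norm ?expR_ge0.
have e2 := expR_taylor3 q.
have e3 : `|p ^+ 2 / 2 * (expR q - 1)| <= `|p| ^+ 2 * (`|q| * M q).
  rewrite normrM ler_pM//; last exact: expR_taylor1.
  by rewrite normrM normrX ler_piMr// ger0_norm// invf_le1// ler1n.
have e4 : `|expR q * (sin p - p)| <= `|p| ^+ 3 * M q.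
  by rewrite normrM mulrC ler_pM// ?sin_taylor3// ger0_norm ?expR_ge0.
have e5 : `|p * (expR q - 1 - q)| <= `|p| * (`|q| ^+ 2 * M q).
  by rewrite normrM ler_wpM2l// expR_taylor2.
apply: (@le_trans _ _ ((`|p| ^+ 3 * M q + `|q| ^+ 3 * M q + `|p| ^+ 2 * (`|q| * M q))
   + (`|p| ^+ 3 * M q + `|p| * (`|q| ^+ 2 * M q)))).
  rewrite (le_trans (ler_normB _ _))// lerD//.
    rewrite normrM -[leRHS]mul1r ler_pM// ?cos_le_norm1//.
    rewrite (le_trans (ler_normB _ _))// lerD//.
    by rewrite (le_trans (ler_normD _ _))// lerD.
  rewrite normrM -[leRHS]mul1r ler_pM// ?sin_le_norm1//.
  by rewrite (le_trans (ler_normD _ _))// lerD.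
have := M0 q; move: (M q) (normr_ge0 p) (normr_ge0 q) => m.
move: `|p| `|q| => u v u0 v0 m0.
have -> : u ^+ 3 * m + v ^+ 3 * m + u ^+ 2 * (v * m) +
  (u ^+ 3 * m + u * (v ^+ 2 * m)) =
  (2 * u ^+ 3 + v ^+ 3 + u ^+ 2 * v + u * v ^+ 2) * m by ring.
rewrite ler_wpM2r// -subr_ge0.
have -> : 4 * (v + u) ^+ 3 - (2 * u ^+ 3 + v ^+ 3 + u ^+ 2 * v + u * v ^+ 2)
  = 2 * u ^+ 3 + 3 * v ^+ 3 + 11 * (u ^+ 2 * v) + 11 * (u * v ^+ 2) by ring.
by rewrite !addr_ge0// !mulr_ge0// exprn_ge0.
Qed.

End ElementaryBounds.

(** * Hyperbolic functions and the Riccati equation *)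

Section Riccati.
Variable R : realType.
Implicit Types (lam tau h x : R).

Lemma cosh_ge1 x : 1 <= cosh x.
Proof.
rewrite /cosh ler_pdivlMr// mul1r expRN -subr_ge0.
have e0 := expR_gt0 x; set e := expR x in e0 *.
have -> : e + e^-1 - 2 = (e - 1) ^+ 2 / e by field; rewrite gt_eqF.
by rewrite divr_ge0 ?sqr_ge0// ltW.
Qed.

Lemma cosh_gt0 x : 0 < cosh x.
Proof. exact: lt_le_trans (cosh_ge1 x). Qed.

Lemma cosh_neq0 x : cosh x != 0.
Proof. by rewrite gt_eqF// cosh_gt0. Qed.

Lemma sqr_cosh_sinh x : cosh x ^+ 2 - sinh x ^+ 2 = 1.
Proof.
rewrite /cosh /sinh; transitivity (expR x * expR (- x)); first by field.
by rewrite -expRD subrr expR0.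
Qed.

Lemma is_derive_cosh x : is_derive x 1 (@cosh R) (sinh x).
Proof.
by apply: is_derive_eq; rewrite /GRing.scale/= /sinh; field.
Qed.

Lemma is_derive_sinh x : is_derive x 1 (@sinh R) (cosh x).
Proof.
by apply: is_derive_eq; rewrite /GRing.scale/= /cosh; field.
Qed.

(* [riccati lam tau] is [tanh (tau lam / 2) / lam], extended by continuity to
   [lam = 0]; it solves [T' = (1 - lam^2 T^2) / 2], [T 0 = 0]. *)
Definition riccati lam tau := tau / 2 * (sinch (tau / 2 * lam) / cosh (tau / 2 * lam)).

Definition ln_cosh lam tau := ln (cosh (tau / 2 * lam)).

Lemma riccati0 lam : riccati lam 0 = 0.
Proof. by rewrite /riccati !mul0r. Qed.

Lemma ln_cosh0 lam : ln_cosh lam 0 = 0.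
Proof. by rewrite /ln_cosh !mul0r /cosh oppr0 expR0 divff// ln1. Qed.

Lemma ln_cosh_ge0 lam tau : 0 <= ln_cosh lam tau.
Proof. by rewrite ln_ge0// cosh_ge1. Qed.

Lemma riccatiE lam tau : lam != 0 ->
  riccati lam tau = sinh (tau / 2 * lam) / cosh (tau / 2 * lam) / lam.
Proof.
move=> lam0; rewrite /riccati /sinch; case: eqP => [/eqP|/eqP].
  rewrite mulf_eq0 (negbTE lam0) orbF mulf_eq0 invr_eq0 pnatr_eq0 orbF => /eqP ->.
  by rewrite !mul0r /sinh oppr0 subrr !mul0r.
have := cosh_neq0 (tau / 2 * lam); move: (cosh _) (sinh _) => c s c0.
by rewrite !mulf_eq0 !negb_or => /andP[/andP[t0 _] _]; field; rewrite lam0 c0 t0.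
Qed.

(** This is [1 - tanh^2 = cosh^-2]. It places the right-hand side of the Riccati equation between 0
    and 1/2, whence bounds uniform in [lam]. *)
Lemma riccati_cosh lam tau :
  1 - lam ^+ 2 * riccati lam tau ^+ 2 = (cosh (tau / 2 * lam))^-1 ^+ 2.
Proof.
have [->|lam0] := eqVneq lam 0.
  by rewrite expr0n/= mul0r subr0 !mulr0 /cosh oppr0 expR0 divff// invr1 expr1n.
rewrite riccatiE//; have := sqr_cosh_sinh (tau / 2 * lam).
have := cosh_neq0 (tau / 2 * lam); move: (cosh _) (sinh _) => c s c0 cs.
apply: (@mulIf _ (c ^+ 2)); first by rewrite expf_neq0.
have -> : c^-1 ^+ 2 * c ^+ 2 = 1 by field.
by rewrite -[RHS]cs; field; rewrite c0 lam0.
Qed.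

Lemma is_derive_riccati lam tau :
  is_derive tau 1 (riccati lam) ((1 - lam ^+ 2 * riccati lam tau ^+ 2) / 2).
Proof.
have [->|lam0] := eqVneq lam 0.
  have -> : riccati 0 = fun t => t / 2.
    apply/funext => t; rewrite /riccati !mulr0 /sinch eqxx /cosh oppr0 expR0.
    by rewrite !divff// mulr1.
  by apply: is_derive_eq; rewrite /GRing.scale/=; field.
rewrite riccati_cosh.
have -> : riccati lam = fun t =>
    sinh (t / 2 * lam) * (cosh (t / 2 * lam))^-1 * lam^-1.
  by apply/funext => t; rewrite riccatiE.
have dl : is_derive tau 1 (fun t : R => t / 2 * lam) (lam / 2).
  by apply: is_derive_eq; rewrite /GRing.scale/=; field.
have ds : is_derive tau 1 (fun t => sinh (t / 2 * lam))
    (cosh (tau / 2 * lam) * (lam / 2)).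
  exact: (@is_derive1_comp _ (@sinh R) _ _ _ _ (is_derive_sinh _) dl).
have dc : is_derive tau 1 (fun t => cosh (t / 2 * lam))
    (sinh (tau / 2 * lam) * (lam / 2)).
  exact: (@is_derive1_comp _ (@cosh R) _ _ _ _ (is_derive_cosh _) dl).
have dv := @is_deriveV _ (fun t => cosh (t / 2 * lam)) _ _ _ (cosh_neq0 (tau / 2 * lam)) dc.
apply: is_derive_eq; rewrite /GRing.scale/=.
have := sqr_cosh_sinh (tau / 2 * lam).
have := cosh_neq0 (tau / 2 * lam); move: (cosh _) (sinh _) => c s c0 cs.
apply: (@mulIf _ (2 * c ^+ 2)); first by rewrite mulf_neq0// expf_neq0.
transitivity (c ^+ 2 - s ^+ 2).
  by field; rewrite c0 lam0.
by rewrite cs; field.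
Qed.

Lemma is_derive_ln_cosh lam tau :
  is_derive tau 1 (ln_cosh lam) (lam ^+ 2 * riccati lam tau / 2).
Proof.
have dl : is_derive tau 1 (fun t : R => t / 2 * lam) (lam / 2).
  by apply: is_derive_eq; rewrite /GRing.scale/=; field.
have dc := @is_derive1_comp _ (@cosh R) _ _ _ _ (is_derive_cosh _) dl.
have dn := @is_derive1_comp _ (@ln R) (fun t => cosh (t / 2 * lam)) _ _ _ (is_derive1_ln (cosh_gt0 _)) dc.
apply: is_derive_eq.
have [->|lam0] := eqVneq lam 0.
  by rewrite expr0n/= !mul0r !mulr0.
rewrite riccatiE//=.
have := cosh_neq0 (tau / 2 * lam); move: (cosh _) (sinh _) => c s c0.
by field; rewrite c0 lam0.
Qed.

Lemma riccati_le lam a b : a <= b ->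
  0 <= riccati lam b - riccati lam a <= (b - a) / 2.
Proof.
move=> ab; have [c _ ->] := MVT_le ab (is_derive_riccati lam).
rewrite riccati_cosh; have c1 := cosh_ge1 (c / 2 * lam).
have : 0 <= (cosh (c / 2 * lam))^-1 ^+ 2 <= 1.
  by rewrite sqr_ge0/= exprn_ile1// ?invr_ge0 ?invf_le1 ?cosh_gt0// ltW// cosh_gt0.
move: (_ ^+ 2) => m /andP[m0 m1]; have ab0 : 0 <= b - a by rewrite subr_ge0.
by rewrite mulr_ge0 ?divr_ge0//= mulrC mulrA ler_pM2r// ler_piMr.
Qed.

Lemma riccati_bound lam tau : 0 <= tau -> 0 <= riccati lam tau <= tau / 2.
Proof. by move=> /(riccati_le lam); rewrite riccati0 !subr0. Qed.

(** The mean value theorem gives the derivative at an intermediate point, and [riccati_le] makes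
    that derivative Lipschitz; no second derivative is computed. The same holds for
    [riccati_taylor]. *)
Lemma ln_cosh_taylor lam tau h : 0 <= h ->
  `|ln_cosh lam (tau + h) - ln_cosh lam tau - h * (lam ^+ 2 * riccati lam tau / 2)|
  <= lam ^+ 2 * h ^+ 2.
Proof.
move=> h0; have th : tau <= tau + h by rewrite lerDl.
have [c /andP[tc ch] ->] := MVT_le th (is_derive_ln_cosh lam).
have /andP[Tc0 Tc] := riccati_le lam tc.
rewrite addrAC subrr add0r.
have -> : lam ^+ 2 * riccati lam c / 2 * h - h * (lam ^+ 2 * riccati lam tau / 2)
  = lam ^+ 2 * (h * ((riccati lam c - riccati lam tau) / 2)) by field.
rewrite normrM ger0_norm ?sqr_ge0// ler_wpM2l ?sqr_ge0// normrM ger0_norm//.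
rewrite expr2 ler_wpM2l// ger0_norm ?divr_ge0//.
by move: Tc; lra.
Qed.

Lemma riccati_taylor lam tau h : 0 <= tau -> 0 <= h ->
  `|riccati lam (tau + h) - riccati lam tau
     - h * ((1 - lam ^+ 2 * riccati lam tau ^+ 2) / 2)|
  <= (tau + h) * lam ^+ 2 * h ^+ 2.
Proof.
move=> tau0 h0; have th : tau <= tau + h by rewrite lerDl.
have [c /andP[tc ch] ->] := MVT_le th (is_derive_riccati lam).
have /andP[Tc0 Tc] := riccati_le lam tc.
have c0 := le_trans tau0 tc.
have /andP[C0 C1] := riccati_bound lam c0.
have /andP[D0 D1] := riccati_bound lam tau0.
rewrite addrAC subrr add0r distrC.
set u := riccati lam c in Tc Tc0 C0 C1 *; set v := riccati lam tau in Tc Tc0 D0 D1 *.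
have -> : h * ((1 - lam ^+ 2 * v ^+ 2) / 2) - (1 - lam ^+ 2 * u ^+ 2) / 2 * h
  = lam ^+ 2 * (((u - v) * h) * ((u + v) / 2)) by field.
rewrite normrM ger0_norm ?sqr_ge0// [leRHS]mulrAC mulrC ler_wpM2r ?sqr_ge0//.
rewrite ger0_norm; last by rewrite !mulr_ge0// addr_ge0.
rewrite [leRHS]mulrC ler_pM ?mulr_ge0//; first by rewrite addr_ge0.
  rewrite expr2 ler_wpM2r//; lra.
lra.
Qed.

End Riccati.

(** * Expectations and Gaussian moments *)

Section Expectation.
Context {disp : measure_display} {T : measurableType disp} {R : realType}.
Variable P : probability T R.
Implicit Types (f g : T -> R) (c : R).

Definition L1 f : Prop := P.-integrable [set: T] (EFin \o f).

Definition Ex f : R := \int[P]_w f w.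

Lemma L1_measurable f : L1 f -> measurable_fun [set: T] f.
Proof. by move=> /measurable_int/measurable_EFinP. Qed.

Lemma L1_le f g : measurable_fun [set: T] f -> L1 g ->
  (forall w, `|f w| <= g w) -> L1 f.
Proof.
move=> mf Lg fg; apply: le_integrable Lg => //; first exact/measurable_EFinP.
by move=> w _ /=; rewrite lee_fin (le_trans (fg w))// ler_norm.
Qed.

Lemma L1_cst c : L1 (cst c).
Proof. exact: finite_measure_integrable_cst. Qed.

Lemma L1D f g : L1 f -> L1 g -> L1 (fun w => f w + g w).
Proof. by move=> Lf Lg; have := integrableD measurableT Lf Lg. Qed.

Lemma L1Z c f : L1 f -> L1 (fun w => c * f w).
Proof. by move=> Lf; have := integrableZl measurableT c Lf. Qed.

Lemma L1B f g : L1 f -> L1 g -> L1 (fun w => f w - g w).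
Proof. by move=> Lf Lg; have := integrableB measurableT Lf Lg. Qed.

Lemma L1_sum (I : Type) (s : seq I) (Q : pred I) (F : I -> T -> R) :
  (forall i, Q i -> L1 (F i)) -> L1 (fun w => \sum_(i <- s | Q i) F i w).
Proof.
move=> LF; have := integrable_sum measurableT s LF.
by apply: eq_integrable => // w _ /=; rewrite sumEFin.
Qed.

Lemma L1_abs f : L1 f -> L1 (fun w => `|f w|).
Proof.
move=> Lf; have := integrable_abse Lf.
by apply: eq_integrable.
Qed.

Lemma ExD f g : L1 f -> L1 g -> Ex (fun w => f w + g w) = Ex f + Ex g.
Proof. by move=> Lf Lg; rewrite /Ex RintegralD. Qed.

Lemma ExB f g : L1 f -> L1 g -> Ex (fun w => f w - g w) = Ex f - Ex g.
Proof. by move=> Lf Lg; rewrite /Ex RintegralB. Qed.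

Lemma ExZ c f : L1 f -> Ex (fun w => c * f w) = c * Ex f.
Proof. by move=> Lf; rewrite /Ex RintegralZl. Qed.

Lemma Ex_cst c : Ex (cst c) = c.
Proof. by rewrite /Ex Rintegral_cst//= probability_setT mulr1. Qed.

Lemma eq_Ex f g : f =1 g -> Ex f = Ex g.
Proof. by move=> /funext ->. Qed.

Lemma Ex_sum (I : Type) (s : seq I) (Q : pred I) (F : I -> T -> R) :
  (forall i, Q i -> L1 (F i)) ->
  Ex (fun w => \sum_(i <- s | Q i) F i w) = \sum_(i <- s | Q i) Ex (F i).
Proof.
move=> LF; elim: s => [|i s IH].
  by rewrite big_nil -[RHS](Ex_cst 0); apply: eq_Ex => w; rewrite big_nil.
rewrite big_cons; case: ifPn => Qi; last first.
  by rewrite -IH; apply: eq_Ex => w; rewrite big_cons (negbTE Qi).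
rewrite -IH -ExD; [|exact: LF|exact: L1_sum].
by apply: eq_Ex => w; rewrite big_cons Qi.
Qed.

Lemma le_Ex f g : L1 f -> L1 g -> (forall w, f w <= g w) -> Ex f <= Ex g.
Proof. by move=> Lf Lg fg; rewrite /Ex le_Rintegral. Qed.

Lemma le_norm_Ex f g : L1 f -> L1 g -> (forall w, `|f w| <= g w) ->
  `|Ex f| <= Ex g.
Proof.
move=> Lf Lg fg; rewrite (le_trans (le_normr_Rintegral measurableT Lf))//.
by apply: le_Ex => //; exact: L1_abs.
Qed.

Lemma L1_bounded f c : measurable_fun [set: T] f -> (forall w, `|f w| <= c) ->
  L1 f.
Proof. by move=> mf fc; apply: (@L1_le _ (cst c)) => //; exact: L1_cst. Qed.

Lemma ExE f : L1 f -> (Ex f)%:E = (\int[P]_w (f w)%:E)%E.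
Proof. by move=> Lf; rewrite /Ex /Rintegral fineK//; exact: integrable_fin_num. Qed.

Lemma L1_ge0 f c : measurable_fun [set: T] f -> (forall w, 0 <= f w) ->
  (\int[P]_w (f w)%:E <= c%:E)%E -> L1 f /\ Ex f <= c.
Proof.
move=> mf f0 fc; suff Lf : L1 f by split=> //; rewrite -lee_fin ExE.
apply/integrableP; split; first exact/measurable_EFinP.
under eq_integral do rewrite /= ger0_norm//.
by rewrite (le_lt_trans fc)// ltry.
Qed.

Lemma ae_eq_Ex f g : measurable_fun [set: T] f -> measurable_fun [set: T] g ->
  {ae P, forall w, f w = g w} -> Ex f = Ex g.
Proof.
move=> mf mg fg; rewrite /Ex /Rintegral; congr fine; apply: ae_eq_integral => //.
- exact/measurable_EFinP.
- exact/measurable_EFinP.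
- by apply: filterS fg => w fgw _ /=; rewrite fgw.
Qed.

End Expectation.

(** * Integration against a measure with a density *)

Section Density.
Context {disp : measure_display} {T : measurableType disp} {R : realType}.
Variables (mu nu : {measure set T -> \bar R}) (p : T -> R).
Hypothesis mp : measurable_fun [set: T] p.
Hypothesis p0 : forall x, 0 <= p x.
Hypothesis nuE : forall A, measurable A -> nu A = (\int[mu]_(x in A) (p x)%:E)%E.

Let density_indic A : measurable A ->
  (\int[nu]_x (\1_A x)%:E = \int[mu]_x ((\1_A x)%:E * (p x)%:E))%E.
Proof.
move=> mA; rewrite integral_indic//= setIT nuE// integral_mkcond.
apply: eq_integral => x _; rewrite patchE indicE.
by case: ifPn => _; rewrite ?mul1e ?mul0e.
Qed.

Import HBNNSimple.

Let density_nnsfun (f : {nnsfun T >-> R}) :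
  (\int[nu]_x (f x)%:E = \int[mu]_x ((f x)%:E * (p x)%:E))%E.
Proof.
under [LHS]eq_integral do rewrite fimfunE -fsumEFin//.
rewrite [LHS]ge0_integral_fsum//; last 2 first.
  - by move=> r; exact/measurable_EFinP/measurableT_comp.
  - by move=> n x _; rewrite EFinM nnfun_muleindic_ge0.
under [RHS]eq_integral.
  move=> x _; rewrite fimfunE -fsumEFin// muleC ge0_mule_fsumr; last first.
    by move=> r; rewrite EFinM nnfun_muleindic_ge0.
  over.
rewrite [RHS]ge0_integral_fsum//; last 2 first.
  - move=> r; apply/measurable_EFinP; apply: measurable_funM => //.
    exact/measurableT_comp.
  - move=> n x _; rewrite mule_ge0//; first by rewrite lee_fin.
    by rewrite EFinM nnfun_muleindic_ge0.
apply: eq_fsbigr => r _.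
(* A negative [r] is not a value of [f], so its fibre is empty; for the other values the integrand
   is nonnegative and [r] can be pulled out. *)
have [r0|r0] := leP 0 r; last first.
  have fr0 : f @^-1` [set r] = set0.
    by rewrite -subset0 => x /= fx; move: r0; rewrite -fx ltNge fun_ge0.
  rewrite fr0 !integral0_eq// => x _; rewrite indic0 mulr0//.
  by rewrite mule0.
under eq_integral do rewrite EFinM.
rewrite ge0_integralZl//; last exact/measurable_EFinP.
rewrite density_indic// -ge0_integralZl//.
- by apply: eq_integral => x _; rewrite -!EFinM; congr EFin; ring.
- apply/measurable_EFinP; exact: measurable_funM.
- by move=> x _; rewrite lee_fin mulr_ge0.
Qed.

(** The law of an increment is given by its values on sets only. Simple functions increasing to [f]
    and monotone convergence on both sides turn this into a formula for integrals. *)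
Lemma ge0_integral_density (f : T -> R) : measurable_fun [set: T] f ->
  (forall x, 0 <= f x) ->
  (\int[nu]_x (f x)%:E = \int[mu]_x (f x * p x)%:E)%E.
Proof.
move=> mf f0.
have mf' : measurable_fun [set: T] (EFin \o f) by exact/measurable_EFinP.
pose f_ := nnsfun_approx measurableT mf'.
transitivity (lim (\int[nu]_x (f_ n x)%:E @[n --> \oo])%E).
  rewrite -monotone_convergence//=.
  - apply: eq_integral => x _; apply/esym/cvg_lim => //=.
    by apply: cvg_nnsfun_approx => // y _; rewrite /= lee_fin.
  - by move=> n; exact/measurable_EFinP/measurable_funTS.
  - by move=> n ? _; rewrite lee_fin.
  - by move=> ? _ ? ? mn; rewrite lee_fin; exact/lefP/nd_nnsfun_approx.
transitivity (lim (\int[mu]_x ((f_ n x)%:E * (p x)%:E) @[n --> \oo])%E).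
  by apply: congr_lim; apply/funext => n; exact: density_nnsfun.
rewrite -monotone_convergence//=.
- apply: eq_integral => x _; apply/cvg_lim => //=.
  rewrite EFinM; apply: cvgeM.
  + by rewrite mule_def_fin.
  + by apply: cvg_nnsfun_approx => // y _; rewrite /= lee_fin.
  + exact: cvg_cst.
- by move=> n; apply/measurable_EFinP; exact: measurable_funM.
- by move=> n x _; rewrite mule_ge0// lee_fin.
- move=> x _ m n mn; rewrite lee_wpmul2r ?lee_fin//.
  exact/lefP/nd_nnsfun_approx.
Qed.

End Density.

Lemma le0_linear (R : realType) (x K : R) :
  (forall a, 0 < a -> a <= 1 -> x <= K * a) -> x <= 0.
Proof.
move=> h; rewrite leNgt; apply/negP => x0.
(* With this choice [K * a <= (|K| + 1) * a <= x / 2 < x]. *)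
pose a := Num.min 1 (x / (2 * (`|K| + 1))).
have a0 : 0 < a by rewrite lt_min ltr01 divr_gt0// mulr_gt0.
have := h a a0; rewrite /a ge_min lexx => /(_ isT); rewrite -/a leNgt => /negP; apply.
apply: (@le_lt_trans _ _ ((`|K| + 1) * (x / (2 * (`|K| + 1))))).
  apply: (@le_trans _ _ ((`|K| + 1) * a)).
    by rewrite ler_pM2r// (le_trans (ler_norm K))// lerDl.
  by rewrite ler_pM2l// ge_min lexx orbT.
have -> : (`|K| + 1) * (x / (2 * (`|K| + 1))) = x / 2 by field; rewrite gt_eqF.
by rewrite ltr_pdivrMr// ltr_pMr// ltr1n.
Qed.

Section GaussianMoments.
Context {disp : measure_display} {T : measurableType disp} {R : realType}.
Variables (P : probability T R) (X : T -> R) (s : R).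
Hypothesis s0 : 0 < s.
Hypothesis mX : measurable_fun [set: T] X.
Hypothesis lawX : forall A, measurable A -> P (X @^-1` A) = normal_prob 0 s A.

Let sn0 : s != 0. Proof. by rewrite gt_eqF. Qed.

(* [lebesgue_measure] lives on [measurableTypeR R], which has the same
   measurable sets as [R] but another display. *)
Let X_mixin := @isMeasurableFun.Build _ _ T (measurableTypeR R) X mX.
Let Xm : {mfun T >-> measurableTypeR R} := HB.pack (X : T -> measurableTypeR R) X_mixin.

Lemma ge0_integral_gauss (f : R -> R) : measurable_fun [set: R] f ->
  (forall x, 0 <= f x) ->
  (\int[P]_w (f (X w))%:E =
   \int[lebesgue_measure]_x (f x * normal_pdf 0 s x)%:E)%E.
Proof.
move=> mf f0.
rewrite -(@ge0_integral_density _ _ _ lebesgue_measure (distribution P Xm) (normal_pdf 0 s))//.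
- rewrite (@ge0_integral_distribution _ _ _ _ _ P Xm (EFin \o f))//.
  exact/measurable_EFinP.
- exact: measurable_normal_pdf.
- exact: normal_pdf_ge0.
Qed.

(** Completing the square: the weighted density is a constant times the density of mean
    [a * s ^+ 2]. *)
Lemma gauss_expR (a : R) :
  (\int[P]_w (expR (a * X w))%:E = (expR (a ^+ 2 * s ^+ 2 / 2))%:E)%E.
Proof.
rewrite (ge0_integral_gauss (f := fun x => expR (a * x))); last 2 first.
- by apply: measurableT_comp => //; exact: measurable_funM.
- by move=> x; exact: expR_ge0.
transitivity (\int[lebesgue_measure]_x ((expR (a ^+ 2 * s ^+ 2 / 2))%:E *
    (normal_pdf (a * s ^+ 2) s x)%:E))%E.
  apply: eq_integral => x _; rewrite -EFinM; congr EFin.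
  rewrite !normal_pdfE// /normal_fun mulrCA [in RHS]mulrCA; congr (_ * _).
  rewrite -!expRD; congr expR; rewrite subr0.
  by field.
rewrite ge0_integralZl//=.
- by rewrite integral_normal_pdf mule1.
- by apply/measurable_EFinP; exact: measurable_normal_pdf.
- by move=> x _; rewrite lee_fin normal_pdf_ge0.
Qed.

(** The weight halves the exponent [- x^2 / (2 s^2)], which amounts to doubling the variance;
    [sqrt 2] is the ratio of the normalising constants. Every moment is dominated by this
    integral. *)
Lemma gauss_expR_sqr :
  (\int[P]_w (expR ((X w / s) ^+ 2 / 4))%:E = (Num.sqrt 2)%:E)%E.
Proof.
rewrite (ge0_integral_gauss (f := fun x => expR ((x / s) ^+ 2 / 4))); last 2 first.
- apply: measurableT_comp => //; apply: measurable_funM => //.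
  by apply: measurable_funX; exact: measurable_funM.
- by move=> x; exact: expR_ge0.
pose s' := Num.sqrt 2 * s.
have s'0 : s' != 0 by rewrite mulf_neq0// gt_eqF// sqrtr_gt0.
have s'2 : s' ^+ 2 = 2 * s ^+ 2 by rewrite exprMn sqr_sqrtr.
transitivity (\int[lebesgue_measure]_x ((Num.sqrt 2)%:E *
    (normal_pdf 0 s' x)%:E))%E.
  apply: eq_integral => x _; rewrite -EFinM; congr EFin.
  rewrite !normal_pdfE// mulrCA [RHS]mulrA /normal_fun; congr (_ * _).
    have e : s' ^+ 2 * pi *+ 2 = 2 * (s ^+ 2 * pi *+ 2).
      by rewrite s'2; ring.
    rewrite /normal_peak e sqrtrM//.
    by rewrite invfM mulrA divff ?mul1r// gt_eqF// sqrtr_gt0.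
  rewrite -!expRD; congr expR; rewrite subr0 s'2.
  by field.
rewrite ge0_integralZl//=.
- by rewrite integral_normal_pdf mule1.
- by apply/measurable_EFinP; exact: measurable_normal_pdf.
- by move=> x _; rewrite lee_fin normal_pdf_ge0.
Qed.

Lemma gauss_L1_expR (a : R) : L1 P (fun w => expR (a * X w)) /\
  Ex P (fun w => expR (a * X w)) = expR (a ^+ 2 * s ^+ 2 / 2).
Proof.
have [| | |L _] := @L1_ge0 _ _ _ P (fun w => expR (a * X w)) (expR (a ^+ 2 * s ^+ 2 / 2)).
- by apply: measurableT_comp => //; exact: measurable_funM.
- by move=> w; exact: expR_ge0.
- by rewrite gauss_expR.
by split=> //; apply: EFin_inj; rewrite ExE// gauss_expR.
Qed.

Lemma gauss_moment12 : L1 P (fun w => X w ^+ 12) /\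
  Ex P (fun w => X w ^+ 12) <= 24 ^+ 6 * Num.sqrt 2 * s ^+ 12.
Proof.
have [| | |L le2] := @L1_ge0 _ _ _ P (fun w => expR ((X w / s) ^+ 2 / 4)) (Num.sqrt 2).
- apply: measurableT_comp => //; apply: measurable_funM => //.
  by apply: measurable_funX; exact: measurable_funM.
- by move=> w; exact: expR_ge0.
- by rewrite gauss_expR_sqr.
have bnd w : X w ^+ 12 <= 24 ^+ 6 * s ^+ 12 * expR ((X w / s) ^+ 2 / 4).
  (* Chosen so that [y ^+ 6 <= expR y ^+ 6 = expR (6 * y)], where [6 * y] is exactly the exponent
     [(X w / s) ^+ 2 / 4]; hence the constant [24 ^+ 6]. *)
  pose y := (X w / s) ^+ 2 / 24.
  have y0 : 0 <= y by rewrite divr_ge0// sqr_ge0.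
  have -> : X w ^+ 12 = 24 ^+ 6 * s ^+ 12 * y ^+ 6 by rewrite /y; field.
  rewrite ler_wpM2l ?mulr_ge0 ?exprn_ge0 ?(ltW s0)//.
  have -> : (X w / s) ^+ 2 / 4 = 6%:R * y by rewrite /y; field.
  rewrite expRM_natl lerXn2r// ?nnegrE ?expR_ge0//.
  by rewrite (le_trans _ (expR_ge1Dx y))// lerDr.
have L12 : L1 P (fun w => X w ^+ 12).
  apply: L1_le (L1Z (24 ^+ 6 * s ^+ 12) L) _; first exact: measurable_funX.
  by move=> w; rewrite ger0_norm ?exprn_even_ge0.
split=> //; apply: le_trans (le_Ex L12 (L1Z (24 ^+ 6 * s ^+ 12) L) bnd) _.
by rewrite ExZ// mulrAC ler_wpM2r ?exprn_ge0 ?(ltW s0)// ler_pM2l.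
Qed.

Lemma gauss_L1X k : (k <= 12)%N -> L1 P (fun w => X w ^+ k).
Proof.
move=> k12; apply: L1_le (L1D (L1_cst P 1) (proj1 gauss_moment12)) _.
  exact: measurable_funX.
move=> w /=; rewrite normrX.
have [x1|x1] := leP `|X w| 1.
  by rewrite (@le_trans _ _ 1)// ?exprn_ile1// lerDl exprn_even_ge0.
rewrite -[X w ^+ 12]ger0_norm ?exprn_even_ge0// normrX.
by rewrite (@le_trans _ _ (`|X w| ^+ 12))// ?lerDr// ler_weXn2l// ltW.
Qed.

(* Both moments are read off the expansion of [E (exp (a X)) = exp (a^2 s^2 / 2)]
   as [a] tends to 0. *)
Lemma gauss_mean_var : Ex P X = 0 /\ Ex P (fun w => X w ^+ 2) = s ^+ 2.
Proof.
have LX : L1 P X by exact: (@gauss_L1X 1).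
have LX2 := @gauss_L1X 2 isT.
set m := Ex P X; set v := Ex P _.
(* For [|a| <= 1] the cubic remainder is at most [|a|^3 |X|^3 exp |X|], and [|X|^3 <= exp (3 |X|)];
   then [exp (4 |X|) <= exp (4 X) + exp (- 4 X)]. *)
have [L4 E4] := gauss_L1_expR 4; have [L4' E4'] := gauss_L1_expR (- 4).
pose K := expR (8 * s ^+ 2) + expR (8 * s ^+ 2).
have LK := L1D L4 L4'.
have EK : Ex P (fun w => expR (4 * X w) + expR (- 4 * X w)) = K.
  by rewrite ExD// E4 E4' /K; congr (expR _ + expR _); field.
have bnd a w : `|a| <= 1 ->
    `|expR (a * X w) - (1 + a * X w + a ^+ 2 / 2 * X w ^+ 2)| <=
    `|a| ^+ 3 * (expR (4 * X w) + expR (- 4 * X w)).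
  move=> a1; rewrite (_ : expR (a * X w) - _ =
    expR (a * X w) - 1 - a * X w - (a * X w) ^+ 2 / 2); last by field.
  rewrite (le_trans (expR_taylor3 _))// normrM exprMn -mulrA ler_wpM2l// ?exprn_ge0//.
  apply: (@le_trans _ _ (expR (4 * `|X w|))); last first.
    by case: (ger0P (X w)) => _; rewrite ?mulrN ?mulNr ?lerDl ?lerDr expR_ge0.
  have -> : expR (4 * `|X w|) = expR `|X w| ^+ 3 * expR `|X w|.
    by rewrite -exprSr -expRM_natl.
  apply: ler_pM; rewrite ?exprn_ge0//.
  - rewrite lerXn2r// ?nnegrE ?expR_ge0//.
    by rewrite (le_trans _ (expR_ge1Dx _))// lerDr.
  - rewrite ge_max -{1}expR0 !ler_expR normr_ge0/= (le_trans (ler_norm _))//.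
    by rewrite normrM ler_piMl.
have key a : `|a| <= 1 ->
    `|expR (a ^+ 2 * s ^+ 2 / 2) - (1 + a * m + a ^+ 2 / 2 * v)| <= `|a| ^+ 3 * K.
  move=> a1; have [La <-] := gauss_L1_expR a.
  have Lq : L1 P (fun w => 1 + a * X w + a ^+ 2 / 2 * X w ^+ 2).
    by apply: L1D; [apply: L1D; [exact: L1_cst|exact: L1Z]|exact: L1Z].
  have Eq : Ex P (fun w => 1 + a * X w + a ^+ 2 / 2 * X w ^+ 2)
      = 1 + a * m + a ^+ 2 / 2 * v.
    rewrite ExD; [|by apply: L1D; [exact: L1_cst|exact: L1Z]|exact: L1Z].
    rewrite ExD; [|exact: L1_cst|exact: L1Z].
    by rewrite (@Ex_cst _ _ _ P 1) !ExZ.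
  rewrite -Eq -ExB// -EK -ExZ//; apply: le_norm_Ex => //.
  - exact: L1B.
  - exact: L1Z.
  - by move=> w; exact: bnd.
pose K2 := s ^+ 4 / 4 * expR (s ^+ 2 / 2).
have key2 a : `|a| <= 1 ->
    `|expR (a ^+ 2 * s ^+ 2 / 2) - (1 + a ^+ 2 * s ^+ 2 / 2)| <= `|a| ^+ 3 * K2.
  move=> a1; rewrite opprD addrA (le_trans (expR_taylor2 _))//.
  have a2 : `|a ^+ 2| = `|a| ^+ 2 by rewrite normrX.
  have h1 : `|a ^+ 2 * s ^+ 2 / 2| ^+ 2 = `|a| ^+ 4 * (s ^+ 4 / 4).
    have p0 : 0 <= a ^+ 2 * s ^+ 2 / 2 by rewrite divr_ge0// mulr_ge0// sqr_ge0.
    rewrite ger0_norm//.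
    by rewrite -[`|a| ^+ 4]/(`|a| ^+ (2 * 2)) exprM -a2 ger0_norm ?sqr_ge0//; field.
  rewrite h1 /K2 [leRHS]mulrA; apply: ler_pM.
  - by rewrite mulr_ge0 ?exprn_ge0// divr_ge0// exprn_even_ge0.
  - by rewrite le_max ler01.
  - rewrite ler_wpM2r ?divr_ge0 ?exprn_even_ge0//.
    by rewrite exprS ler_piMl// exprn_ge0.
  - rewrite ge_max -{1}expR0 !ler_expR divr_ge0 ?sqr_ge0//=.
    rewrite ler_pM2r// ler_piMl ?sqr_ge0//.
    by rewrite -[a ^+ 2]ger0_norm ?sqr_ge0// a2 exprn_ile1.
have key3 a : `|a| <= 1 -> `|a * m + a ^+ 2 / 2 * (v - s ^+ 2)| <= (K + K2) * `|a| ^+ 3.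
  move=> a1; have h1 := key a a1; have h2 := key2 a a1.
  rewrite [leRHS]mulrC [leRHS]mulrDr.
  apply: (le_trans _ (lerD h1 h2)); rewrite [leRHS]addrC.
  apply: le_trans (ler_normB _ _); rewrite le_eqVlt; apply/orP; left.
  by apply/eqP; congr `|_|; field.
(* Subtracting the estimates at [a] and [- a] cancels the quadratic term and isolates
   [2 * a * m]. *)
have hm a : 0 < a -> a <= 1 -> `|m| <= (K + K2 ) * a.
  move=> a0 a1; have p1 : `|a| <= 1 by rewrite ger0_norm// ltW.
  have := key3 a p1; have := key3 (- a); rewrite normrN => /(_ p1).
  rewrite sqrrN (ger0_norm (ltW a0)) mulNr => h1 h2.
  have : `|2 * a * m| <= 2 * ((K + K2) * a ^+ 3).
    have -> : 2 * a * m = (a * m + a ^+ 2 / 2 * (v - s ^+ 2))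
                 - (- (a * m) + a ^+ 2 / 2 * (v - s ^+ 2)) by ring.
    by rewrite (le_trans (ler_normB _ _))// mulr_natl mulr2n lerD.
  rewrite -mulrA normrM ger0_norm// ler_pM2l// normrM gtr0_norm//.
  rewrite exprS mulrCA ler_pM2l// => /le_trans; apply.
  rewrite ler_wpM2l//; last by rewrite expr2 ler_piMr// ltW.
  rewrite addr_ge0//; first by rewrite addr_ge0// expR_ge0.
  by rewrite mulr_ge0 ?expR_ge0// divr_ge0// exprn_even_ge0.
have m0 : m = 0 by apply/eqP; rewrite -normr_le0; exact: le0_linear hm.
split=> //.
have hv a : 0 < a -> a <= 1 -> `|v - s ^+ 2| <= 2 * (K + K2) * a.
  move=> a0 a1; have p1 : `|a| <= 1 by rewrite ger0_norm// ltW.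
  have := key3 a p1; rewrite m0 mulr0 add0r (ger0_norm (ltW a0)) normrM.
  rewrite ger0_norm ?divr_ge0 ?sqr_ge0// => h.
  have a20 : 0 < a ^+ 2 / 2 by rewrite divr_gt0// exprn_gt0.
  rewrite -(ler_pM2l a20) (le_trans h)// le_eqVlt; apply/orP; left; apply/eqP.
  by field.
by apply/eqP; rewrite -subr_eq0 -normr_le0; exact: le0_linear hv.
Qed.

End GaussianMoments.

(** * Independence of Brownian increments *)

Section PiSystems.
Context {disp : measure_display} {T : measurableType disp} {R : realType}.
Variable P : probability T R.

(** As functions of [E] both sides are finite measures, a restriction and a multiple of [P]; they
    agree on a pi-system containing the whole space, hence on the sigma-algebra it generates. *)
Lemma indep_pi_system (G : set (set T)) (F : set T) :
  G `<=` measurable -> setI_closed G -> G setT -> measurable F ->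
  (forall A, G A -> P (A `&` F) = (P A * P F)%E) ->
  forall E, <<s G >> E -> P (E `&` F) = (P E * P F)%E.
Proof.
move=> Gm GI GT mF GF E sE.
have PF : P F = (fine (P F))%:E by rewrite fineK// fin_num_measure.
have PF0 : (0 <= fine (P F))%R by exact: fine_ge0.
pose m1 := mrestr P mF; pose m2 := mscale (NngNum PF0) P.
have m2E X : m2 X = (P X * P F)%E by rewrite muleC PF.
have : m1 E = m2 E.
  apply: (@g_sigma_algebra_measure_unique _ _ _ G Gm (fun _ => setT) _ _ m1 m2) => //.
  - by rewrite -[RHS](bigcup_const (I := nat) (P := setT))//; exists 0%N.
  - by move=> A GA; have e := GF A GA; rewrite -m2E in e; exact: e.
  - move=> _; suff e : (P (setT `&` F) < +oo)%E by exact: e.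
    by rewrite setTI ltey_eq fin_num_measure.
by move=> e; rewrite -m2E -e.
Qed.

(** Independence identifies the joint law with the product of the two laws, and Fubini's theorem
    factors the integral. *)
Lemma indep_Ex (Y Z : T -> R) :
  (forall A C, measurable A -> measurable C ->
    P (Y @^-1` A `&` Z @^-1` C) = (P (Y @^-1` A) * P (Z @^-1` C))%E) ->
  L1 P Y -> L1 P Z ->
  L1 P (fun w => Y w * Z w) /\ Ex P (fun w => Y w * Z w) = Ex P Y * Ex P Z.
Proof.
move=> YZ LY LZ.
have mY := L1_measurable LY; have mZ := L1_measurable LZ.
pose Ym : {mfun T >-> R} := HB.pack Y (isMeasurableFun.Build _ _ _ _ _ mY).
pose Zm : {mfun T >-> R} := HB.pack Z (isMeasurableFun.Build _ _ _ _ _ mZ).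
pose W w := (Y w, Z w).
have mW : measurable_fun [set: T] W by exact: measurable_fun_pair.
pose Wm : {mfun T >-> (R * R)%type} := HB.pack W (isMeasurableFun.Build _ _ _ _ _ mW).
pose m1 := distribution P Ym; pose m2 := distribution P Zm.
pose m := distribution P Wm.
have mE A : measurable A -> (m1 \x m2)%E A = m A.
  by apply: product_measure_unique => {}A C mA mC; exact: YZ.
pose f (z : R * R) := (z.1 * z.2)%:E.
have mf : measurable_fun setT f.
  by apply/measurable_EFinP; exact: measurable_funM.
have int1 (X : {mfun T >-> R}) : L1 P X ->
    (distribution P X).-integrable setT (EFin \o idfun).
  move=> LX; apply/integrableP; split.
    by apply/measurable_EFinP; exact: measurable_id.
  rewrite (@ge0_integral_distribution _ _ _ _ _ P X (fun x : R => `|x%:E|%E))//.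
    by move/integrableP : LX => [].
  by apply: measurableT_comp => //; apply/measurable_EFinP; exact: measurable_id.
have eint (X : {mfun T >-> R}) : L1 P X ->
    (\int[distribution P X]_x x%:E = (Ex P X)%:E)%E.
  move=> LX; rewrite ExE//.
  rewrite (@integral_distribution _ _ _ _ _ P X (EFin \o idfun))//.
  by apply/measurable_EFinP; exact: measurable_id.
have intf : ((m1 \x m2)%E).-integrable setT f.
  apply/integrable12ltyP => //.
  under eq_integral.
    move=> x _.
    under eq_integral do rewrite /f/= normrM EFinM.
    rewrite ge0_integralZl//=; last first.
      by apply/measurable_EFinP; exact: normr_measurable.
    over.
  rewrite ge0_integralZr//=.
  - rewrite lte_mul_pinfty//.
    + exact: integral_ge0.
    + have := integrable_abse (int1 Ym LY) => /integrable_fin_num.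
      exact.
    + have := integrable_abse (int1 Zm LZ) => /integrable_fin_num.
      by rewrite ltey_eq => ->.
  - by apply/measurable_EFinP; exact: normr_measurable.
  - exact: integral_ge0.
have mm (h : R * R -> \bar R) :
    (\int[m]_z h z = \int[m1 \x m2]_z h z)%E.
  by apply: eq_measure_integral => A mA _; rewrite [RHS]mE.
have LYZ : L1 P (fun w => Y w * Z w).
  apply/integrableP; split; first by apply/measurable_EFinP; exact: measurable_funM.
  have <- := @ge0_integral_distribution _ _ _ _ _ P Wm (fun z => `|f z|%E).
  - by rewrite mm; have /integrableP[] := intf.
  - exact: measurableT_comp.
  - by [].
split=> //; apply: EFin_inj; rewrite ExE//.
have <- := @integral_distribution _ _ _ _ _ P Wm f mf LYZ.
rewrite mm -integral12_prod_meas1// /fubini_F.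
under eq_integral.
  move=> x _.
  under eq_integral do rewrite /f/= EFinM.
  rewrite integralZl//=; last exact: int1.
  rewrite eint//.
  over.
by rewrite integralZr//=; [rewrite eint// EFinM|exact: int1].
Qed.

End PiSystems.

Section MutualIndependence.
Context {disp : measure_display} {T : measurableType disp} {R : realType}.
Variable P : probability T R.

Lemma ae_probability_setI (S Z : set T) : measurable S -> measurable Z ->
  {ae P, forall w, Z w} -> P (S `&` Z) = P S.
Proof.
move=> mS mZ aeZ.
have Z0 : P (~` Z) = 0%E by apply/negligibleP => //; exact: measurableC.
have mZC := measurableC mZ.
have mSZ : measurable (S `&` Z) by exact: measurableI.
have mSZC : measurable (S `&` ~` Z) by exact: measurableI.
rewrite -[in RHS](setIT S) -(setUv Z) setIUr measureU//; last first.
  by rewrite setIACA setICr setI0.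
rewrite [X in (_ + X)%E](_ : _ = 0%E) ?adde0//.
by apply/eqP; rewrite eq_le measure_ge0 andbT -Z0 le_measure// ?inE.
Qed.

(* The null variables [Z k] stand for the starting values [B k 0], which vanish
   only almost surely but do enter the natural filtration. *)
Lemma mutually_independent_sigma (J0 K : finType) (X : J0 -> T -> R)
    (Z : K -> T -> R) (p0 : J0) :
  (forall p, measurable_fun [set: T] (X p)) ->
  (forall k, measurable_fun [set: T] (Z k)) ->
  mutually_independent P X -> {ae P, forall w, forall k, Z k w = 0} ->
  forall E A, measurable A ->
  <<s [set E | (exists p A, [/\ p != p0, measurable A & E = X p @^-1` A]) \/
               (exists k A, measurable A /\ E = Z k @^-1` A)] >> E ->
  P (E `&` X p0 @^-1` A) = (P E * P (X p0 @^-1` A))%E.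
Proof.
move=> mX mZ indepX Z0 E A mA.
have mXA p C : measurable C -> measurable (X p @^-1` C).
  by move=> mC; rewrite -[X in measurable X]setTI; exact: mX.
have mZA k C : measurable C -> measurable (Z k @^-1` C).
  by move=> mC; rewrite -[X in measurable X]setTI; exact: mZ.
pose box (D : J0 -> set R) (C : K -> set R) : set T :=
  (\bigcap_p (X p @^-1` D p)) `&` (\bigcap_k (Z k @^-1` C k)).
pose G := [set S | exists D C, [/\ forall p, measurable (D p),
   forall k, measurable (C k), D p0 = setT & S = box D C]].
have mI (J : finType) (S : J -> set T) : (forall p, measurable (S p)) ->
    measurable (\bigcap_p S p).
  move=> mS; apply: fin_bigcap_measurable; first exact: finite_finset.
  by move=> p _; exact: mS.
have sub : [set E | (exists p A, [/\ p != p0, measurable A & E = X p @^-1` A]) \/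
               (exists k A, measurable A /\ E = Z k @^-1` A)] `<=` G.
  move=> _ [[p [C [pp0 mC ->]]]|[k [C [mC ->]]]].
    exists (fun q => if q == p then C else setT), (fun=> setT); split => //.
    - by move=> q; case: ifP.
    - by rewrite eq_sym (negbTE pp0).
    - apply/seteqP; split => [w Cw|w [/(_ p I)]]; last by rewrite /= eqxx.
      by split=> [q _ /=|//]; case: eqP => [->|].
  exists (fun=> setT), (fun q => if q == k then C else setT); split => //.
  - by move=> q; case: ifP.
  - apply/seteqP; split => [w Cw|w [_ /(_ k I)]]; last by rewrite /= eqxx.
    by split=> [//|q _ /=]; case: eqP => [->|].
move=> /(sub_sigma_algebra2 sub) sE.
apply: (indep_pi_system (G := G)) => //.
- by move=> _ [D [C [mD mC _ ->]]]; apply: measurableI; apply: mI => p; auto.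
- move=> _ _ [D [C [mD mC D0 ->]]] [D' [C' [mD' mC' D'0 ->]]].
  exists (fun p => D p `&` D' p), (fun k => C k `&` C' k); split.
  + by move=> p; exact: measurableI.
  + by move=> p; exact: measurableI.
  + by rewrite D0 D'0 setTI.
  + rewrite /box setIACA -!bigcapI.
    by congr (_ `&` _); apply: eq_bigcapr => p _; rewrite preimage_setI.
- exists (fun=> setT), (fun=> setT); split => //.
  by apply/seteqP; split => w.
- exact: mXA.
- move=> _ [D [C [mD mC D0 ->]]].
  have mDI : measurable (\bigcap_p X p @^-1` D p) by apply: mI => p; exact: mXA.
  have mCI : measurable (\bigcap_k Z k @^-1` C k) by apply: mI => p; exact: mZA.
  rewrite /box.
  (* The event on the null variables is almost sure if every [C k] contains 0, and negligible
     otherwise. *)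
  have [C0|C0] := pselect (forall k, C k 0).
    have aeC : {ae P, forall w, (\bigcap_k Z k @^-1` C k) w}.
      by apply: filterS Z0 => w Zw k _ /=; rewrite Zw.
    rewrite setIAC ae_probability_setI//; last first.
      by apply: measurableI => //; exact: mXA.
    rewrite (ae_probability_setI mDI mCI aeC).
    pose D' p := if p == p0 then A else D p.
    have -> : \bigcap_p (X p @^-1` D p) `&` X p0 @^-1` A = \bigcap_p (X p @^-1` D' p).
      apply/seteqP; split => [w [Dw Aw] p _|w Dw].
        by rewrite /D'; case: eqP => [->//|_]; exact: Dw.
      split=> [p _|]; last by have := Dw p0 I; rewrite /= /D' eqxx.
      have := Dw p I; rewrite /= /D'; case: eqP => [-> _|//].
      by rewrite D0.
    rewrite !indepX//; last by move=> p; rewrite /D'; case: ifP.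
    rewrite (bigD1 p0)//= [X in (_ = X * _)%E](bigD1 p0)//= D0 preimage_setT.
    rewrite probability_setT mul1e muleC /D' eqxx; congr (_ * _)%E.
    by apply: eq_bigr => p /negbTE ->.
  have aeC : {ae P, forall w, (~` (\bigcap_k Z k @^-1` C k)) w}.
    apply: filterS Z0 => w Zw CZ; apply: C0 => k.
    by have := CZ k I; rewrite /= Zw.
  have P0 S : measurable S -> P (S `&` (\bigcap_k Z k @^-1` C k)) = 0%E.
    move=> mS; rewrite -(ae_probability_setI _ _ aeC) ?setIK//.
    - by rewrite -setIA setICr setI0 measure0.
    - exact: measurableI.
    - exact: measurableC.
  rewrite setIAC !P0 ?mul0e//; apply: measurableI => //; exact: mXA.
Qed.

End MutualIndependence.

(** * Independence of an increment from the past *)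

Section BrownianIndependence.
Context {disp : measure_display} {T : measurableType disp} {R : realType}.
Variable P : probability T R.
Variables (d : nat) (B : 'I_d -> R -> {RV P >-> R}).
Hypothesis hB : brownian_motion B.

(** [bm_indep] speaks of one strictly increasing grid, so finitely many past times must be fitted
    into a grid whose last interval is that of the increment. Starting it at 0 makes every value of
    [B] on the grid a sum of increments added to [B k 0]. *)
Lemma time_grid (s v : R) (L : seq R) : 0 <= s -> s < v ->
  (forall u, u \in L -> 0 <= u <= s) ->
  exists m (t : nat -> R), [/\ t 0%N = 0 , t m = s, t m.+1 = v,
    forall i, (i < m.+1)%N -> t i < t i.+1 &
    forall u, u \in L -> exists2 i, (i <= m)%N & t i = u].
Proof.
move=> s0 sv hL.
(* Times equal to [s] are filtered out and [s] is appended once, which keeps the grid strict; [g] is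
   empty when [s = 0]. *)
pose g := sort <=%R (undup [seq u <- 0 :: L | u < s]).
have ming u : (u \in g) = (u < s) && (u \in 0 :: L).
  by rewrite mem_sort mem_undup mem_filter.
pose gr := g ++ [:: s; v]; pose t i := nth 0 gr i.
have srt : sorted <%R gr.
  rewrite (sorted_pairwise lt_trans) pairwise_cat /= sv !andbT.
  apply/andP; split; last first.
    by rewrite -(sorted_pairwise lt_trans) sort_lt_sorted undup_uniq.
  apply/allrelP => x y; rewrite ming !inE => /andP[xs _] /orP[]/eqP -> //.
  exact: lt_trans sv.
have szgr : size gr = (size g).+2 by rewrite size_cat addn2.
have tinc i : (i < (size g).+1)%N -> t i < t i.+1.
  move=> im; rewrite /t lt_sorted_ltn_nth// inE szgr ?ltnS// ltnW//.
have tm : t (size g) = s by rewrite /t nth_cat ltnn subnn.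
have tin u : u \in 0 :: L -> exists2 i, (i <= size g)%N & t i = u.
  move=> uL; have u0s : 0 <= u <= s.
    by move: uL; rewrite inE => /predU1P[->|/hL//]; rewrite lexx s0.
  case/andP: u0s => u0; rewrite le_eqVlt => /predU1P[->|us].
    by exists (size g).
  have ug : u \in g by rewrite ming us uL.
  exists (index u g); first by rewrite ltnW// index_mem.
  by rewrite /t nth_cat index_mem ug nth_index.
have t0 i : (i <= size g)%N -> 0 <= t i.
  rewrite leq_eqVlt => /predU1P[->|ig]; first by rewrite tm.
  rewrite /t nth_cat ig; have := mem_nth 0 ig; rewrite ming => /andP[_].
  by rewrite inE => /predU1P[->//|/hL/andP[]].
exists (size g), t; split => //.
- have [i ig ti] := tin 0 (mem_head _ _).
  apply/eqP; rewrite eq_le t0// andbT -ti.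
  rewrite /t lt_sorted_leq_nth// inE szgr// ltnS.
  by rewrite ltnW// ltnS ltnW.
- by rewrite /t nth_cat ltnNge leqnSn/= subSnn.
- by move=> u uL; apply: tin; rewrite inE uL orbT.
Qed.

(** The increments of the other coordinates over the same interval are included, so that mixed
    products within one time step are covered too. *)
Definition past_gen (s v : R) (j : 'I_d) : set (set T) :=
  [set E | (exists k u A, [/\ 0 <= u, u <= s, measurable A & E = B k u @^-1` A]) \/
    (exists k A, [/\ k != j, measurable A &
       E = increment (fun r => B k r) s v @^-1` A])].

Lemma measurable_increment k s v :
  measurable_fun [set: T] (increment (fun r => B k r) s v).
Proof. exact: measurable_funB. Qed.

(** Events depending on finitely many past times form a pi-system, since two finite lists of times
    can be concatenated. On a grid containing these times such an event is a function of [B k 0] and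
    of increments other than the one considered. *)
Lemma bm_past_indep (s v : R) (j : 'I_d) E A : 0 <= s -> s < v ->
  measurable A -> <<s past_gen s v j >> E ->
  P (E `&` increment (fun r => B j r) s v @^-1` A) =
  (P E * P (increment (fun r => B j r) s v @^-1` A))%E.
Proof.
move=> s0 sv mA.
pose gen (L : seq R) : set (set T) :=
  [set E | (exists k u A, [/\ u \in L, measurable A & E = B k u @^-1` A]) \/
    (exists k A, [/\ k != j, measurable A &
       E = increment (fun r => B k r) s v @^-1` A])].
pose G := [set S | exists L, (forall u, u \in L -> 0 <= u <= s) /\ <<s gen L >> S].
have sub : past_gen s v j `<=` G.
  move=> S [[k [u [C [u0 us mC ->]]]]|kC].
    exists [:: u]; split; first by move=> x; rewrite inE => /eqP ->; rewrite u0 us.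
    by apply: sub_sigma_algebra; left; exists k, u, C; rewrite mem_head.
  by exists [::]; split => //; apply: sub_sigma_algebra; right.
move=> /(sub_sigma_algebra2 sub) sE.
have subL L L' : {subset L <= L'} -> <<s gen L >> `<=` <<s gen L' >>.
  move=> LL'; apply: sub_sigma_algebra2 => S [[k [u [C [uL mC ->]]]]|kC].
    by left; exists k, u, C; split => //; exact: LL'.
  by right.
have mG L : gen L `<=` measurable.
  move=> S [[k [u [C [uL mC ->]]]]|[k [C [kj mC ->]]]].
    by rewrite -[X in measurable X]setTI; exact: measurable_funPT.
  by rewrite -[X in measurable X]setTI; exact: measurable_increment.
apply: (indep_pi_system (G := G)) => //.
- move=> S [L [_]]; apply: smallest_sub; last exact: mG.
  exact: sigma_algebra_measurable.
- move=> S S' [L [hL LS]] [L' [hL' LS']]; exists (L ++ L'); split.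
    by move=> u; rewrite mem_cat => /orP[/hL|/hL'].
  apply: (@measurableI _ (g_sigma_algebraType (gen (L ++ L')))).
    by apply: (subL L) LS => x xL; rewrite mem_cat xL.
  by apply: (subL L') LS' => x xL; rewrite mem_cat xL orbT.
- exists [::]; split => //.
  exact: (@measurableT _ (g_sigma_algebraType (gen [::]))).
- by rewrite -[X in measurable X]setTI; exact: measurable_increment.
move=> S [L [hL LS]].
have [m [t [t0 tm tm1 tinc tL]]] := time_grid s0 sv hL.
pose X (ij : 'I_m.+1 * 'I_d) := increment (fun r => B ij.2 r) (t ij.1) (t ij.1.+1).
pose p0 : 'I_m.+1 * 'I_d := (ord_max, j).
have indX : mutually_independent P X by apply: bm_indep => //; rewrite t0.
have Xp0 : X p0 = increment (fun r => B j r) s v by rewrite /X /= tm tm1.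
rewrite -Xp0; apply: (mutually_independent_sigma (Z := fun k => B k 0) _ _ indX) => //.
- by move=> p; exact: measurable_increment.
- exact: bm_start hB.
set GI := (X in <<s X >>).
move: LS; apply: smallest_sub; first exact: smallest_sigma_algebra.
have mX p : p != p0 -> measurable_fun [set: g_sigma_algebraType GI] (X p).
  move=> pp0 _ C mC; rewrite setTI.
  by apply: sub_sigma_algebra; left; exists p, C.
have mZ k : measurable_fun [set: g_sigma_algebraType GI] (B k 0).
  move=> _ C mC; rewrite setTI.
  by apply: sub_sigma_algebra; right; exists k, C.
move=> _ [[k [u [C [/tL[i im <-] mC ->]]]]|[k [C [kj mC ->]]]].
  suff : measurable_fun [set: g_sigma_algebraType GI] (B k (t i)).
    by move=> /(_ measurableT C mC); rewrite setTI.
  elim: i im => [_|i IH im]; first by rewrite t0.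
  have ik : (inord i : 'I_m.+1) = i :> nat by rewrite inordK// ltnS ltnW.
  have -> : (B k (t i.+1) : T -> R) = fun w => B k (t i) w +
      X (inord i, k) w.
    by apply/funext => w; rewrite /X /increment /= ik addrC subrK.
  apply: measurable_funD; first by apply: IH; exact: ltnW.
  apply: mX; rewrite /p0 xpair_eqE -val_eqE /= ik.
  by rewrite (ltn_eqF im).
have := mX (ord_max, k); rewrite /X/= tm tm1 xpair_eqE eqxx/= => /(_ kj).
by move=> /(_ measurableT C mC); rewrite setTI.
Qed.

End BrownianIndependence.

Section BrownianMoments.
Context {disp : measure_display} {T : measurableType disp} {R : realType}.
Variable P : probability T R.
Variables (d : nat) (B : 'I_d -> R -> {RV P >-> R}).
Hypothesis hB : brownian_motion B.

Let xi (j : 'I_d) s v := increment (fun r => B j r) s v.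

Definition adapted (s : R) (Y : T -> R) :=
  measurable_wrt (natural_filtration (fun l r => B l r) s) Y.

Let nat_gen (s : R) : set (set T) :=
  [set E | exists (j : 'I_d) (u : R) (A : set R),
         [/\ 0 <= u, u <= s, measurable A & E = B j u @^-1` A]].

Lemma adaptedP s Y :
  adapted s Y <-> measurable_fun [set: g_sigma_algebraType (nat_gen s)] Y.
Proof.
split=> [aY _ A mA|mY A mA]; first by rewrite setTI; exact: aY.
by have := mY measurableT A mA; rewrite setTI.
Qed.

Lemma adapted_le s s' Y : s <= s' -> adapted s Y -> adapted s' Y.
Proof.
move=> ss' aY A mA; move: (aY A mA); apply: sub_sigma_algebra2.
move=> _ [j [u [C [u0 us mC ->]]]]; exists j, u, C; split => //.
exact: le_trans ss'.
Qed.

Lemma adapted_B j u s : 0 <= u -> u <= s -> adapted s (B j u).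
Proof. by move=> u0 us A mA; apply: sub_sigma_algebra; exists j, u, A. Qed.

Lemma adapted_measurable s Y : adapted s Y -> measurable_fun [set: T] Y.
Proof.
move=> aY _ A mA; rewrite setTI; move: (aY A mA); apply: smallest_sub.
  exact: sigma_algebra_measurable.
move=> _ [j [u [C [u0 us mC ->]]]]; rewrite -[X in measurable X]setTI.
exact: measurable_funPT.
Qed.

Lemma adapted_cst s c : adapted s (cst c).
Proof. by apply/adaptedP; exact: measurable_cst. Qed.

Lemma adaptedD s Y Z : adapted s Y -> adapted s Z -> adapted s (fun w => Y w + Z w).
Proof.
by move=> /adaptedP aY /adaptedP aZ; apply/adaptedP; exact: measurable_funD.
Qed.

Lemma adaptedM s Y Z : adapted s Y -> adapted s Z -> adapted s (fun w => Y w * Z w).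
Proof.
by move=> /adaptedP aY /adaptedP aZ; apply/adaptedP; exact: measurable_funM.
Qed.

Lemma adapted_comp s Y (g : R -> R) : measurable_fun [set: R] g ->
  adapted s Y -> adapted s (fun w => g (Y w)).
Proof.
by move=> mg /adaptedP aY; apply/adaptedP; exact: measurableT_comp.
Qed.

Lemma adaptedB s Y Z : adapted s Y -> adapted s Z -> adapted s (fun w => Y w - Z w).
Proof.
by move=> /adaptedP aY /adaptedP aZ; apply/adaptedP; exact: measurable_funB.
Qed.

Lemma adapted_sum s (J : Type) (r : seq J) (F : J -> T -> R) :
  (forall i, adapted s (F i)) -> adapted s (fun w => \sum_(i <- r) F i w).
Proof.
move=> aF; elim: r => [|i r IH].
  have -> : (fun w => \sum_(i <- [::]) F i w) = cst 0.
    by apply/funext => w; rewrite big_nil.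
  exact: adapted_cst.
have -> : (fun w => \sum_(i <- i :: r) F i w) = fun w => F i w + \sum_(i <- r) F i w.
  by apply/funext => w; rewrite big_cons.
exact: adaptedD.
Qed.

Lemma adapted_increment j u v s : 0 <= u -> u <= s -> 0 <= v -> v <= s ->
  adapted s (xi j u v).
Proof. by move=> u0 us v0 vs; apply: adaptedB; exact: adapted_B. Qed.

Lemma adapted_past s v j Y : adapted s Y ->
  measurable_fun [set: g_sigma_algebraType (past_gen B s v j)] Y.
Proof.
move=> aY _ A mA; rewrite setTI; move: (aY A mA); apply: sub_sigma_algebra2.
by move=> _ [k [u [C [u0 us mC ->]]]]; left; exists k, u, C.
Qed.

Lemma xi_refl j s w : xi j s s w = 0.
Proof. by rewrite /xi /increment subrr. Qed.

Lemma increment_L1X j s v k : 0 <= s -> s <= v -> (k <= 12)%N ->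
  L1 P (fun w => xi j s v w ^+ k).
Proof.
move=> s0; rewrite le_eqVlt => /predU1P[<- _|sv k12].
  have -> : (fun w => xi j s s w ^+ k) = cst (0 ^+ k).
    by apply/funext => w; rewrite xi_refl.
  exact: L1_cst.
apply: (gauss_L1X (s := Num.sqrt (v - s))) => //.
- by rewrite sqrtr_gt0 subr_gt0.
- exact: measurable_increment.
- by move=> A mA; apply: bm_normal.
Qed.

Lemma increment_L1 j s v : 0 <= s -> s <= v -> L1 P (xi j s v).
Proof. by move=> s0 sv; have := @increment_L1X j s v 1 s0 sv isT. Qed.

Lemma increment_moment12 j s v : 0 <= s -> s <= v ->
  Ex P (fun w => xi j s v w ^+ 12) <= 24 ^+ 6 * Num.sqrt 2 * (v - s) ^+ 6.
Proof.
move=> s0; rewrite le_eqVlt => /predU1P[<-|sv].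
  have -> : (fun w => xi j s s w ^+ 12) = cst 0.
    by apply/funext => w; rewrite xi_refl expr0n.
  by rewrite Ex_cst subrr expr0n/= mulr0.
have h0 : 0 < Num.sqrt (v - s) by rewrite sqrtr_gt0 subr_gt0.
have law A : measurable A -> P (xi j s v @^-1` A) = normal_prob 0 (Num.sqrt (v - s)) A.
  by move=> mA; apply: bm_normal.
have [_] := gauss_moment12 h0 (measurable_increment B j s v) law.
have -> : (v - s) ^+ 6 = Num.sqrt (v - s) ^+ (2 * 6).
  by rewrite exprM sqr_sqrtr// subr_ge0 ltW.
by [].
Qed.

Lemma past_mul j s v Y (g : R -> R) : 0 <= s -> s < v ->
  measurable_fun [set: g_sigma_algebraType (past_gen B s v j)] Y -> L1 P Y ->
  measurable_fun [set: R] g -> L1 P (fun w => g (xi j s v w)) ->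
  L1 P (fun w => Y w * g (xi j s v w)) /\
  Ex P (fun w => Y w * g (xi j s v w)) = Ex P Y * Ex P (fun w => g (xi j s v w)).
Proof.
move=> s0 sv mY LY mg Lg; apply: (indep_Ex (Z := fun w => g (xi j s v w))) => //.
move=> A C mA mC.
have -> : (fun w => g (xi j s v w)) @^-1` C = xi j s v @^-1` (g @^-1` C) by [].
apply: bm_past_indep => //.
  by rewrite -[X in measurable X]setTI; exact: mg.
by have := mY measurableT A mA; rewrite setTI.
Qed.

(** Measurability is with respect to the enlarged past, because [increment_cov] applies this to a
    weight that already contains another coordinate of the same increment. *)
Let past_mean j s v Y : 0 <= s -> s < v ->
  measurable_fun [set: g_sigma_algebraType (past_gen B s v j)] Y -> L1 P Y ->
  L1 P (fun w => Y w * xi j s v w) /\ Ex P (fun w => Y w * xi j s v w) = 0.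
Proof.
move=> s0 sv mY LY.
have Lx := increment_L1 j s0 (ltW sv).
have [L ->] := past_mul s0 sv mY LY (@measurable_id _ _ setT) Lx.
split=> //.
have h0 : 0 < Num.sqrt (v - s) by rewrite sqrtr_gt0 subr_gt0.
have law A : measurable A -> P (xi j s v @^-1` A) = normal_prob 0 (Num.sqrt (v - s)) A.
  by move=> mA; apply: bm_normal.
have [-> _] := gauss_mean_var h0 (measurable_increment B j s v) law.
by rewrite mulr0.
Qed.

Lemma increment_mean j s v Y : 0 <= s -> s <= v -> adapted s Y -> L1 P Y ->
  L1 P (fun w => Y w * xi j s v w) /\ Ex P (fun w => Y w * xi j s v w) = 0.
Proof.
move=> s0; rewrite le_eqVlt => /predU1P[<- _ _|sv aY LY]; last first.
  by apply: past_mean => //; exact: adapted_past.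
have -> : (fun w => Y w * xi j s s w) = cst 0.
  by apply/funext => w; rewrite xi_refl mulr0.
by rewrite Ex_cst; split => //; exact: L1_cst.
Qed.

Lemma increment_var j s v Y : 0 <= s -> s <= v -> adapted s Y -> L1 P Y ->
  L1 P (fun w => Y w * xi j s v w ^+ 2) /\
  Ex P (fun w => Y w * xi j s v w ^+ 2) = (v - s) * Ex P Y.
Proof.
move=> s0; rewrite le_eqVlt => /predU1P[<- _ _|sv aY LY].
  have -> : (fun w => Y w * xi j s s w ^+ 2) = cst 0.
    by apply/funext => w; rewrite xi_refl expr0n mulr0.
  by rewrite Ex_cst subrr mul0r; split => //; exact: L1_cst.
have Lx := increment_L1X j s0 (ltW sv) (isT : (2 <= 12)%N).
have mg : measurable_fun [set: R] (fun x : R => x ^+ 2) by exact: measurable_funX.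
have [L ->] := past_mul s0 sv (@adapted_past s v j Y aY) LY mg Lx.
split=> //.
have h0 : 0 < Num.sqrt (v - s) by rewrite sqrtr_gt0 subr_gt0.
have law A : measurable A -> P (xi j s v @^-1` A) = normal_prob 0 (Num.sqrt (v - s)) A.
  by move=> mA; apply: bm_normal.
have [_ ->] := gauss_mean_var h0 (measurable_increment B j s v) law.
by rewrite sqr_sqrtr 1?mulrC// subr_ge0 ltW.
Qed.

Lemma increment_cov i j s v Y : i != j -> 0 <= s -> s <= v -> adapted s Y -> L1 P Y ->
  L1 P (fun w => Y w * (xi i s v w * xi j s v w)) /\
  Ex P (fun w => Y w * (xi i s v w * xi j s v w)) = 0.
Proof.
move=> ij s0; rewrite le_eqVlt => /predU1P[<- _ _|sv aY LY].
  have -> : (fun w => Y w * (xi i s s w * xi j s s w)) = cst 0.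
    by apply/funext => w; rewrite xi_refl mul0r mulr0.
  by rewrite Ex_cst; split => //; exact: L1_cst.
have [LYx _] := increment_mean i s0 (ltW sv) aY LY.
have -> : (fun w => Y w * (xi i s v w * xi j s v w)) =
    fun w => (Y w * xi i s v w) * xi j s v w.
  by apply/funext => w; rewrite mulrA.
apply: past_mean => //; apply: measurable_funM; first exact: adapted_past.
move=> _ A mA; rewrite setTI; apply: sub_sigma_algebra; right.
by exists i, A.
Qed.

End BrownianMoments.

(** * Ito isometry and Riemann sums *)

Section SquareIntegrable.
Context {disp : measure_display} {T : measurableType disp} {R : realType}.
Variable P : probability T R.
Implicit Types (f g : T -> R).

Definition L2 f : Prop := measurable_fun [set: T] f /\ L1 P (fun w => f w ^+ 2).

Lemma L2M f g : L2 f -> L2 g -> L1 P (fun w => f w * g w).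
Proof.
move=> [mf Lf] [mg Lg]; apply: L1_le (L1D Lf Lg) _; first exact: measurable_funM.
move=> w; rewrite normrM -[f w ^+ 2]real_normK ?num_real//.
rewrite -[g w ^+ 2]real_normK ?num_real//.
have := sqr_ge0 (`|f w| - `|g w|); have := sqr_ge0 (`|f w| + `|g w|); nra.
Qed.

Lemma L2_cst c : L2 (cst c).
Proof. by split=> //; exact: (L1_cst P (c ^+ 2)). Qed.

Lemma L2_L1 f : L2 f -> L1 P f.
Proof.
move=> Lf; have := L2M Lf (L2_cst 1).
by under eq_fun do rewrite mulr1.
Qed.

Lemma L2D f g : L2 f -> L2 g -> L2 (fun w => f w + g w).
Proof.
move=> Lf Lg; split; first exact: measurable_funD (proj1 Lf) (proj1 Lg).
have -> : (fun w => (f w + g w) ^+ 2) =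
    fun w => f w ^+ 2 + (2 * (f w * g w) + g w ^+ 2).
  by apply/funext => w; ring.
apply: L1D; first exact: (proj2 Lf).
by apply: L1D; [apply: L1Z; exact: L2M|exact: (proj2 Lg)].
Qed.

Lemma L2Z c f : L2 f -> L2 (fun w => c * f w).
Proof.
move=> Lf; split; first exact: measurable_funM (measurable_cst _) (proj1 Lf).
have -> : (fun w => (c * f w) ^+ 2) = fun w => c ^+ 2 * f w ^+ 2.
  by apply/funext => w; ring.
by apply: L1Z; exact: (proj2 Lf).
Qed.

Lemma L2B f g : L2 f -> L2 g -> L2 (fun w => f w - g w).
Proof.
move=> Lf Lg; have := L2D Lf (L2Z (-1) Lg).
by under eq_fun do rewrite mulN1r.
Qed.

Lemma L2_sum (J : Type) (r : seq J) (F : J -> T -> R) :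
  (forall i, L2 (F i)) -> L2 (fun w => \sum_(i <- r) F i w).
Proof.
move=> LF; elim: r => [|i r IH].
  by under eq_fun do rewrite big_nil; exact: L2_cst.
by under eq_fun do rewrite big_cons; exact: L2D.
Qed.

End SquareIntegrable.

Section IncrementInner.
Context {disp : measure_display} {T : measurableType disp} {R : realType}.
Variable P : probability T R.
Variables (d : nat) (B : 'I_d -> R -> {RV P >-> R}).
Hypothesis hB : brownian_motion B.
Variable k : 'I_d.

Local Notation xi := (increment (fun r => B k r)).

Lemma increment_L2 s v a : 0 <= s -> s <= v -> adapted B s a -> L2 P a ->
  L2 P (fun w => a w * xi s v w).
Proof.
move=> s0 sv aa La; split.
  by apply: measurable_funM; [exact: (proj1 La)|exact: measurable_funB].
have -> : (fun w => (a w * xi s v w) ^+ 2) = fun w => a w ^+ 2 * xi s v w ^+ 2.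
  by apply/funext => w; rewrite exprMn.
have aa2 : adapted B s (fun w => a w ^+ 2) by exact: adaptedM.
by have [] := increment_var hB k s0 sv aa2 (proj2 La).
Qed.

Lemma xi_split s u v w : xi s v w = xi s u w + xi u v w.
Proof. by rewrite /increment; ring. Qed.

(* Length of [`]s, s'] `&` `]u, u']]; it allows the isometry to be stated for
   overlapping intervals, so that an elementary process and a Riemann sum can be
   subtracted without a common refinement of their subdivisions. *)
Definition overlap (s s' u u' : R) : R :=
  Num.max 0 (Num.min s' u' - Num.max s u).

(** Both intervals are cut at [u] and at the end [m] of their overlap. A product over disjoint
    pieces has mean zero, the later increment being independent of all the rest; the common piece
    []u, m]] contributes its variance. *)
Let inner_le s s' u u' a b : 0 <= s -> s <= u -> s <= s' -> u <= u' ->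
  adapted B s a -> adapted B u b -> L2 P a -> L2 P b ->
  Ex P (fun w => (a w * xi s s' w) * (b w * xi u u' w)) =
  Ex P (fun w => a w * b w) * overlap s s' u u'.
Proof.
move=> s0 su ss' uu' aa ab La Lb; have u0 := le_trans s0 su.
have aau := adapted_le su aa.
have orth v v' Y : 0 <= v -> v <= v' -> adapted B v Y -> L1 P Y ->
    L1 P (fun w => Y w * xi v v' w) /\ Ex P (fun w => Y w * xi v v' w) = 0.
  by move=> v0 vv' aY LY; exact: increment_mean.
have [s'u|us'] := leP s' u.
  have [_ e] := orth u u' (fun w => (a w * xi s s' w) * b w) u0 uu'
    (adaptedM (adaptedM aau (adapted_increment k s0 su (le_trans s0 ss') s'u)) ab)
    (L2M (increment_L2 s0 ss' aa La) Lb).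
  have -> : overlap s s' u u' = 0.
    apply/max_idPl; rewrite subr_le0 (max_idPr su) ge_min s'u //.
  rewrite mulr0 -[RHS]e; apply: eq_Ex => w; ring.
pose m := Num.min s' u'.
have um : u <= m by rewrite le_min uu' ltW.
have m0 := le_trans u0 um.
have -> : overlap s s' u u' = m - u.
  by rewrite /overlap (max_idPr su) -/m; apply/max_idPr; rewrite subr_ge0.
have ms' : m <= s' by rewrite ge_min lexx.
have mu' : m <= u' by rewrite ge_min lexx orbT.
have [L1a E1] := orth u u' (fun w => (a w * xi s u w) * b w) u0 uu'
    (adaptedM (adaptedM aau (adapted_increment k s0 su u0 (lexx u))) ab)
    (L2M (increment_L2 s0 su aa La) Lb).
have [L2a E2] := increment_var hB k u0 um (adaptedM aau ab) (L2M La Lb).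
have aum : adapted B m (fun w => (a w * xi u m w) * b w).
  apply: adaptedM; last exact: adapted_le ab.
  apply: adaptedM; first exact: adapted_le aau.
  exact: adapted_increment.
have LL := L2M (increment_L2 u0 um aau La) Lb.
have [L3a E3] := orth m u' _ m0 mu' aum LL.
have [L4a E4] := orth m s' _ m0 ms' aum LL.
(* [m] is one of [s'] and [u'], so at most one interval extends beyond it. *)
have zero w : xi m s' w * xi m u' w = 0.
  by rewrite /m /increment; case: (leP s' u') => _; rewrite subrr ?mul0r ?mulr0.
have -> : (fun w => a w * xi s s' w * (b w * xi u u' w)) =
   fun w => a w * xi s u w * b w * xi u u' w +
    (a w * b w * xi u m w ^+ 2 +
    (a w * xi u m w * b w * xi m u' w + a w * xi u m w * b w * xi m s' w)).
  apply/funext => w; rewrite (xi_split s u s') (xi_split u m s').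
  rewrite [in LHS](xi_split u m u') [in RHS](xi_split u m u').
  have := zero w; move: (xi m s' w) (xi m u' w) => x y xy.
  transitivity (a w * xi s u w * b w * (xi u m w + y) +
    (a w * b w * xi u m w ^+ 2 +
    (a w * xi u m w * b w * y + a w * xi u m w * b w * x)) + a w * b w * (x * y)).
    by ring.
  by rewrite xy mulr0 addr0.
rewrite ExD ?E1 ?add0r//; last by apply: L1D => //; exact: L1D.
rewrite ExD ?E2//; last exact: L1D.
by rewrite ExD// E3 E4 !addr0 mulrC.
Qed.

Lemma increment_inner s s' u u' a b : 0 <= s -> 0 <= u -> s <= s' -> u <= u' ->
  adapted B s a -> adapted B u b -> L2 P a -> L2 P b ->
  Ex P (fun w => (a w * xi s s' w) * (b w * xi u u' w)) =
  Ex P (fun w => a w * b w) * overlap s s' u u'.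
Proof.
move=> s0 u0 ss' uu' aa ab La Lb; have [su|/ltW us] := leP s u.
  exact: inner_le.
rewrite (_ : overlap s s' u u' = overlap u u' s s'); last first.
  by rewrite /overlap minC (maxC s).
under eq_Ex do rewrite mulrC.
under [in RHS]eq_Ex do rewrite mulrC.
exact: inner_le.
Qed.

Lemma isometry (J : finType) (a : J -> T -> R) (s s' : J -> R) :
  (forall i, 0 <= s i) -> (forall i, s i <= s' i) ->
  (forall i, adapted B (s i) (a i)) -> (forall i, L2 P (a i)) ->
  Ex P (fun w => (\sum_i a i w * xi (s i) (s' i) w) ^+ 2) =
  \sum_i \sum_l Ex P (fun w => a i w * a l w) * overlap (s i) (s' i) (s l) (s' l).
Proof.
move=> s0 ss' aa La.
have LX i := increment_L2 (s0 i) (ss' i) (aa i) (La i).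
transitivity (Ex P (fun w => \sum_i \sum_l
    (a i w * xi (s i) (s' i) w) * (a l w * xi (s l) (s' l) w))).
  by apply: eq_Ex => w; rewrite expr2 big_distrlr.
rewrite Ex_sum; last by move=> i _; apply: L1_sum => l _; exact: L2M.
apply: eq_bigr => i _; rewrite Ex_sum; last by move=> l _; exact: L2M.
by apply: eq_bigr => l _; exact: increment_inner.
Qed.

End IncrementInner.

Lemma cvge0_lt (R : realType) (u v : nat -> \bar R) (e : R) :
  u @ \oo --> 0%E -> v @ \oo --> 0%E -> 0 < e ->
  exists n, (u n < e%:E)%E /\ (v n < e%:E)%E.
Proof.
have key (z : nat -> \bar R) : z @ \oo --> 0%E -> 0 < e ->
    \forall n \near \oo, (z n < e%:E)%E.
  move=> /fine_cvgP[fz /cvgrPdist_lt z0] e0; have := z0 e e0.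
  apply: filterS2 fz => n fn; rewrite sub0r normrN => h.
  by rewrite -[z n]fineK// lte_fin (le_lt_trans (ler_norm _)).
move=> u0 v0 e0.
have [n _ hn] := filterI (key u u0 e0) (key v v0 e0).
by exists n; exact: hn (leqnn n).
Qed.

(** * The norm of processes and of step processes *)

Section ProcessNorm.
Context {disp : measure_display} {T : measurableType disp} {R : realType}.
Variable P : probability T R.
Variable t : R.
Hypothesis t0 : 0 < t.
Local Notation leb := (@lebesgue_measure R).
Implicit Types X Y : R -> T -> R.

(** An integrand is jointly measurable over [[0, t]] only; the indicator extends it by 0, so that
    Tonelli's theorem applies on the full product. *)
Definition jmeasurable X := measurable_fun [set: measurableTypeR R * T]
  (fun z => X z.1 z.2 * \1_(`[0, t]%classic : set R) z.1).

Let sq X (z : measurableTypeR R * T) : \bar R :=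
  ((X z.1 z.2 * \1_(`[0, t]%classic : set R) z.1) ^+ 2)%:E.

Let msq X : jmeasurable X -> measurable_fun setT (sq X).
Proof. by move=> jX; apply/measurable_EFinP; exact: measurable_funX. Qed.

Let sq0 X z : (0 <= sq X z)%E.
Proof. by rewrite lee_fin sqr_ge0. Qed.

Lemma sqnorm_prod X : jmeasurable X ->
  sqnorm_process P t X = (\int[leb \x P]_z sq X z)%E.
Proof.
move=> jX; rewrite (@fubini_tonelli2 _ _ _ _ _ leb P (sq X) (msq jX) (@sq0 X)).
rewrite /sqnorm_process; apply: eq_integral => w _; rewrite /fubini_G [LHS]integral_mkcond.
apply: eq_integral => s _; rewrite patchE /sq/= indicE.
by case: ifPn => _; rewrite ?mulr1 ?mulr0 ?expr0n.
Qed.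

Lemma sqnorm_le X (c : R) : jmeasurable X -> 0 <= c ->
  (forall s, 0 <= s -> s <= t -> (\int[P]_w ((X s w) ^+ 2)%:E <= c%:E)%E) ->
  (sqnorm_process P t X <= (t * c)%:E)%E.
Proof.
move=> jX c0 Xc; rewrite sqnorm_prod// (@fubini_tonelli1 _ _ _ _ _ leb P (sq X) (msq jX) (@sq0 X)).
apply: (@le_trans _ _ (\int[leb]_s (c%:E * (\1_(`[0, t]%classic : set R) s)%:E))%E).
  apply: ge0_le_integral => //.
  - by move=> s _; apply: integral_ge0 => w _; exact: sq0.
  - by apply: measurable_fun_fubini_tonelli_F => //; exact: msq.
  - by apply: measurable_funeM; apply/measurable_EFinP; exact: measurable_indic.
  - move=> s _; rewrite /fubini_F /sq/= indicE.
    case: (boolP (s \in _)) => [|_].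
      rewrite inE/= in_itv/= => /andP[s0 st]; rewrite mule1.
      by under eq_integral do rewrite mulr1; exact: Xc.
    by rewrite mule0; under eq_integral do rewrite mulr0 expr0n; rewrite integral0.
rewrite ge0_integralZl//; last by apply/measurable_EFinP; exact: measurable_indic.
have lE : leb `[0, t]%classic = t%:E.
  by rewrite lebesgue_measure_itv/= lte_fin t0 oppr0 adde0.
rewrite integral_indic// setIT [X in (_ * X)%E](_ : _ = t%:E); last exact: lE.
by rewrite -EFinM mulrC.
Qed.

Lemma sqnormD X Y : jmeasurable X -> jmeasurable Y ->
  (sqnorm_process P t (fun s w => (X s w + Y s w)%R)
   <= 2%:E * sqnorm_process P t X + 2%:E * sqnorm_process P t Y)%E.
Proof.
move=> jX jY.
have jXY : jmeasurable (fun s w => X s w + Y s w).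
  rewrite /jmeasurable; under eq_fun do rewrite mulrDl.
  exact: measurable_funD.
rewrite !sqnorm_prod// -!ge0_integralZl//; try exact: msq.
rewrite -ge0_integralD//.
- apply: ge0_le_integral => //.
  + exact: msq.
  + by apply: emeasurable_funD; apply: measurable_funeM; exact: msq.
  + move=> z _; rewrite /sq -!EFinM -EFinD lee_fin mulrDl.
    move: (X _ _ * _) (Y _ _ * _) => x y; have := sqr_ge0 (x - y); nra.
- by move=> z _; rewrite mule_ge0.
- by apply: measurable_funeM; exact: msq.
- by move=> z _; rewrite mule_ge0.
- by apply: measurable_funeM; exact: msq.
Qed.

Let integral_sqr_step (J : finType) (a : J -> R) (s s' : J -> R) :
  (forall i, 0 <= s i) -> (forall i, s' i <= t) ->
  (\int[leb]_(r in `[0%R, t])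
      (((\sum_i a i * \1_(`]s i, s' i]%classic) r) ^+ 2)%R)%:E =
   ((\sum_i \sum_l a i * a l * overlap (s i) (s' i) (s l) (s' l))%R)%:E)%E.
Proof.
move=> s0 s't.
pose A i l : set R := `]Num.max (s i) (s l), Num.min (s' i) (s' l)]%classic.
have intA i l : leb.-integrable `[0%R, t]%classic (fun r => (\1_(A i l) r)%:E).
  apply: measurable_bounded_integrable => //.
  - by rewrite /= lebesgue_measure_itv/= lte_fin t0 ltry.
  - by apply: measurable_funTS; apply: measurable_indic; rewrite /A.
  - by exists 1; split => // x x1 r _; rewrite /= indicE; case: (_ \in _);
      rewrite ?normr1 ?normr0 ?ltW// (lt_trans ltr01).
transitivity (\int[leb]_(r in `[0%R, t])
    (\sum_i \sum_l (a i * a l)%:E * (\1_(A i l) r)%:E))%E.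
  apply: eq_integral => r _; rewrite expr2 big_distrlr/= -sumEFin.
  apply: eq_bigr => i _; rewrite -sumEFin; apply: eq_bigr => l _.
  rewrite -EFinM mulrACA; congr (_ * _)%:E.
  rewrite -[LHS]/((\1_(`]s i, s' i]%classic) \* \1_(`]s l, s' l]%classic)) r).
  rewrite !indicE/= -natrM mulnb -in_setI; congr (nat_of_bool _)%:R.
  apply/idP/idP; rewrite !inE /A /= !in_itv/= gt_max le_min.
    by move=> [/andP[-> ->] /andP[-> ->]].
  by move=> /andP[/andP[-> ->] /andP[-> ->]].
rewrite integral_sum//; last first.
  by move=> i; apply: integrable_sum => // l _; exact: integrableZl.
rewrite -sumEFin; apply: eq_bigr => i _.
rewrite integral_sum//; last by move=> l; exact: integrableZl.
rewrite -sumEFin; apply: eq_bigr => l _.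
rewrite integralZl// [RHS]EFinM; congr (_ * _)%E.
have mA : measurable (A i l : set (measurableTypeR R)) by rewrite /A.
rewrite integral_indic// setIidl; last first.
  move=> r; rewrite /A/= !in_itv/= gt_max le_min => /andP[/andP[si _] /andP[s'i _]].
  by rewrite (le_trans (s0 i) (ltW si)) (le_trans s'i).
have lE : leb (A i l) = (overlap (s i) (s' i) (s l) (s' l))%:E; last exact: lE.
rewrite /A lebesgue_measure_itv/= lte_fin /overlap.
move: (Num.min _ _) (Num.max (s i) (s l)) => u v.
case: ltP => h; first by rewrite -EFinB (max_idPr _)// subr_ge0 ltW.
by rewrite (max_idPl _)// subr_le0.
Qed.

(** The right-hand side is the double sum of [isometry]: together the two statements are the Ito
    isometry for step processes. *)
Lemma sqnorm_step (J : finType) (a : J -> T -> R) (s s' : J -> R) :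
  (forall i, 0 <= s i) -> (forall i, s' i <= t) -> (forall i, L2 P (a i)) ->
  (sqnorm_process P t (fun r w => (\sum_i a i w * \1_(`]s i, s' i]%classic) r)%R) =
   ((\sum_i \sum_l Ex P (fun w => a i w * a l w) *
      overlap (s i) (s' i) (s l) (s' l))%R)%:E)%E.
Proof.
move=> s0 s't La; rewrite /sqnorm_process.
under eq_integral do rewrite integral_sqr_step//.
have LL i l : L1 P (fun w => a i w * a l w * overlap (s i) (s' i) (s l) (s' l)).
  have := L1Z (overlap (s i) (s' i) (s l) (s' l)) (L2M (La i) (La l)).
  by under eq_fun do rewrite mulrC.
rewrite -ExE; last by apply: L1_sum => i _; exact: L1_sum.
congr EFin; rewrite Ex_sum; last by move=> i _; exact: L1_sum.
apply: eq_bigr => i _; rewrite Ex_sum//; apply: eq_bigr => l _.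
under eq_Ex do rewrite mulrC.
by rewrite ExZ 1?mulrC//; exact: L2M.
Qed.

Lemma jmeasurable_step (J : finType) (a : J -> T -> R) (s s' : J -> R) :
  (forall i, measurable_fun [set: T] (a i)) ->
  jmeasurable (fun r w => \sum_i a i w * \1_(`]s i, s' i]%classic) r).
Proof.
move=> ma; apply: measurable_funM; last first.
  by apply: measurableT_comp => //; exact: measurable_indic.
apply: measurable_sum => i; apply: measurable_funM.
  exact: measurableT_comp.
by apply: measurableT_comp => //; exact: measurable_indic.
Qed.

End ProcessNorm.

Section BrownianMarginals.
Context {disp : measure_display} {T : measurableType disp} {R : realType}.
Variable P : probability T R.

Lemma L1_ae (f g : T -> R) : measurable_fun [set: T] f -> L1 P g ->
  {ae P, forall w, f w = g w} -> L1 P f.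
Proof.
move=> mf Lg fg; apply/integrableP; split; first exact/measurable_EFinP.
have /integrableP[mg gy] := Lg.
suff -> : (\int[P]_w `|(EFin \o f) w| = \int[P]_w `|(EFin \o g) w|)%E by [].
apply: ae_eq_integral => //.
- by apply: measurableT_comp => //; exact/measurable_EFinP.
- exact: measurableT_comp.
- by apply: filterS fg => w fgw _ /=; rewrite fgw.
Qed.

Variables (d : nat) (B : 'I_d -> R -> {RV P >-> R}).
Hypothesis hB : brownian_motion B.

Lemma bm_ae j s : {ae P, forall w, B j s w = increment (fun r => B j r) 0 s w}.
Proof.
by apply: filterS (bm_start hB) => w B0; rewrite /increment B0 subr0.
Qed.

Lemma bm_L1X j s k : 0 <= s -> (k <= 12)%N -> L1 P (fun w => B j s w ^+ k).
Proof.
move=> s0 k12; apply: L1_ae (increment_L1X hB j (lexx 0) s0 k12) _.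
  exact: measurable_funX.
by apply: filterS (bm_ae j s) => w ->.
Qed.

Lemma bm_L2 j s : 0 <= s -> L2 P (B j s).
Proof. by move=> s0; split => //; exact: bm_L1X. Qed.

Lemma bm_moment12 j s : 0 <= s ->
  Ex P (fun w => B j s w ^+ 12) <= 24 ^+ 6 * Num.sqrt 2 * s ^+ 6.
Proof.
move=> s0; rewrite (@ae_eq_Ex _ _ _ P _ (fun w => increment (fun r => B j r) 0 s w ^+ 12)).
- by have := increment_moment12 hB j (lexx 0) s0; rewrite subr0.
- exact: measurable_funX.
- by apply: measurable_funX; exact: measurable_funB.
- by apply: filterS (bm_ae j s) => w ->.
Qed.

End BrownianMarginals.

(** * Distance between the Ito integral and its Riemann sums *)

Section RiemannSums.
Context {disp : measure_display} {T : measurableType disp} {R : realType}.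
Variable P : probability T R.
Variables (d : nat) (B : 'I_d -> R -> {RV P >-> R}).
Hypothesis hB : brownian_motion B.
Variables (t : R) (N : nat).
Hypothesis t0 : 0 < t.
Hypothesis N0 : (0 < N)%N.

Let h := t / N%:R.
Let s (i : nat) : R := i%:R * h.

Definition riemann_sum (j k : 'I_d) (w : T) : R :=
  \sum_(i < N) B j (i%:R * (t / N%:R)) w *
    increment (fun r => B k r) (i%:R * (t / N%:R)) (i.+1%:R * (t / N%:R)) w.

Let NR0 : 0 < N%:R :> R. Proof. by rewrite ltr0n. Qed.

Let h0 : 0 < h. Proof. by rewrite divr_gt0. Qed.

Let s_ge0 i : 0 <= s i. Proof. by rewrite mulr_ge0 ?ler0n// ltW. Qed.

Let s_le i : s i <= s i.+1.
Proof. by rewrite ler_pM2r// ler_nat. Qed.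

Let sN : s N = t. Proof. by rewrite /s /h mulrCA divff ?mulr1// gt_eqF. Qed.

Let s_let i : (i < N)%N -> s i.+1 <= t.
Proof. by move=> iN; rewrite -sN ler_pM2r// ler_nat. Qed.

Let sB i : s i.+1 - s i = h.
Proof. by rewrite /s -mulrBl -natrB// subSnn mul1r. Qed.

Let step (j : 'I_d) (r : R) (w : T) : R :=
  \sum_(i < N) B j (s i) w * \1_(`]s i, s i.+1]%classic) r.

Let step_le j r : 0 <= r -> r <= t ->
  (\int[P]_w ((B j r w - step j r w) ^+ 2)%:E <= h%:E)%E.
Proof.
(* The cells are open on the left: at [r = 0] the step process vanishes, as [B j 0] does almost
   surely. Any other [r] lies in exactly one cell. *)
move=> r0 rt; have [r00|rn0] := eqVneq r 0.
  have st0 w : step j r w = 0.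
    rewrite /step big1// => i _; rewrite indicE memNset ?mulr0//=.
    by rewrite in_itv/= r00 ltNge s_ge0.
  under eq_integral do rewrite st0 subr0.
  rewrite r00 (ae_eq_integral (cst 0%E))//.
  - by rewrite integral0 lee_fin ltW.
  - by apply/measurable_EFinP; exact: measurable_funX.
  - by apply: filterS (bm_start hB) => w B0 _ /=; rewrite B0 expr0n.
have rpos : 0 < r by rewrite lt_neqAle eq_sym rn0.
have exm : exists m, r <= s m by exists N; rewrite sN.
case: (ex_minnP exm) => m rm minm.
have m0 : (0 < m)%N.
  by rewrite lt0n; apply/eqP => m0; move: rm; rewrite m0 /s mul0r leNgt rpos.
pose i := m.-1; have mi : m = i.+1 by rewrite prednK.
have iN : (i < N)%N by rewrite -mi; apply: minm; rewrite sN.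
have sir : s i < r.
  by rewrite ltNge; apply/negP => /minm; rewrite mi ltnn.
rewrite mi in rm.
have stE w : step j r w = B j (s i) w.
  rewrite /step (bigD1 (Ordinal iN))//= big1 ?addr0; last first.
    move=> l li; rewrite indicE memNset ?mulr0//= in_itv/= => /andP[lr rl].
    move/eqP: li; apply; apply/val_inj => /=; apply/eqP; rewrite eqn_leq.
    have := lt_le_trans lr rm; rewrite ltr_pM2r// ltr_nat ltnS => ->/=.
    by have := lt_le_trans sir rl; rewrite ltr_pM2r// ltr_nat ltnS.
  by rewrite indicE mem_set ?mulr1//= in_itv/= sir rm.
have [Lv Ev] := increment_var hB j (s_ge0 i) (ltW sir) (@adapted_cst _ _ _ _ _ B (s i) 1) (L1_cst P 1).
under eq_integral do rewrite stE.
have -> : (\int[P]_w ((B j r w - B j (s i) w) ^+ 2)%:E =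
    \int[P]_w ((cst 1 w : R) * increment (fun r => B j r) (s i) r w ^+ 2)%:E)%E.
  by apply: eq_integral => w _; rewrite mul1r.
rewrite -ExE// Ev (@Ex_cst _ _ _ P 1) mulr1 lee_fin -(sB i) lerD2r//.
Qed.

Variables (j k : 'I_d) (I : T -> R).
Hypothesis hI : is_ito_integral P (natural_filtration (fun l r => B l r)) t
  (fun r => B k r) (fun r => B j r) I.

Lemma riemann_sum_L2 : L2 P (riemann_sum j k).
Proof.
apply: L2_sum => i; apply: (increment_L2 hB k (s_ge0 i) (s_le i)).
  by apply: adapted_B; rewrite ?s_ge0.
exact: (bm_L2 hB j (s_ge0 i)).
Qed.

Lemma ito_L2 : L2 P I.
Proof.
case: hI => _ LI _; split; last exact: Lfun2_integrable_sqr.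
by move: LI; rewrite inE => /andP[]; rewrite inE.
Qed.

Let jB : jmeasurable t (fun r w => B j r w).
Proof.
case: hI => -[mB _ _] _ _; rewrite /jmeasurable.
have := (measurable_restrictT _ (measurableX (measurable_itv `[0, t]) measurableT)).1 mB.
apply: eq_measurable_fun => -[r w] _ /=; rewrite patchE indicE.
have -> : ((r, w) \in `[0, t] `*` [set: T]) = (r \in `[0, t]%classic).
  by apply/idP/idP; rewrite !inE/= => // -[].
by case: ifPn => _; rewrite ?mulr1 ?mulr0.
Qed.

(** An elementary process close to [B j] serves as intermediary. Its integral is close to [I] by
    definition, and close to the Riemann sum by the isometry, because both processes are close to
    [B j]; twice the inequality [(x + y)^2 <= 2 x^2 + 2 y^2] gives the factor 4. *)
Theorem riemann_sum_ito : Ex P (fun w => (I w - riemann_sum j k w) ^+ 2) <= 4 * (t * h).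
Proof.
have LI := ito_L2; have LJ := riemann_sum_L2.
case: hI => _ _ [H [H1 H2]].
apply/ler_addgt0Pr => e e0.
(* The total error is [2 * (e / 6)] from [I] plus [2 * (2 * (e / 6))] from the process norm, that is
   [e]. *)
have e6 : 0 < e / 6 by rewrite divr_gt0.
have [m [m1 m2]] := cvge0_lt H1 H2 e6.
set E := H m in m1 m2 *; set n := el_size E.
pose tm := el_time E; pose a := el_coef E.
have tinc i l : (i <= l)%N -> (l <= n)%N -> tm i <= tm l.
  move=> + ln; elim: l ln => [|l IH] ln; first by rewrite leqn0 => /eqP ->.
  rewrite leq_eqVlt => /predU1P[->//|]; rewrite ltnS => il.
  by rewrite (le_trans (IH (ltnW ln) il))// el_time_incr.
have tge0 i : (i <= n)%N -> 0 <= tm i.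
  by move=> i_n; rewrite (le_trans (el_time_ge0 E))// tinc.
have tlet i : (i <= n)%N -> tm i <= t.
  by move=> i_n; rewrite (le_trans _ (el_time_le E))// tinc.
have La (i : 'I_n) : L2 P (a i).
  have LL := el_coef_L2 (ltn_ord i); split; last exact: Lfun2_integrable_sqr.
  by move: LL; rewrite inE => /andP[]; rewrite inE.
(* The difference of the two integrals is a single family over two unrelated subdivisions, the
   Riemann part carrying the sign [-1]. *)
pose J := ('I_n + 'I_N)%type.
pose b (i : J) : T -> R := match i with inl i => a i | inr i => fun w => -1 * B j (s i) w end.
pose u (i : J) : R := match i with inl i => tm i | inr i => s i end.
pose u' (i : J) : R := match i with inl i => tm i.+1 | inr i => s i.+1 end.
have u0 i : 0 <= u i by case: i => i /=; [exact/tge0/ltnW|exact: s_ge0].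
have uu' i : u i <= u' i by case: i => i /=; [exact: tinc|exact: s_le].
have u't i : u' i <= t by case: i => i /=; [exact: tlet|exact: s_let].
have Lb i : L2 P (b i).
  case: i => i; first exact: La.
  exact: (L2Z (-1) (bm_L2 hB j (s_ge0 i))).
have ab i : adapted B (u i) (b i).
  case: i => i; first exact: el_coef_adapted.
  have aB := @adapted_B _ _ _ P d B j _ _ (s_ge0 i) (lexx (s i)).
  exact: (adaptedM (@adapted_cst _ _ _ _ _ B (s i) (-1)) aB).
pose EI := elementary_integral E (fun r => B k r).
have EIE w : EI w - riemann_sum j k w =
    \sum_i b i w * increment (fun r => B k r) (u i) (u' i) w.
  rewrite big_sumType/=; congr (_ + _).
  by rewrite -sumrN; apply: eq_bigr => i _; rewrite mulN1r mulNr.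
have iso := isometry hB k u0 uu' ab Lb.
have isoS := sqnorm_step t0 u0 u't Lb.
have LEI : L2 P EI.
  by apply: L2_sum => i; apply: (increment_L2 hB k) => //; [exact/tge0/ltnW|exact: tinc|exact: (el_coef_adapted (ltn_ord i))].
have procE : (fun r w => (\sum_i b i w * \1_(`]u i, u' i]%classic) r)%R) =
   fun r w => (elementary_process E r w - B j r w) + (B j r w - step j r w).
  apply/funext => r; apply/funext => w; rewrite big_sumType/= addrA subrK.
  by congr (_ + _); rewrite -sumrN; apply: eq_bigr => i _; rewrite mulN1r mulNr.
have jE : jmeasurable t (elementary_process E).
  apply: (@jmeasurable_step _ T R t _ (fun i : 'I_n => a i) (fun i => tm i) (fun i => tm i.+1)).
  by move=> i; exact: (proj1 (La i)).
have jS : jmeasurable t (step j).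
  by apply: (@jmeasurable_step _ T R t _ (fun i : 'I_N => B j (s i)) (fun i => s i) (fun i => s i.+1)).
have jmB (X Y : R -> T -> R) : jmeasurable t X -> jmeasurable t Y ->
    jmeasurable t (fun r w => X r w - Y r w).
  move=> jX jY; rewrite /jmeasurable; under eq_fun do rewrite mulrBl.
  exact: measurable_funB.
have q2 : (sqnorm_process P t (fun r w => B j r w - step j r w)%R <= (t * h)%:E)%E.
  by apply: sqnorm_le => //; [exact: jmB|exact: ltW|exact: step_le].
have q : Ex P (fun w => (EI w - riemann_sum j k w) ^+ 2) <= 2 * (e / 6) + 2 * (t * h).
  under eq_Ex do rewrite EIE.
  rewrite iso -lee_fin -isoS procE (le_trans (sqnormD P (jmB _ _ jE jB) (jmB _ _ jB jS)))//.
  rewrite [leRHS]EFinD; apply: leeD; rewrite [leRHS]EFinM.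
    by rewrite lee_wpmul2l// ?lee_fin// ltW.
  by rewrite lee_wpmul2l// lee_fin.
have LD1 := L2B LEI LI; have LD2 := L2B LEI LJ.
have q3 : Ex P (fun w => (EI w - I w) ^+ 2) <= e / 6.
  by rewrite -lee_fin ExE; [rewrite ltW//; move: m2; rewrite unlock|exact: (proj2 LD1)].
have := le_Ex (proj2 (L2B LI LJ)) (L1D (L1Z 2 (proj2 LD1)) (L1Z 2 (proj2 LD2))).
have hpt w : (I w - riemann_sum j k w) ^+ 2 <=
    2 * (EI w - I w) ^+ 2 + 2 * (EI w - riemann_sum j k w) ^+ 2.
  move: (I w) (EI w) (riemann_sum j k w) => x y z.
  have := sqr_ge0 (y - x + (y - z)); nra.
move=> /(_ hpt); rewrite ExD; [|exact: L1Z (proj2 LD1)|exact: L1Z (proj2 LD2)].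
rewrite (ExZ _ (proj2 LD1)) (ExZ _ (proj2 LD2)).
move: q q3; lra.
Qed.

End RiemannSums.

(** * The backward equation and its discretization *)

Section ScalarSteps.
Variable R : realType.
Implicit Types (a q p psi x rho K h : R).

Lemma ler_norm_sum_bound (J : finType) (F : J -> R) (c : J -> R) :
  (forall i, `|F i| <= c i) -> `|\sum_i F i| <= \sum_i c i.
Proof.
by move=> Fc; rewrite (le_trans (ler_norm_sum _ _ _))// ler_sum.
Qed.

Lemma amplitude_le a q : 0 <= a -> a <= 1 -> a * expR q <= 1 ->
  a * Num.max 1 (expR q) <= 1.
Proof.
by move=> a0 a1 aq; rewrite maxr_pMr// mulr1 ge_max a1 aq.
Qed.

(** Here [rho] is the size of the increment and [x] that of the position; all that is dropped has
    degree at least 3 in [rho]. In the constant, 128 is 4 from the Taylor bound, 8 from the cube of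
    [2 * K], and 4 from [(rho + rho^2)^3 <= 4 (rho^3 + rho^6)]; the 3 counts the products [q1 * q2],
    [q2 ^+ 2 / 2] and [q2 * p]. *)
Lemma space_step a q1 q2 p psi x rho K : 0 <= a -> a <= 1 ->
  a * expR (q1 + q2) <= 1 -> 1 <= x -> 0 <= rho -> 0 <= K ->
  `|q1| <= K * x * rho -> `|q2| <= K * rho ^+ 2 -> `|p| <= K * x * rho ->
  `|a * (expR (q1 + q2) * cos (psi + p))
    - a * (cos psi * (1 + q1 + q2 + q1 ^+ 2 / 2 - p ^+ 2 / 2)
           - sin psi * (p + q1 * p))|
  <= (128 * K ^+ 3 + 3 * K ^+ 2) * (x ^+ 4 * (rho ^+ 3 + rho ^+ 6)).
Proof.
move=> a0 a1 aq x1 r0 K0 h1 h2 hp.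
have x0 : 0 <= x := le_trans ler01 x1.
have amax := amplitude_le a0 a1 aq.
have tay := expR_cos_taylor psi p (q1 + q2).
set D := expR (q1 + q2) * cos (psi + p) - _ in tay.
have -> : a * (expR (q1 + q2) * cos (psi + p))
    - a * (cos psi * (1 + q1 + q2 + q1 ^+ 2 / 2 - p ^+ 2 / 2)
           - sin psi * (p + q1 * p)) =
   a * D + a * (cos psi * (q1 * q2 + q2 ^+ 2 / 2) - sin psi * (q2 * p)).
  by rewrite /D; field.
have r34 : rho ^+ 4 <= rho ^+ 3 + rho ^+ 6.
  have : 0 <= rho ^+ 3 * (1 - rho + rho ^+ 3).
    rewrite mulr_ge0// ?exprn_ge0//.
    have : 0 <= rho * (1 - rho) ^+ 2 by rewrite mulr_ge0// sqr_ge0.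
    have := sqr_ge0 (1 - rho); nra.
  by move=> u0; rewrite -subr_ge0 (_ : _ - _ = rho ^+ 3 * (1 - rho + rho ^+ 3)) //; ring.
have x14 : x <= x ^+ 4 by rewrite exprS ler_peMr// exprn_ege1.
have x34 : x ^+ 3 <= x ^+ 4 by rewrite ler_weXn2l.
have x04 : 1 <= x ^+ 4 by rewrite exprn_ege1.
have b1 : `|a * D| <= 128 * K ^+ 3 * (x ^+ 4 * (rho ^+ 3 + rho ^+ 6)).
  rewrite normrM ger0_norm// (le_trans (ler_wpM2l a0 tay))//.
  rewrite mulrCA (le_trans (ler_wpM2l _ amax)) ?mulr_ge0 ?exprn_ge0 ?addr_ge0// mulr1.
  have qp : `|q1 + q2| + `|p| <= 2 * K * x * (rho + rho ^+ 2).
    apply: (@le_trans _ _ (K * x * rho + K * rho ^+ 2 + K * x * rho)).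
      by rewrite lerD// (le_trans (ler_normD _ _))// lerD.
    rewrite -subr_ge0.
    have -> : 2 * K * x * (rho + rho ^+ 2) - (K * x * rho + K * rho ^+ 2 + K * x * rho)
      = K * rho ^+ 2 * (x - 1) + K * x * rho ^+ 2 by ring.
    by rewrite addr_ge0// !mulr_ge0// ?subr_ge0// exprn_ge0.
  have qp3 : (`|q1 + q2| + `|p|) ^+ 3 <= (2 * K * x * (rho + rho ^+ 2)) ^+ 3.
    by rewrite lerXn2r// nnegrE ?addr_ge0// !mulr_ge0// addr_ge0// exprn_ge0.
  rewrite (le_trans (ler_wpM2l _ qp3))//.
  have cube : (rho + rho ^+ 2) ^+ 3 <= 4 * (rho ^+ 3 + rho ^+ 6).
    rewrite -subr_ge0.
    have -> : 4 * (rho ^+ 3 + rho ^+ 6) - (rho + rho ^+ 2) ^+ 3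
      = 3 * rho ^+ 3 * ((1 + rho) * (1 - rho) ^+ 2) by ring.
    apply: mulr_ge0; first by rewrite mulr_ge0// exprn_ge0.
    by apply: mulr_ge0; [rewrite addr_ge0|exact: sqr_ge0].
  have -> : 4 * (2 * K * x * (rho + rho ^+ 2)) ^+ 3 =
    32 * K ^+ 3 * (x ^+ 3 * (rho + rho ^+ 2) ^+ 3) by ring.
  have -> : 128 * K ^+ 3 * (x ^+ 4 * (rho ^+ 3 + rho ^+ 6)) =
    32 * K ^+ 3 * (x ^+ 4 * (4 * (rho ^+ 3 + rho ^+ 6))) by ring.
  rewrite ler_wpM2l ?mulr_ge0 ?exprn_ge0// ler_pM ?exprn_ge0//.
  by rewrite addr_ge0// exprn_ge0.
have c1 : `|q1 * q2| <= K ^+ 2 * (x ^+ 4 * (rho ^+ 3 + rho ^+ 6)).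
  rewrite normrM (le_trans (ler_pM _ _ h1 h2))//.
  have -> : K * x * rho * (K * rho ^+ 2) = K ^+ 2 * (x * rho ^+ 3) by ring.
  rewrite ler_wpM2l ?exprn_ge0// ler_pM ?exprn_ge0//.
  by rewrite lerDl exprn_ge0.
have c2 : `|q2 ^+ 2 / 2| <= K ^+ 2 * (x ^+ 4 * (rho ^+ 3 + rho ^+ 6)).
  rewrite normrM (ger0_norm (_ : 0 <= 2^-1))// normrX.
  rewrite (@le_trans _ _ (`|q2| ^+ 2))//.
    by rewrite ler_piMr ?exprn_ge0// invf_le1// ler1n.
  have h22 : `|q2| ^+ 2 <= (K * rho ^+ 2) ^+ 2.
    by rewrite lerXn2r// nnegrE// mulr_ge0// exprn_ge0.
  rewrite (le_trans h22)//.
  have -> : (K * rho ^+ 2) ^+ 2 = K ^+ 2 * (1 * rho ^+ 4) by ring.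
  by rewrite ler_wpM2l ?exprn_ge0// ler_pM ?exprn_ge0.
have c3 : `|q2 * p| <= K ^+ 2 * (x ^+ 4 * (rho ^+ 3 + rho ^+ 6)).
  rewrite normrM mulrC (le_trans (ler_pM _ _ hp h2))//.
  have -> : K * x * rho * (K * rho ^+ 2) = K ^+ 2 * (x * rho ^+ 3) by ring.
  rewrite ler_wpM2l ?exprn_ge0// ler_pM ?exprn_ge0//.
  by rewrite lerDl exprn_ge0.
have b2 : `|a * (cos psi * (q1 * q2 + q2 ^+ 2 / 2) - sin psi * (q2 * p))|
   <= 3 * K ^+ 2 * (x ^+ 4 * (rho ^+ 3 + rho ^+ 6)).
  rewrite normrM ger0_norm// (@le_trans _ _ (1 * `|cos psi * (q1 * q2 + q2 ^+ 2 / 2) - sin psi * (q2 * p)|))//.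
    by rewrite ler_wpM2r.
  rewrite mul1r (le_trans (ler_normB _ _))// !normrM.
  have d1 : `|cos psi| * `|q1 * q2 + q2 ^+ 2 / 2| <= `|q1 * q2 + q2 ^+ 2 / 2|.
    by rewrite ler_piMl// cos_le_norm1.
  have d2 : `|sin psi| * (`|q2| * `|p|) <= `|q2 * p|.
    by rewrite normrM ler_piMl ?mulr_ge0// sin_le_norm1.
  have d3 := ler_normD (q1 * q2) (q2 ^+ 2 / 2).
  move: c1 c2 c3 d1 d2 d3; set B := K ^+ 2 * _; rewrite -mulrA -/B; lra.
rewrite (le_trans (ler_normD _ _))// mulrDl lerD//.
Qed.

(** [q3] is the variation of the exponent in time and [e1] its derivative. The hypotheses give
    [|q3| <= (1 + t) * K * h * x^2], whose square is the first summand of the bound. *)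
Lemma time_step a q3 e1 h x K t : 0 <= a -> a <= 1 -> a * expR q3 <= 1 ->
  0 <= h -> h <= t -> 1 <= x -> 0 <= K ->
  `|e1| <= K * x ^+ 2 -> `|q3 - h * e1| <= K * h ^+ 2 * x ^+ 2 ->
  `|a * expR q3 - a * (1 + h * e1)| <= ((1 + t) ^+ 2 * K ^+ 2 + K) * (x ^+ 4 * h ^+ 2).
Proof.
move=> a0 a1 aq h0 ht x1 K0 e1K qK.
have amax := amplitude_le a0 a1 aq.
have x0 : 0 <= x := le_trans ler01 x1.
have tay := expR_taylor2 q3.
have q3b : `|q3| <= (1 + t) * K * h * x ^+ 2.
  have -> : q3 = (q3 - h * e1) + h * e1 by rewrite subrK.
  rewrite (le_trans (ler_normD _ _))// normrM (ger0_norm h0).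
  apply: (@le_trans _ _ (K * h ^+ 2 * x ^+ 2 + h * (K * x ^+ 2))).
    by rewrite lerD// ler_wpM2l.
  have -> : K * h ^+ 2 * x ^+ 2 + h * (K * x ^+ 2) = (h + 1) * (K * h * x ^+ 2) by ring.
  have -> : (1 + t) * K * h * x ^+ 2 = (1 + t) * (K * h * x ^+ 2) by ring.
  by rewrite ler_wpM2r ?mulr_ge0 ?exprn_ge0// addrC lerD2l.
have -> : a * expR q3 - a * (1 + h * e1) = a * (expR q3 - 1 - q3) + a * (q3 - h * e1) by ring.
rewrite (le_trans (ler_normD _ _))// mulrDl lerD//.
  rewrite normrM ger0_norm// (le_trans (ler_wpM2l a0 tay))// mulrCA.
  rewrite (le_trans (ler_wpM2l _ amax)) ?exprn_ge0// mulr1.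
  have -> : (1 + t) ^+ 2 * K ^+ 2 * (x ^+ 4 * h ^+ 2) = ((1 + t) * K * h * x ^+ 2) ^+ 2 by ring.
  by rewrite lerXn2r// nnegrE !mulr_ge0// ?exprn_ge0// addr_ge0// (le_trans h0).
rewrite normrM ger0_norm// (@le_trans _ _ (1 * `|q3 - h * e1|)) ?ler_wpM2r//.
rewrite mul1r (le_trans qK)// -mulrA ler_wpM2l// mulrC ler_wpM2r ?exprn_ge0//.
by rewrite ler_weXn2l.
Qed.

(** Each summand is bounded by the largest one, whose power is one of the terms on the right. *)
Lemma exprD_sum_le (J : finType) (u : J -> R) n : (forall i, 0 <= u i) ->
  (\sum_i u i) ^+ n.+1 <= #|J|%:R ^+ n.+1 * \sum_i u i ^+ n.+1.
Proof.
move=> u0; case: (pickP [pred i : J | true]) => [i0 _|J0]; last first.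
  by rewrite big1 ?expr0n ?mulr_ge0 ?sumr_ge0// => i; have := J0 i.
case: (@arg_maxP _ _ _ i0 predT u isT) => m _ um.
have le1 : \sum_i u i <= #|J|%:R * u m.
  rewrite -sum1_card natr_sum mulr_suml; apply: ler_sum => i _.
  by rewrite mul1r; exact: um.
apply: (@le_trans _ _ ((#|J|%:R * u m) ^+ n.+1)).
  by rewrite lerXn2r// nnegrE ?sumr_ge0// mulr_ge0.
rewrite exprMn ler_wpM2l ?exprn_ge0// (bigD1 m)//= lerDl.
by apply: sumr_ge0 => i _; rewrite exprn_ge0.
Qed.

End ScalarSteps.

(** * Expansion of the profile over one time step *)

Section OneStep.
Variables (R : realType) (d : nat) (Theta Q : 'M[R]_d) (l : 'rV[R]_d).
Variables (gamma : 'cV[R]_d) (alpha t : R).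
Hypothesis skewTheta : Theta^T = - Theta.
Hypothesis QQ : Q *m Q^T = 1%:M.
Hypothesis spec : Theta^T *m Theta = Q^T *m diag_mx l *m Q.
Hypothesis t0 : 0 <= t.

Local Notation G := (Q *m Theta^T).

Definition ycoord (b : 'I_d -> R) (k : 'I_d) : R :=
  \sum_j G k j * b j + 2 * (Q *m gamma) k 0.

(** The vector [Theta^T b + 2 gamma] in the standard basis, where [ycoord] gives it in the
    eigenbasis; half of it is the slope of the phase in [xi]. *)
Definition zcoord (b : 'I_d -> R) (j : 'I_d) : R :=
  \sum_i Theta i j * b i + 2 * gamma j 0.

Definition tanh_coef (tau : R) (k : 'I_d) : R := riccati (Num.sqrt (l 0 k)) tau.

Definition expo (tau : R) (b : 'I_d -> R) : R :=
  - (2^-1 * \sum_k ln_cosh (Num.sqrt (l 0 k)) tau)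
  - 4^-1 * \sum_k tanh_coef tau k * ycoord b k ^+ 2.

(** [J] stands for [tr (Theta^T A)], which the characteristic function multiplies by one half. *)
Definition phase (J : R) (b : 'I_d -> R) : R :=
  J / 2 + \sum_j gamma j 0 * b j + alpha.

Definition profile (tau J : R) (b : 'I_d -> R) : R :=
  expR (expo tau b) * cos (phase J b).

Definition grad (tau : R) (b : 'I_d -> R) (j : 'I_d) : R :=
  - (2^-1 * \sum_k ycoord b k * tanh_coef tau k * G k j).

(** Half the Hessian of [expo tau]. It does not depend on the position, so that the expansion
    [expo_shift] is exact. *)
Definition hess (tau : R) (i j : 'I_d) : R :=
  - (4^-1 * \sum_k tanh_coef tau k * (G k i * G k j)).

(* [coef1] and [coef2] are the coefficients of [xi] and of [xi xi^T] in the expansion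
   of [profile tau] at [(J, b)] along [(<Theta^T b, xi>, xi)]. *)
Definition coef1 (tau J : R) (b : 'I_d -> R) (j : 'I_d) : R :=
  expR (expo tau b) *
  (cos (phase J b) * grad tau b j - sin (phase J b) * (zcoord b j / 2)).

Definition coef2 (tau J : R) (b : 'I_d -> R) (i j : 'I_d) : R :=
  expR (expo tau b) *
  (cos (phase J b) *
     (hess tau i j + grad tau b i * grad tau b j / 2 - zcoord b i * zcoord b j / 8)
   - sin (phase J b) * (grad tau b i * zcoord b j / 2)).

(* The time derivative of [expo], see [bound_time]; [trace_coef2] is thus the
   backward equation. *)
Let drift (tau : R) (b : 'I_d -> R) : R :=
  - (4^-1 * \sum_k l 0 k * tanh_coef tau k)
  - 8^-1 * \sum_k (1 - l 0 k * tanh_coef tau k ^+ 2) * ycoord b k ^+ 2.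

Let l0 k : 0 <= l 0 k. Proof. exact: (spectral_ge0 QQ spec). Qed.

Let lam2 k : Num.sqrt (l 0 k) ^+ 2 = l 0 k.
Proof. by rewrite sqr_sqrtr. Qed.

Let gram k k' : \sum_j G k j * G k' j = l 0 k *+ (k == k').
Proof. exact: (spectral_gramE QQ spec). Qed.

Let QtQ : Q^T *m Q = 1%:M. Proof. exact: mulmx1C. Qed.

Let zE b j : \sum_k Q k j * ycoord b k = zcoord b j.
Proof.
pose bv : 'cV[R]_d := \col_i b i.
have bvE i : bv i 0 = b i by rewrite mxE.
have : (Q^T *m (G *m bv + 2 *: (Q *m gamma))) j 0 = (Theta^T *m bv + 2 *: gamma) j 0.
  by rewrite mulmxDr -scalemxAr !mulmxA QtQ !mul1mx.
move=> e; transitivity ((Q^T *m (G *m bv + 2 *: (Q *m gamma))) j 0).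
  rewrite mxE; apply: eq_bigr => k _; rewrite [(Q^T) j k]mxE; congr (_ * _).
  rewrite [in RHS]mxE /ycoord; congr (_ + _); last by rewrite [in RHS]mxE.
  by rewrite [in RHS]mxE; apply: eq_bigr => i _; rewrite bvE.
rewrite e mxE /zcoord; congr (_ + _); last by rewrite mxE.
by rewrite mxE; apply: eq_bigr => i _; rewrite !mxE.
Qed.

Let normz b : \sum_j zcoord b j ^+ 2 = \sum_k ycoord b k ^+ 2.
Proof.
pose yv : 'cV[R]_d := \col_k ycoord b k.
have e : (Q^T *m yv)^T *m (Q^T *m yv) = yv^T *m yv.
  by rewrite trmx_mul trmxK mulmxA -(mulmxA yv^T) QQ mulmx1.
have e' : ((Q^T *m yv)^T *m (Q^T *m yv)) 0 0 = (yv^T *m yv) 0 0 by rewrite e.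
rewrite [LHS]mxE [RHS]mxE in e'.
transitivity (\sum_j ((Q^T *m yv)^T) 0 j * (Q^T *m yv) j 0).
  apply: eq_bigr => j _; rewrite [X in X * _]mxE -expr2; congr (_ ^+ 2).
  by rewrite -zE mxE; apply: eq_bigr => k _; rewrite !mxE.
by rewrite e'; apply: eq_bigr => k _; rewrite !mxE -expr2.
Qed.

Let normgrad tau b :
  \sum_j grad tau b j ^+ 2 = 4^-1 * \sum_k l 0 k * tanh_coef tau k ^+ 2 * ycoord b k ^+ 2.
Proof.
pose c k := ycoord b k * tanh_coef tau k.
transitivity (4^-1 * \sum_j \sum_k \sum_k' c k * c k' * (G k j * G k' j)).
  rewrite mulr_sumr; apply: eq_bigr => j _.
  rewrite /grad sqrrN exprMn (_ : 2^-1 ^+ 2 = 4^-1); last by field.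
  rewrite expr2 big_distrlr /=; congr (_ * _); apply: eq_bigr => k _.
  by apply: eq_bigr => k' _; rewrite /c; ring.
congr (_ * _); rewrite exchange_big; apply: eq_bigr => k _ /=.
rewrite exchange_big /= (bigD1 k)//= [X in _ + X]big1 ?addr0; last first.
  by move=> k' kk'; rewrite -mulr_sumr gram eq_sym (negbTE kk') mulr0n mulr0.
by rewrite -mulr_sumr gram eqxx mulr1n /c; ring.
Qed.

Let gradz tau b : \sum_j grad tau b j * zcoord b j = 0.
Proof.
have := spectral_cross skewTheta QQ spec (fun x => riccati (Num.sqrt x) tau) (ycoord b).
move=> e; transitivity (- 2^-1 * \sum_j (\sum_k ycoord b k * riccati (Num.sqrt (l 0 k)) tau * G k j) *
     (\sum_k Q k j * ycoord b k)); last by rewrite e mulr0.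
rewrite mulr_sumr; apply: eq_bigr => j _.
by rewrite zE /grad /tanh_coef; ring.
Qed.

Let tr_hess tau : \sum_i hess tau i i = - (4^-1 * \sum_k l 0 k * tanh_coef tau k).
Proof.
rewrite /hess sumrN -mulr_sumr exchange_big /=; congr (- (_ * _)).
apply: eq_bigr => k _; rewrite -mulr_sumr gram eqxx mulr1n mulrC.
by [].
Qed.

(** The term [|grad|^2 / 2] is [1/8] times the sum of [l T^2 y^2], while [- |z|^2 / 8] is [- 1/8]
    times the sum of [y^2]: together they form the Riccati derivative. The trace of [hess] is the
    derivative of the [ln_cosh] part, and the sine terms cancel by [gradz]. *)
Lemma trace_coef2 tau J b :
  \sum_i coef2 tau J b i i = expR (expo tau b) * cos (phase J b) * drift tau b.
Proof.
transitivity (expR (expo tau b) * (cos (phase J b) *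
   (\sum_i hess tau i i + (\sum_i grad tau b i ^+ 2) / 2 - (\sum_i zcoord b i ^+ 2) / 8)
   - sin (phase J b) * ((\sum_i grad tau b i * zcoord b i) / 2))).
  rewrite /coef2 -mulr_sumr; congr (_ * _).
  rewrite !mulr_suml -!sumrN -!big_split /= !mulr_sumr -sumrN -big_split /=.
  by apply: eq_bigr => i _; rewrite !expr2; ring.
rewrite gradz tr_hess normgrad normz mul0r mulr0 subr0 -mulrA; congr (_ * (_ * _)).
rewrite /drift.
have -> : \sum_k (1 - l 0 k * tanh_coef tau k ^+ 2) * ycoord b k ^+ 2 =
  \sum_k ycoord b k ^+ 2 - \sum_k l 0 k * tanh_coef tau k ^+ 2 * ycoord b k ^+ 2.
  by rewrite -sumrB; apply: eq_bigr => k _; ring.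
by field.
Qed.

Let addf (b xi : 'I_d -> R) j := b j + xi j.

Let expo_shift tau b xi : expo tau (addf b xi) = expo tau b +
  (\sum_j grad tau b j * xi j + \sum_i \sum_j hess tau i j * (xi i * xi j)).
Proof.
pose g k := \sum_j G k j * xi j.
have yE k : ycoord (addf b xi) k = ycoord b k + g k.
  rewrite /ycoord /g addrAC -big_split /=; congr (_ + _).
  by apply: eq_bigr => j _; rewrite /addf mulrDr.
have e1 : \sum_j grad tau b j * xi j = - (2^-1 * \sum_k tanh_coef tau k * ycoord b k * g k).
  rewrite /grad /g mulr_sumr -sumrN.
  under [RHS]eq_bigr do rewrite mulr_sumr mulr_sumr -sumrN.
  rewrite [RHS]exchange_big /=; apply: eq_bigr => j _.
  rewrite mulNr mulr_sumr mulr_suml -sumrN; apply: eq_bigr => k _; ring.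
have e2 : \sum_i \sum_j hess tau i j * (xi i * xi j) =
   - (4^-1 * \sum_k tanh_coef tau k * g k ^+ 2).
  transitivity (\sum_i \sum_j \sum_k - (4^-1 * (tanh_coef tau k * ((G k i * xi i) * (G k j * xi j))))).
    apply: eq_bigr => i _; apply: eq_bigr => j _.
    rewrite /hess mulNr mulr_sumr mulr_suml -sumrN; apply: eq_bigr => k _; ring.
  under eq_bigr do rewrite exchange_big /=.
  rewrite exchange_big /= mulr_sumr -sumrN; apply: eq_bigr => k _.
  rewrite /g expr2 big_distrlr /= !mulr_sumr -sumrN; apply: eq_bigr => i _.
  by rewrite !mulr_sumr -sumrN.
rewrite e1 e2 /expo -!addrA; congr (_ + _).
have -> : \sum_k tanh_coef tau k * ycoord (addf b xi) k ^+ 2 =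
  \sum_k tanh_coef tau k * ycoord b k ^+ 2 +
  (2 * \sum_k tanh_coef tau k * ycoord b k * g k + \sum_k tanh_coef tau k * g k ^+ 2).
  rewrite mulr_sumr -!big_split /=; apply: eq_bigr => k _; rewrite yE; ring.
by field.
Qed.

Let phase_shift J b xi :
  phase (J + \sum_j (\sum_i Theta i j * b i) * xi j) (addf b xi) =
  phase J b + \sum_j zcoord b j / 2 * xi j.
Proof.
rewrite /phase /addf.
have -> : \sum_j gamma j 0 * (b j + xi j) =
    \sum_j gamma j 0 * b j + \sum_j gamma j 0 * xi j.
  by rewrite -big_split; apply: eq_bigr => j _; rewrite mulrDr.
have -> : \sum_j zcoord b j / 2 * xi j =
    (\sum_j (\sum_i Theta i j * b i) * xi j) / 2 + \sum_j gamma j 0 * xi j.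
  rewrite mulr_suml -big_split; apply: eq_bigr => j _.
  by rewrite /zcoord /=; field.
by rewrite mulrDl; ring.
Qed.

Let D : R := d%:R.
Let M : R := 1 + (\sum_i \sum_j `|Theta i j| + (\sum_i \sum_j `|G i j| +
  (\sum_k `|2 * (Q *m gamma) k 0| + (\sum_j `|2 * gamma j 0| + \sum_k l 0 k)))).

Let S1 := \sum_i \sum_j `|Theta i j|.
Let S2 := \sum_i \sum_j `|G i j|.
Let S3 := \sum_k `|2 * (Q *m gamma) k 0|.
Let S4 := \sum_j `|2 * gamma j 0|.
Let S5 := \sum_k l 0 k.
Let sum_ge0 (F : 'I_d -> R) : (forall i, 0 <= F i) -> 0 <= \sum_i F i.
Proof. by move=> F0; exact: sumr_ge0. Qed.
Let S10 : 0 <= S1. Proof. by apply: sum_ge0 => i; exact: sum_ge0. Qed.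
Let S20 : 0 <= S2. Proof. by apply: sum_ge0 => i; exact: sum_ge0. Qed.
Let S30 : 0 <= S3. Proof. exact: sum_ge0. Qed.
Let S40 : 0 <= S4. Proof. exact: sum_ge0. Qed.
Let S50 : 0 <= S5. Proof. exact: sum_ge0. Qed.
Let ME : M = 1 + (S1 + (S2 + (S3 + (S4 + S5)))). Proof. by []. Qed.

Let term_le (F : 'I_d -> R) i : (forall i, 0 <= F i) -> F i <= \sum_i F i.
Proof. by move=> F0; rewrite (bigD1 i)//= lerDl sumr_ge0. Qed.

Let M1 : 1 <= M.
Proof. by rewrite ME lerDl !addr_ge0. Qed.

Let M0 : 0 <= M. Proof. exact: le_trans M1. Qed.

Let boundTheta i j : `|Theta i j| <= M.
Proof.
have h1 : `|Theta i j| <= \sum_j `|Theta i j| by exact: (@term_le (fun j => `|Theta i j|)).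
have h2 : \sum_j `|Theta i j| <= S1.
  by apply: (@term_le (fun i => \sum_j `|Theta i j|)) => i'; exact: sum_ge0.
move: S20 S30 S40 S50; rewrite ME; lra.
Qed.

Let boundG i j : `|G i j| <= M.
Proof.
have h1 : `|G i j| <= \sum_j `|G i j| by exact: (@term_le (fun j => `|G i j|)).
have h2 : \sum_j `|G i j| <= S2.
  by apply: (@term_le (fun i => \sum_j `|G i j|)) => i'; exact: sum_ge0.
move: S10 S30 S40 S50; rewrite ME; lra.
Qed.

Let bound3 k : `|2 * (Q *m gamma) k 0| <= M.
Proof.
have h2 : `|2 * (Q *m gamma) k 0| <= S3 by exact: (@term_le (fun k => `|2 * (Q *m gamma) k 0|)).
move: S10 S20 S40 S50; rewrite ME; lra.
Qed.

Let bound4 j : `|2 * gamma j 0| <= M.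
Proof.
have h2 : `|2 * gamma j 0| <= S4 by exact: (@term_le (fun j => `|2 * gamma j 0|)).
move: S10 S20 S30 S50; rewrite ME; lra.
Qed.

Let boundl k : l 0 k <= M.
Proof.
have h2 : l 0 k <= S5 by exact: (@term_le (fun k => l 0 k)).
move: S10 S20 S30 S40; rewrite ME; lra.
Qed.

Definition size1 (b : 'I_d -> R) : R := \sum_j `|b j|.

Let x b := 1 + size1 b.

Let size1_ge0 b : 0 <= size1 b. Proof. exact: sum_ge0. Qed.

Let x1 b : 1 <= x b. Proof. by rewrite lerDl. Qed.

Let x0 b : 0 <= x b. Proof. exact: le_trans (x1 b). Qed.

Let lin_bound (F c : 'I_d -> R) (K : R) b : (forall j, `|F j| <= K) ->
  `|\sum_j F j * b j| <= K * size1 b.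
Proof.
move=> FK; rewrite /size1 mulr_sumr; apply: ler_norm_sum_bound => j.
by rewrite normrM ler_wpM2r.
Qed.

Let bound_y b k : `|ycoord b k| <= M * x b.
Proof.
rewrite /ycoord /x mulrDr mulr1 addrC (le_trans (ler_normD _ _))// lerD//.
exact: (@lin_bound (fun j => G k j) (fun j => G k j)).
Qed.

Let bound_z b j : `|zcoord b j| <= M * x b.
Proof.
rewrite /zcoord /x mulrDr mulr1 addrC (le_trans (ler_normD _ _))// lerD//.
exact: (@lin_bound (fun i => Theta i j) (fun i => Theta i j)).
Qed.

Let bound_T tau k : 0 <= tau -> tau <= t -> 0 <= tanh_coef tau k <= t.
Proof.
move=> tau0 taut; have /andP[h1 h2] := riccati_bound (Num.sqrt (l 0 k)) tau0.
rewrite h1/=; move: h2 taut tau0; rewrite /tanh_coef; lra.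
Qed.

Let sum_cst (c : R) : \sum_(i < d) c = D * c.
Proof. by rewrite sumr_const card_ord mulr_natl. Qed.

Let D0 : 0 <= D. Proof. exact: ler0n. Qed.

Let bound_grad tau b j : 0 <= tau -> tau <= t ->
  `|grad tau b j| <= D * t * M ^+ 2 * x b.
Proof.
move=> tau0 taut; rewrite /grad normrN normrM ger0_norm//.
have : `|\sum_k ycoord b k * tanh_coef tau k * G k j| <= \sum_(k < d) (M * x b * t * M).
  apply: ler_norm_sum_bound => k; have := bound_T k tau0 taut.
  move: (tanh_coef tau k) => T /andP[T0 Tt].
  by rewrite 2!normrM (ger0_norm T0) ler_pM ?mulr_ge0// ler_pM.
rewrite sum_cst (_ : D * (M * x b * t * M) = D * t * M ^+ 2 * x b); last by ring.
move=> h; apply: (le_trans _ h); rewrite ler_piMl//.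
by rewrite invf_le1// ler1n.
Qed.

Let bound_hess tau i j : 0 <= tau -> tau <= t -> `|hess tau i j| <= D * t * M ^+ 2.
Proof.
move=> tau0 taut; rewrite /hess normrN normrM ger0_norm//.
have : `|\sum_k tanh_coef tau k * (G k i * G k j)| <= \sum_(k < d) (t * (M * M)).
  apply: ler_norm_sum_bound => k; have := bound_T k tau0 taut.
  move: (tanh_coef tau k) => T /andP[T0 Tt].
  by rewrite normrM (ger0_norm T0) normrM ler_pM ?mulr_ge0// ler_pM.
rewrite sum_cst (_ : D * (t * (M * M)) = D * t * M ^+ 2); last by ring.
move=> h; apply: (le_trans _ h); rewrite ler_piMl//.
by rewrite invf_le1// ler1n.
Qed.

(** One constant for all the bounds: [D] counts the summands over coordinates, [t] bounds
    [tanh_coef], and the highest power of [M], the cube, occurs in [bound_time]. *)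
Let K : R := (D + 1) * (1 + t) * M ^+ 3.

Let K_DtM2 : D * t * M ^+ 2 <= K.
Proof.
rewrite /K [M ^+ 3]exprSr mulrA; apply: (@le_trans _ _ ((D + 1) * (1 + t) * M ^+ 2)).
  rewrite ler_wpM2r ?exprn_ge0// ler_pM// ?lerDl ?lerDr//.
by rewrite ler_peMr// !mulr_ge0// ?addr_ge0// exprn_ge0.
Qed.

Let K_M : M <= K.
Proof.
rewrite /K [M ^+ 3]exprSr mulrA ler_peMl// -[X in X <= _]mulr1 ler_pM// ?exprn_ege1//.
by rewrite -[X in X <= _]mulr1 ler_pM// ?lerDl ?lerDr.
Qed.

Let K0 : 0 <= K. Proof. exact: le_trans K_M. Qed.

(** This sign makes the amplitude at most 1 at the old and at the new position alike, as
    [amplitude_le] requires. *)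
Let expo_le0 tau b : 0 <= tau -> expo tau b <= 0.
Proof.
move=> tau0; rewrite /expo -opprD oppr_le0 addr_ge0// mulr_ge0//; apply: sum_ge0 => k.
  exact: ln_cosh_ge0.
have /andP[h1 _] := riccati_bound (Num.sqrt (l 0 k)) tau0.
by rewrite mulr_ge0// sqr_ge0.
Qed.

Let amp_le1 tau b : 0 <= tau -> expR (expo tau b) <= 1.
Proof. by move=> tau0; rewrite -[leRHS]expR0 ler_expR expo_le0. Qed.

Let bound_drift tau b : 0 <= tau -> tau <= t -> `|drift tau b| <= K * x b ^+ 2.
Proof.
move=> tau0 taut.
have h1 : `|\sum_k l 0 k * tanh_coef tau k| <= \sum_(k < d) (M * t).
  apply: ler_norm_sum_bound => k; have := bound_T k tau0 taut.
  move: (tanh_coef tau k) => T /andP[T0 Tt].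
  by rewrite normrM !ger0_norm// ler_pM.
have h2 : `|\sum_k (1 - l 0 k * tanh_coef tau k ^+ 2) * ycoord b k ^+ 2| <=
    \sum_(k < d) (1 * (M * x b) ^+ 2).
  apply: ler_norm_sum_bound => k; rewrite normrM.
  have := riccati_cosh (Num.sqrt (l 0 k)) tau; rewrite lam2 => ->.
  apply: ler_pM => //.
    rewrite ger0_norm ?sqr_ge0// exprn_ile1// ?invr_ge0 ?(ltW (cosh_gt0 _))//.
    by rewrite invf_le1 ?cosh_gt0// cosh_ge1.
  by rewrite normrX lerXn2r// nnegrE// mulr_ge0.
rewrite !sum_cst in h1 h2.
have h3 : `|drift tau b| <= 4^-1 * (D * (M * t)) + 8^-1 * (D * (1 * (M * x b) ^+ 2)).
  rewrite /drift (le_trans (ler_normB _ _))// normrN !normrM !(ger0_norm (_ : 0 <= _^-1))//.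
  by rewrite lerD// ler_wpM2l.
apply: (le_trans h3).
have xx : 1 <= x b ^+ 2 by rewrite exprn_ege1.
have e1 : D * (M * t) <= D * t * M ^+ 2 * x b ^+ 2.
  rewrite (_ : D * (M * t) = D * t * M * 1); last by ring.
  by rewrite ler_pM ?mulr_ge0// ler_wpM2l ?mulr_ge0// expr2 ler_peMl.
have e2 : D * (1 * (M * x b) ^+ 2) <= D * M ^+ 2 * x b ^+ 2.
  by rewrite le_eqVlt; apply/orP; left; apply/eqP; ring.
have e3 : D * t * M ^+ 2 * x b ^+ 2 + D * M ^+ 2 * x b ^+ 2 <= K * x b ^+ 2.
  rewrite -mulrDl ler_wpM2r ?exprn_ge0//.
  rewrite (_ : D * t * M ^+ 2 + D * M ^+ 2 = D * (1 + t) * M ^+ 2); last by ring.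
  rewrite /K [M ^+ 3]exprSr mulrA; apply: (@le_trans _ _ ((D + 1) * (1 + t) * M ^+ 2)).
    by rewrite ler_wpM2r ?exprn_ge0// ler_wpM2r ?addr_ge0// lerDl.
  by rewrite ler_peMr// !mulr_ge0// ?addr_ge0// exprn_ge0.
have e4 : 0 <= D * (M * t) by rewrite !mulr_ge0.
have e5 : 0 <= D * (1 * (M * x b) ^+ 2) by rewrite !mulr_ge0// exprn_ge0// mulr_ge0.
lra.
Qed.

Let bound_time tau h b : 0 <= tau -> 0 <= h -> tau + h <= t ->
  `|expo (tau + h) b - expo tau b - h * drift tau b| <= K * h ^+ 2 * x b ^+ 2.
Proof.
move=> tau0 h0 tht.
pose dL k := ln_cosh (Num.sqrt (l 0 k)) (tau + h) - ln_cosh (Num.sqrt (l 0 k)) tau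
   - h * (l 0 k * tanh_coef tau k / 2).
pose dT k := (tanh_coef (tau + h) k - tanh_coef tau k
   - h * ((1 - l 0 k * tanh_coef tau k ^+ 2) / 2)) * ycoord b k ^+ 2.
have -> : expo (tau + h) b - expo tau b - h * drift tau b =
    - (2^-1 * \sum_k dL k) - 4^-1 * \sum_k dT k.
  have -> : \sum_k dL k = \sum_k ln_cosh (Num.sqrt (l 0 k)) (tau + h) -
      \sum_k ln_cosh (Num.sqrt (l 0 k)) tau - h / 2 * \sum_k l 0 k * tanh_coef tau k.
    by rewrite mulr_sumr -!sumrB; apply: eq_bigr => k _; rewrite /dL; field.
  have -> : \sum_k dT k = \sum_k tanh_coef (tau + h) k * ycoord b k ^+ 2 -
      \sum_k tanh_coef tau k * ycoord b k ^+ 2 -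
      h / 2 * \sum_k (1 - l 0 k * tanh_coef tau k ^+ 2) * ycoord b k ^+ 2.
    by rewrite mulr_sumr -!sumrB; apply: eq_bigr => k _; rewrite /dT; field.
  by rewrite /expo /drift; field.
have h1 : `|\sum_k dL k| <= \sum_(k < d) (M * h ^+ 2).
  apply: ler_norm_sum_bound => k.
  have := ln_cosh_taylor (Num.sqrt (l 0 k)) tau h0; rewrite lam2 => h1.
  by rewrite (le_trans h1)// ler_wpM2r ?exprn_ge0.
have h2 : `|\sum_k dT k| <= \sum_(k < d) ((t * M * h ^+ 2) * (M * x b) ^+ 2).
  apply: ler_norm_sum_bound => k; rewrite normrM ler_pM//.
    have := riccati_taylor (Num.sqrt (l 0 k)) tau0 h0; rewrite lam2 => h2.
    rewrite (le_trans h2)// ler_wpM2r ?exprn_ge0// ler_pM// addr_ge0//.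
  by rewrite normrX lerXn2r// nnegrE// mulr_ge0.
rewrite !sum_cst in h1 h2.
have h3 : `|- (2^-1 * \sum_k dL k) - 4^-1 * \sum_k dT k| <=
   2^-1 * (D * (M * h ^+ 2)) + 4^-1 * (D * (t * M * h ^+ 2 * (M * x b) ^+ 2)).
  rewrite (le_trans (ler_normB _ _))// normrN !normrM !(ger0_norm (_ : 0 <= _^-1))//.
  by rewrite lerD// ler_wpM2l.
apply: (le_trans h3).
have xx : 1 <= x b ^+ 2 by rewrite exprn_ege1.
have hh : 0 <= h ^+ 2 by rewrite exprn_ge0.
have MM : 1 <= M ^+ 2 by rewrite exprn_ege1.
have e1 : D * (M * h ^+ 2) <= D * M ^+ 3 * h ^+ 2 * x b ^+ 2.
  rewrite (_ : D * (M * h ^+ 2) = D * (M * 1) * h ^+ 2 * 1); last by ring.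
  rewrite ler_pM ?mulr_ge0// ler_wpM2r// ler_wpM2l// exprS.
  by rewrite ler_wpM2l.
have e2 : D * (t * M * h ^+ 2 * (M * x b) ^+ 2) = D * t * M ^+ 3 * h ^+ 2 * x b ^+ 2.
  by ring.
have e3 : D * M ^+ 3 * h ^+ 2 * x b ^+ 2 + D * t * M ^+ 3 * h ^+ 2 * x b ^+ 2 <= K * h ^+ 2 * x b ^+ 2.
  rewrite -!mulrDl ler_wpM2r ?exprn_ge0// ler_wpM2r// ler_wpM2r ?exprn_ge0//.
  rewrite (_ : D + D * t = D * (1 + t)); last by ring.
  by rewrite ler_wpM2r ?addr_ge0// lerDl.
have e4 : 0 <= D * (M * h ^+ 2) by rewrite !mulr_ge0.
have e5 : 0 <= D * t * M ^+ 3 * h ^+ 2 * x b ^+ 2 by rewrite !mulr_ge0// exprn_ge0.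
rewrite e2; lra.
Qed.

Let C := 128 * K ^+ 3 + 3 * K ^+ 2 + ((1 + t) ^+ 2 * K ^+ 2 + K).

Let C1_ge0 : 0 <= 128 * K ^+ 3 + 3 * K ^+ 2.
Proof. by rewrite addr_ge0// mulr_ge0// exprn_ge0. Qed.

Let C2_ge0 : 0 <= (1 + t) ^+ 2 * K ^+ 2 + K.
Proof. by rewrite addr_ge0// mulr_ge0// exprn_ge0// addr_ge0. Qed.

(** The sum subtracted last is the part of mean zero. Centring [xi i * xi j] at [h *+ (i == j)]
    removes [h] times the trace of [coef2], which by the backward equation is the first-order
    variation of the profile in time; only Taylor remainders are left. *)
Lemma one_step : exists2 C : R, 0 <= C & forall tau h J b xi,
  0 <= tau -> 0 <= h -> tau + h <= t ->
  `|profile tau (J + \sum_j (\sum_i Theta i j * b i) * xi j) (fun j => b j + xi j)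
    - profile (tau + h) J b
    - (\sum_j coef1 tau J b j * xi j +
       \sum_i \sum_j coef2 tau J b i j * (xi i * xi j - h *+ (i == j)))|
  <= C * ((1 + size1 b) ^+ 4 * (h ^+ 2 + (size1 xi ^+ 3 + size1 xi ^+ 6))).
Proof.
exists C; first by rewrite addr_ge0.
move=> tau h J b xi tau0 h0 tht.
have taut : tau <= t by rewrite (le_trans _ tht)// lerDl.
have ht : h <= t by rewrite (le_trans _ tht)// lerDr.
have th0 : 0 <= tau + h by rewrite addr_ge0.
set a := expR (expo tau b); set psi := phase J b.
pose q1 := \sum_j grad tau b j * xi j.
pose q2 := \sum_i \sum_j hess tau i j * (xi i * xi j).
pose p := \sum_j zcoord b j / 2 * xi j.
pose q3 := expo (tau + h) b - expo tau b.
have a0 : 0 <= a by exact: expR_ge0.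
have a1 : a <= 1 by exact: amp_le1.
have E1 : profile tau (J + \sum_j (\sum_i Theta i j * b i) * xi j) (fun j => b j + xi j)
    = a * (expR (q1 + q2) * cos (psi + p)).
  by rewrite /profile phase_shift expo_shift expRD mulrA.
have eq3 : a * expR q3 = expR (expo (tau + h) b).
  by rewrite /a -expRD /q3; congr expR; ring.
have E2 : profile (tau + h) J b = cos psi * (a * expR q3).
  by rewrite eq3 mulrC.
have E3 : \sum_j coef1 tau J b j * xi j +
    \sum_i \sum_j coef2 tau J b i j * (xi i * xi j - h *+ (i == j)) =
    a * (cos psi * (q1 + q2 + q1 ^+ 2 / 2 - p ^+ 2 / 2) - sin psi * (p + q1 * p))
    - h * (a * cos psi * drift tau b).
  have e1 : \sum_j coef1 tau J b j * xi j = a * (cos psi * q1 - sin psi * p).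
    rewrite /q1 /p !mulr_sumr -sumrB mulr_sumr; apply: eq_bigr => j _.
    by rewrite /coef1 -/a -/psi; ring.
  have e2 : \sum_i \sum_j coef2 tau J b i j * (xi i * xi j - h *+ (i == j)) =
     \sum_i \sum_j coef2 tau J b i j * (xi i * xi j) - h * \sum_i coef2 tau J b i i.
    rewrite mulr_sumr -sumrB; apply: eq_bigr => i _.
    rewrite [X in _ - X](_ : _ = \sum_j coef2 tau J b i j * (h *+ (i == j))).
      by rewrite -sumrB; apply: eq_bigr => j _; rewrite mulrBr.
    rewrite (bigD1 i)//= eqxx mulr1n big1 ?addr0 1?mulrC// => j ji.
    by rewrite eq_sym (negbTE ji) mulr0n mulr0.
  have e3 : \sum_i \sum_j coef2 tau J b i j * (xi i * xi j) =
      a * (cos psi * (q2 + q1 ^+ 2 / 2 - p ^+ 2 / 2) - sin psi * (q1 * p)).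
    have q11 : q1 ^+ 2 = \sum_i \sum_j grad tau b i * grad tau b j * (xi i * xi j).
      rewrite expr2 /q1 big_distrlr /=; apply: eq_bigr => i _; apply: eq_bigr => j _.
      by ring.
    have pp : p ^+ 2 = \sum_i \sum_j zcoord b i * zcoord b j / 4 * (xi i * xi j).
      rewrite expr2 /p big_distrlr /=; apply: eq_bigr => i _; apply: eq_bigr => j _.
      by field.
    have q1p : q1 * p = \sum_i \sum_j grad tau b i * zcoord b j / 2 * (xi i * xi j).
      rewrite /q1 /p big_distrlr /=; apply: eq_bigr => i _; apply: eq_bigr => j _.
      by field.
    rewrite q11 pp q1p /q2 !mulr_suml -!sumrN -!big_split /= !mulr_sumr -sumrN -big_split /= mulr_sumr.
    apply: eq_bigr => i _.
    rewrite !mulr_suml -!sumrN -!big_split /= !mulr_sumr -sumrN -big_split /= mulr_sumr.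
    by apply: eq_bigr => j _; rewrite /coef2 -/a -/psi; field.
  by rewrite e1 e2 e3 trace_coef2 -/a -/psi; ring.
rewrite E1 E2 E3.
set xx := 1 + size1 b; set rho := size1 xi.
have r0 : 0 <= rho by exact: size1_ge0.
have xx1 : 1 <= xx by exact: x1.
have xx0 : 0 <= xx by exact: x0.
have s1 := @space_step R a q1 q2 p psi xx rho K a0 a1.
have aq : a * expR (q1 + q2) <= 1.
  by rewrite /a -expRD -expo_shift amp_le1.
have bq1 : `|q1| <= K * xx * rho.
  apply: (@lin_bound (fun j => grad tau b j) (fun j => 0)) => j.
  by rewrite (le_trans (bound_grad b j tau0 taut))// ler_wpM2r.
have bq2 : `|q2| <= K * rho ^+ 2.
  rewrite expr2 {1}/rho /size1 big_distrlr /= mulr_sumr; apply: ler_norm_sum_bound => i.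
  rewrite mulr_sumr; apply: ler_norm_sum_bound => j.
  by rewrite !normrM ler_wpM2r ?mulr_ge0// (le_trans (bound_hess i j tau0 taut)).
have bp : `|p| <= K * xx * rho.
  apply: (@lin_bound (fun j => zcoord b j / 2) (fun j => 0)) => j.
  rewrite normrM (ger0_norm (_ : 0 <= 2^-1))// (@le_trans _ _ `|zcoord b j|)//.
    by rewrite ler_piMr// invf_le1// ler1n.
  by rewrite (le_trans (bound_z b j))// ler_wpM2r.
have {}s1 := s1 aq xx1 r0 K0 bq1 bq2 bp.
have aq3 : a * expR q3 <= 1 by rewrite eq3 amp_le1.
have s2 := time_step a0 a1 aq3 h0 ht xx1 K0 (bound_drift b tau0 taut) (bound_time b tau0 h0 tht).
set A := _ - _ in s1; set B' := a * expR q3 - _ in s2.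
have -> : a * (expR (q1 + q2) * cos (psi + p)) - cos psi * (a * expR q3) -
  (a * (cos psi * (q1 + q2 + q1 ^+ 2 / 2 - p ^+ 2 / 2) - sin psi * (p + q1 * p)) -
   h * (a * cos psi * drift tau b)) = A - cos psi * B' by rewrite /A /B'; ring.
rewrite (le_trans (ler_normB _ _))//.
have B1 : `|cos psi * B'| <= `|B'| by rewrite normrM ler_piMl// cos_le_norm1.
have X0 : 0 <= xx ^+ 4 by rewrite exprn_ge0.
have rr : 0 <= rho ^+ 3 + rho ^+ 6 by rewrite addr_ge0// exprn_ge0.
have hh : 0 <= h ^+ 2 by rewrite exprn_ge0.
apply: (le_trans (lerD s1 (le_trans B1 s2))).
rewrite /C [leRHS]mulrDl lerD// ler_wpM2l// ler_wpM2l//.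
  by rewrite lerDr.
by rewrite lerDl.
Qed.

Lemma coef_bounds : exists2 C : R, 0 <= C & forall tau J b i j, 0 <= tau -> tau <= t ->
  `|coef1 tau J b j| <= C * (1 + size1 b) ^+ 2 /\
  `|coef2 tau J b i j| <= C * (1 + size1 b) ^+ 2.
Proof.
exists (2 * K + 4 * K ^+ 2); first by rewrite addr_ge0// mulr_ge0// exprn_ge0.
move=> tau J b i j tau0 taut.
have a1 := amp_le1 b tau0.
have bv k : `|grad tau b k| <= K * x b.
  by rewrite (le_trans (bound_grad b k tau0 taut))// ler_wpM2r.
have bz k : `|zcoord b k| <= K * x b.
  by rewrite (le_trans (bound_z b k))// ler_wpM2r.
have bh : `|hess tau i j| <= K by rewrite (le_trans (bound_hess i j tau0 taut)).
have c1 := cos_le_norm1 (phase J b); have s1 := sin_le_norm1 (phase J b).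
have x12 : x b <= x b ^+ 2 by rewrite expr2 ler_peMl.
have x02 : 1 <= x b ^+ 2 by rewrite exprn_ege1.
have Kx1 : K * x b <= K * x b ^+ 2 by rewrite ler_wpM2l.
have Kx2 : K <= K * x b ^+ 2 by rewrite ler_peMr.
have K2x : 0 <= K ^+ 2 * x b ^+ 2 by rewrite mulr_ge0// exprn_ge0.
have small (u v A B : R) : `|u| <= 1 -> `|v| <= 1 -> `|u * A - v * B| <= `|A| + `|B|.
  move=> u1 v1; rewrite (le_trans (ler_normB _ _))// !normrM lerD// ler_piMl//.
have amp (u : R) : `|expR (expo tau b) * u| <= `|u|.
  by rewrite normrM ger0_norm// ler_piMl.
have half (u c : R) : 1 <= c -> `|u / c| <= `|u|.
  move=> c1'; have c0 : 0 < c by rewrite (lt_le_trans ltr01).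
  by rewrite normrM ler_piMr// ger0_norm ?invr_ge0 ?invf_le1// ltW.
have prod (u v : R) : `|u| <= K * x b -> `|v| <= K * x b -> `|u * v| <= K ^+ 2 * x b ^+ 2.
  by move=> u1 v1; rewrite normrM (le_trans (ler_pM _ _ u1 v1))// -expr2 exprMn.
rewrite -/(x b); split.
- rewrite (le_trans (amp _))// (le_trans (small _ _ _ _ c1 s1))//.
  have h2 : `|zcoord b j / 2| <= `|zcoord b j| by apply: half; rewrite ler1n.
  move: h2 (bv j) (bz j) Kx1 K2x; lra.
- rewrite (le_trans (amp _))// (le_trans (small _ _ _ _ c1 s1))//.
  have h1 : `|grad tau b i * grad tau b j / 2| <= `|grad tau b i * grad tau b j|.
    by apply: half; rewrite ler1n.
  have h2 : `|zcoord b i * zcoord b j / 8| <= `|zcoord b i * zcoord b j|.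
    by apply: half; rewrite ler1n.
  have h3 : `|grad tau b i * zcoord b j / 2| <= `|grad tau b i * zcoord b j|.
    by apply: half; rewrite ler1n.
  have p1 := prod _ _ (bv i) (bv j); have p2 := prod _ _ (bz i) (bz j).
  have p3 := prod _ _ (bv i) (bz j).
  have n1 := ler_normB (hess tau i j + grad tau b i * grad tau b j / 2) (zcoord b i * zcoord b j / 8).
  have n2 := ler_normD (hess tau i j) (grad tau b i * grad tau b j / 2).
  move: h1 h2 h3 p1 p2 p3 n1 n2 bh Kx2 K2x K0; lra.
Qed.

Lemma profile_le1 tau J b : 0 <= tau -> `|profile tau J b| <= 1.
Proof.
move=> tau0; rewrite normrM ger0_norm ?expR_ge0// -[leRHS]mulr1 ler_pM ?expR_ge0//.
  exact: amp_le1.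
exact: cos_le_norm1.
Qed.

Lemma profile0 J b : profile 0 J b = cos (phase J b).
Proof.
rewrite /profile /expo big1 => [|k _]; last exact: ln_cosh0.
rewrite big1 => [|k _]; last by rewrite /tanh_coef riccati0 mul0r.
by rewrite !mulr0 !oppr0 addr0 expR0 mul1r.
Qed.

End OneStep.

(* The variables [xi j / sqrt h] have moments bounded independently of [h], so
   that the error term of [one_step] is of order [h^(3/2)]; the degree 12 is more
   than that of each of its monomials. *)
Lemma moment_envelope (R : realType) (d : nat) (b xi : 'I_d -> R) (h t : R) :
  0 < h -> h <= t ->
  (1 + size1 b) ^+ 4 * (h ^+ 2 + (size1 xi ^+ 3 + size1 xi ^+ 6)) <=
  (Num.sqrt t + 1 + t * Num.sqrt t) * (h * Num.sqrt h) *
  (2 ^+ 12 * (1 + d%:R ^+ 12 * \sum_j b j ^+ 12) +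
   d%:R ^+ 12 * \sum_j (xi j / Num.sqrt h) ^+ 12).
Proof.
move=> h0 ht; have t0 : 0 <= t by rewrite (le_trans _ ht)// ltW.
set r := Num.sqrt h; set q := Num.sqrt t.
have r0 : 0 < r by rewrite sqrtr_gt0.
have hr : h = r ^+ 2 by rewrite sqr_sqrtr// ltW.
have rq : r <= q by rewrite ler_wsqrtr.
have tq : t = q ^+ 2 by rewrite sqr_sqrtr.
have q0 : 0 <= q by exact: sqrtr_ge0.
set x := 1 + size1 b; pose y := size1 xi / r.
have S0 (u : 'I_d -> R) : 0 <= size1 u by exact: sumr_ge0.
have x1 : 1 <= x by rewrite lerDl.
have y0 : 0 <= y by rewrite divr_ge0// ltW.
have even12 (u : R) : `|u| ^+ 12 = u ^+ 12.
  by rewrite -normrX ger0_norm// exprn_even_ge0.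
have bx : x ^+ 12 <= 2 ^+ 12 * (1 + d%:R ^+ 12 * \sum_j b j ^+ 12).
  have h1 : size1 b ^+ 12 <= d%:R ^+ 12 * \sum_j b j ^+ 12.
    have := @exprD_sum_le R 'I_d (fun j => `|b j|) 11 (fun j => normr_ge0 _).
    by rewrite card_ord; under [X in _ <= _ * X]eq_bigr do rewrite even12.
  apply: (@le_trans _ _ (2 ^+ 12 * (1 + size1 b ^+ 12))); last first.
    by rewrite ler_pM2l// lerD2l.
  have [s1|s1] := leP (size1 b) 1.
    apply: (@le_trans _ _ (2 ^+ 12)).
      by rewrite lerXn2r ?nnegrE// ?addr_ge0// /x; move: s1; lra.
    by rewrite ler_peMr// lerDl exprn_ge0.
  apply: (@le_trans _ _ ((2 * size1 b) ^+ 12)).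
    by rewrite lerXn2r ?nnegrE ?mulr_ge0// ?addr_ge0// /x; move: s1; lra.
  by rewrite exprMn ler_pM2l// lerDr.
have by_ : y ^+ 12 <= d%:R ^+ 12 * \sum_j (xi j / r) ^+ 12.
  have := @exprD_sum_le R 'I_d (fun j => `|xi j / r|) 11 (fun j => normr_ge0 _).
  rewrite card_ord; under [X in _ <= _ * X]eq_bigr do rewrite even12.
  suff -> : \sum_i `|xi i / r| = y by [].
  rewrite /y /size1 mulr_suml; apply: eq_bigr => j _.
  by rewrite normrM (gtr0_norm (_ : 0 < r^-1))// invr_gt0.
have rho : size1 xi = r * y by rewrite /y mulrC divfK// gt_eqF.
(* The larger of [x] and [y] is at least 1 because [x] is, so its powers increase with the
   exponent. *)
have monom (i j : nat) : (i + j <= 12)%N -> x ^+ i * y ^+ j <= x ^+ 12 + y ^+ 12.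
  move=> ij; have x0 := le_trans ler01 x1.
  have [xy|/ltW yx] := leP x y.
    have y1 := le_trans x1 xy.
    apply: (@le_trans _ _ (y ^+ i * y ^+ j)).
      by rewrite ler_wpM2r ?exprn_ge0// lerXn2r.
    rewrite -exprD (le_trans (ler_weXn2l y1 ij))// lerDr exprn_ge0//.
  apply: (@le_trans _ _ (x ^+ i * x ^+ j)).
    by rewrite ler_wpM2l ?exprn_ge0// lerXn2r.
  by rewrite -exprD (le_trans (ler_weXn2l x1 ij))// lerDl exprn_ge0.
have m4 := monom 4%N 0%N isT; have m43 := monom 4%N 3%N isT.
have m46 := monom 4%N 6%N isT; rewrite expr0 mulr1 in m4.
set E := x ^+ 12 + y ^+ 12 in m4 m43 m46.
apply: (@le_trans _ _ ((q + 1 + t * q) * (h * r) * E)); last first.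
  apply: ler_wpM2l; last exact: lerD.
  apply: mulr_ge0; last by rewrite mulr_ge0// ltW.
  by rewrite addr_ge0 ?mulr_ge0// addr_ge0.
rewrite rho.
(* [r ^+ 3] is [h * sqrt h]; the factors left over, [r], 1 and [r ^+ 3], are bounded by the three
   terms of [sqrt t + 1 + t * sqrt t]. *)
have -> : x ^+ 4 * (h ^+ 2 + ((r * y) ^+ 3 + (r * y) ^+ 6)) =
  r ^+ 3 * (r * x ^+ 4 + (x ^+ 4 * y ^+ 3 + r ^+ 3 * (x ^+ 4 * y ^+ 6))).
  by rewrite hr; ring.
have -> : (q + 1 + t * q) * (h * r) * E = r ^+ 3 * (q * E + (E + q ^+ 3 * E)).
  by rewrite hr tq; ring.
rewrite ler_wpM2l ?exprn_ge0 ?(ltW r0)//.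
rewrite lerD// ?ler_pM ?(ltW r0) ?exprn_ge0// ?(le_trans _ x1)//.
rewrite lerD// ler_pM ?exprn_ge0 ?(ltW r0)//.
  by rewrite mulr_ge0 ?exprn_ge0// (le_trans _ x1).
by rewrite lerXn2r// nnegrE ltW.
Qed.

(** * One time step in expectation *)

Section DiscreteMartingale.
Context {disp : measure_display} {T : measurableType disp} {R : realType}.
Variable P : probability T R.
Variables (d : nat) (B : 'I_d -> R -> {RV P >-> R}).
Hypothesis hB : brownian_motion B.
Variables (Theta Q : 'M[R]_d) (l : 'rV[R]_d).
Variables (gamma : 'cV[R]_d) (alpha t : R).
Hypothesis skewTheta : Theta^T = - Theta.
Hypothesis QQ : Q *m Q^T = 1%:M.
Hypothesis spec : Theta^T *m Theta = Q^T *m diag_mx l *m Q.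
Hypothesis t0 : 0 < t.

Local Notation pos s w := (fun j => B j s w).
Local Notation profile := (profile Theta Q l gamma alpha).
Local Notation coef1 := (coef1 Theta Q l gamma alpha).
Local Notation coef2 := (coef2 Theta Q l gamma alpha).

Section Adapted.
Variables (s : R) (J : T -> R).
Hypothesis s0 : 0 <= s.
Hypothesis aJ : adapted B s J.

Let aB j : adapted B s (B j s). Proof. exact: adapted_B. Qed.

Let aZ c Y : adapted B s Y -> adapted B s (fun w => c * Y w).
Proof. by move=> aY; apply: adaptedM => //; exact: adapted_cst. Qed.

Let aN Y : adapted B s Y -> adapted B s (fun w => - Y w).
Proof.
by move=> aY; have := aZ (-1) aY; under eq_fun do rewrite mulN1r.
Qed.

Let aDc c Y : adapted B s Y -> adapted B s (fun w => Y w + c).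
Proof. by move=> aY; apply: adaptedD => //; exact: adapted_cst. Qed.

Let aY_ k : adapted B s (fun w => ycoord Theta Q gamma (pos s w) k).
Proof. by apply: aDc; apply: adapted_sum => j; apply: aZ. Qed.

Let az j : adapted B s (fun w => zcoord Theta gamma (pos s w) j).
Proof. by apply: aDc; apply: adapted_sum => i; apply: aZ. Qed.

Let aexpo tau : adapted B s (fun w => expR (expo Theta Q l gamma tau (pos s w))).
Proof.
apply: (adapted_comp (g := expR)); first exact: measurable_expR.
apply: adaptedB; first exact: adapted_cst.
by apply: aZ; apply: adapted_sum => k; apply: aZ; apply: adaptedM.
Qed.

Let aphase : adapted B s (fun w => phase gamma alpha (J w) (pos s w)).
Proof.
apply: aDc; apply: adaptedD; last by apply: adapted_sum => j; apply: aZ.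
by apply: adaptedM => //; exact: adapted_cst.
Qed.

Let acos : adapted B s (fun w => cos (phase gamma alpha (J w) (pos s w))).
Proof.
apply: (adapted_comp (g := @cos R)) => //.
by apply: continuous_measurable_fun; exact: continuous_cos.
Qed.

Let asin : adapted B s (fun w => sin (phase gamma alpha (J w) (pos s w))).
Proof.
apply: (adapted_comp (g := @sin R)) => //.
by apply: continuous_measurable_fun; exact: continuous_sin.
Qed.

Let agrad tau j : adapted B s (fun w => grad Theta Q l gamma tau (pos s w) j).
Proof.
apply: aN; apply: aZ; apply: adapted_sum => k.
by apply: adaptedM; [apply: adaptedM => //|]; exact: adapted_cst.
Qed.

Lemma adapted_profile tau : adapted B s (fun w => profile tau (J w) (pos s w)).
Proof. exact: adaptedM. Qed.

Lemma adapted_coef1 tau j : adapted B s (fun w => coef1 tau (J w) (pos s w) j).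
Proof.
apply: adaptedM => //; apply: adaptedB; apply: adaptedM => //.
by apply: adaptedM => //; exact: adapted_cst.
Qed.

Lemma adapted_coef2 tau i j : adapted B s (fun w => coef2 tau (J w) (pos s w) i j).
Proof.
have aq c Y : adapted B s Y -> adapted B s (fun w => Y w / c).
  by move=> aY; apply: adaptedM => //; exact: adapted_cst.
apply: adaptedM => //; apply: adaptedB; apply: adaptedM => //.
  apply: adaptedB; last by apply: aq; exact: adaptedM.
  by apply: adaptedD; [exact: adapted_cst|apply: aq; exact: adaptedM].
by apply: aq; exact: adaptedM.
Qed.

Lemma L1_profile tau : 0 <= tau -> L1 P (fun w => profile tau (J w) (pos s w)).
Proof.
move=> tau0; apply: (@L1_bounded _ _ _ P _ 1).
  exact: adapted_measurable (adapted_profile tau).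
by move=> w; apply: profile_le1.
Qed.

Let L1_size : L1 P (fun w => (1 + size1 (pos s w)) ^+ 2).
Proof.
have Lb : L2 P (fun w => 1 + size1 (pos s w)).
  apply: L2D; first exact: (L2_cst P 1).
  apply: L2_sum => j; have [mb Lb] := bm_L2 hB j s0; split.
    exact: measurableT_comp.
  by under eq_fun do rewrite real_normK ?num_real//.
exact: (proj2 Lb).
Qed.

Lemma L1_coef tau i j : 0 <= tau -> tau <= t ->
  L1 P (fun w => coef1 tau (J w) (pos s w) j) /\
  L1 P (fun w => coef2 tau (J w) (pos s w) i j).
Proof.
move=> tau0 taut.
have [C C0 hC] := coef_bounds gamma alpha QQ spec (ltW t0).
split.
- apply: L1_le (L1Z C L1_size) _; first exact: adapted_measurable (adapted_coef1 tau j).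
  by move=> w; have [] := hC tau (J w) (pos s w) i j tau0 taut.
- apply: L1_le (L1Z C L1_size) _; first exact: adapted_measurable (adapted_coef2 tau i j).
  by move=> w; have [] := hC tau (J w) (pos s w) i j tau0 taut.
Qed.

End Adapted.

(** The coefficients depend on the past only, and given the past the increment has mean zero and
    covariance [v - s] times the identity. *)
Lemma linear_part_mean s v J tau : 0 <= s -> s <= v -> adapted B s J ->
  0 <= tau -> tau <= t ->
  let F := fun w =>
    \sum_j coef1 tau (J w) (pos s w) j * increment (fun r => B j r) s v w +
    \sum_i \sum_j coef2 tau (J w) (pos s w) i j *
      (increment (fun r => B i r) s v w * increment (fun r => B j r) s v w
       - (v - s) *+ (i == j)) in
  L1 P F /\ Ex P F = 0.
Proof.
move=> s0 sv aJ tau0 taut F.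
have X1 j : L1 P (fun w => coef1 tau (J w) (pos s w) j * increment (fun r => B j r) s v w) /\
  Ex P (fun w => coef1 tau (J w) (pos s w) j * increment (fun r => B j r) s v w) = 0.
  apply: increment_mean => //; first exact: adapted_coef1.
  by have [] := L1_coef s0 aJ j j tau0 taut.
have X2 i j : L1 P (fun w => coef2 tau (J w) (pos s w) i j *
      (increment (fun r => B i r) s v w * increment (fun r => B j r) s v w
       - (v - s) *+ (i == j))) /\
   Ex P (fun w => coef2 tau (J w) (pos s w) i j *
      (increment (fun r => B i r) s v w * increment (fun r => B j r) s v w
       - (v - s) *+ (i == j))) = 0.
  have [_ Lc] := L1_coef s0 aJ i j tau0 taut.
  have ac := adapted_coef2 s0 aJ tau i j.
  have [<-|ij] := eqVneq i j.
    have [_ Lci] := L1_coef s0 aJ i i tau0 taut.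
    have aci := adapted_coef2 s0 aJ tau i i.
    have [LY EY] := increment_var hB i s0 sv aci Lci.
    rewrite mulr1n; under eq_fun do rewrite mulrBr -expr2 (mulrC _ (v - s)).
    split; first by apply: L1B => //; exact: L1Z.
    by rewrite ExB ?EY ?ExZ ?subrr//; exact: L1Z.
  rewrite mulr0n; under eq_fun do rewrite subr0.
  exact: increment_cov.
have LX2 i : L1 P (fun w => \sum_j coef2 tau (J w) (pos s w) i j *
      (increment (fun r => B i r) s v w * increment (fun r => B j r) s v w
       - (v - s) *+ (i == j))).
  by apply: L1_sum => j _; exact: (proj1 (X2 i j)).
have LS1 := @L1_sum _ _ _ P _ (index_enum 'I_d) xpredT _ (fun j _ => proj1 (X1 j)).
have LS2 := @L1_sum _ _ _ P _ (index_enum 'I_d) xpredT _ (fun i _ => LX2 i).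
split; first exact: L1D.
rewrite /F ExD// Ex_sum ?big1 ?add0r; last 2 first.
- by move=> j _; exact: (proj2 (X1 j)).
- by move=> j _; exact: (proj1 (X1 j)).
rewrite Ex_sum// big1// => i _; rewrite Ex_sum; last by move=> j _; exact: (proj1 (X2 i j)).
by rewrite big1// => j _; exact: (proj2 (X2 i j)).
Qed.

Lemma profile_step_mean : exists2 C : R, 0 <= C & forall s h J,
  0 <= s -> 0 < h -> s + h <= t -> adapted B s J ->
  `|Ex P (fun w => profile (t - (s + h))
        (J w + \sum_j (\sum_i Theta i j * B i s w) *
           increment (fun r => B j r) s (s + h) w) (pos (s + h) w))
    - Ex P (fun w => profile (t - s) (J w) (pos s w))| <= C * (h * Num.sqrt h).
Proof.
have [C C0 hC] := one_step gamma alpha skewTheta QQ spec (ltW t0).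
(* [K12] is the constant of the twelfth moment, [K3] the factor in [t] of [moment_envelope], and
   [K4] bounds the expectation of its last factor, uniformly in [s] and [h]. *)
pose K12 : R := 24 ^+ 6 * Num.sqrt 2.
pose K3 : R := Num.sqrt t + 1 + t * Num.sqrt t.
pose K4 : R := 2 ^+ 12 * (1 + d%:R ^+ 12 * (d%:R * (K12 * t ^+ 6))) + d%:R ^+ 12 * (d%:R * K12).
have K30 : 0 <= K3 by rewrite !addr_ge0 ?mulr_ge0// ltW.
have K40 : 0 <= K4.
  by rewrite addr_ge0 ?mulr_ge0 ?addr_ge0 ?mulr_ge0 ?exprn_ge0// ltW.
exists (C * (K3 * K4)); first by rewrite !mulr_ge0.
move=> s h J s0 h0 sht aJ.
have st : s <= s + h by rewrite lerDl ltW.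
have ht : h <= t by rewrite (le_trans _ sht)// lerDr.
have sh0 : 0 <= s + h by rewrite addr_ge0// ltW.
have tau0 : 0 <= t - (s + h) by rewrite subr_ge0.
have taut : t - (s + h) <= t by rewrite gerBl.
pose dJ w := \sum_j (\sum_i Theta i j * B i s w) * increment (fun r => B j r) s (s + h) w.
have adJ : adapted B (s + h) (fun w => J w + dJ w).
  apply: adaptedD; first exact: adapted_le aJ.
  apply: adapted_sum => j; apply: adaptedM.
    apply: adapted_sum => i; apply: adaptedM; first exact: adapted_cst.
    exact: adapted_B.
  exact: adapted_increment.
have L1' := L1_profile sh0 adJ tau0.
have L0 : L1 P (fun w => profile (t - s) (J w) (pos s w)).
  by apply: L1_profile => //; rewrite subr_ge0 (le_trans st).
have [LF EF] := linear_part_mean s0 st aJ tau0 taut.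
set F := (X in L1 P X) in LF; rewrite -/F in EF.
pose env w := (K3 * (h * Num.sqrt h)) *
  (2 ^+ 12 * (1 + d%:R ^+ 12 * \sum_j B j s w ^+ 12) +
   d%:R ^+ 12 * \sum_j (increment (fun r => B j r) s (s + h) w / Num.sqrt h) ^+ 12).
have Lb : L1 P (fun w => \sum_j B j s w ^+ 12).
  by apply: L1_sum => j _; exact: bm_L1X.
pose c : R := (Num.sqrt h)^-1 ^+ 12.
have xiE j w : (increment (fun r => B j r) s (s + h) w / Num.sqrt h) ^+ 12 =
    c * increment (fun r => B j r) s (s + h) w ^+ 12 by rewrite exprMn mulrC.
have Lxij j : L1 P (fun w => (increment (fun r => B j r) s (s + h) w / Num.sqrt h) ^+ 12).
  by under eq_fun do rewrite xiE; apply: L1Z; exact: increment_L1X.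
have Lxi : L1 P (fun w => \sum_j (increment (fun r => B j r) s (s + h) w / Num.sqrt h) ^+ 12).
  by apply: L1_sum => j _.
have Lb1 : L1 P (fun w => 1 + d%:R ^+ 12 * \sum_j B j s w ^+ 12).
  by apply: L1D; [exact: (L1_cst P 1)|exact: L1Z].
have Lenv0 : L1 P (fun w => 2 ^+ 12 * (1 + d%:R ^+ 12 * \sum_j B j s w ^+ 12) +
   d%:R ^+ 12 * \sum_j (increment (fun r => B j r) s (s + h) w / Num.sqrt h) ^+ 12).
  by apply: L1D; exact: L1Z.
have Lenv : L1 P env by exact: L1Z.
have Eb : Ex P (fun w => \sum_j B j s w ^+ 12) <= d%:R * (K12 * t ^+ 6).
  rewrite Ex_sum; last by move=> j _; exact: bm_L1X.
  apply: (@le_trans _ _ (\sum_(j < d) (K12 * t ^+ 6))).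
    apply: ler_sum => j _; rewrite (le_trans (bm_moment12 hB j s0))// ler_wpM2l//.
    by rewrite lerXn2r// ?nnegrE ?(ltW t0)// (le_trans st).
  by rewrite sumr_const card_ord mulr_natl.
have Exi : Ex P (fun w => \sum_j (increment (fun r => B j r) s (s + h) w / Num.sqrt h) ^+ 12)
    <= d%:R * K12.
  rewrite Ex_sum//.
  apply: (@le_trans _ _ (\sum_(j < d) K12)); last by rewrite sumr_const card_ord mulr_natl.
  apply: ler_sum => j _; under eq_Ex do rewrite xiE.
  rewrite ExZ; last exact: increment_L1X.
  have := increment_moment12 hB j s0 st.
  rewrite (_ : s + h - s = h); last by ring.
  move=> hm; have c0 : 0 <= c by rewrite exprn_ge0// invr_ge0.
  rewrite (le_trans (ler_wpM2l c0 hm))// -/K12.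
  rewrite le_eqVlt; apply/orP; left; apply/eqP.
  have e6 : h ^+ 6 = Num.sqrt h ^+ 12.
    by rewrite -[in LHS](sqr_sqrtr (ltW h0)) -exprM.
  by rewrite e6 mulrCA -exprMn mulVf ?expr1n ?mulr1// gt_eqF// sqrtr_gt0.
have Eenv : Ex P env <= (K3 * (h * Num.sqrt h)) * K4.
  rewrite /env ExZ// ler_wpM2l ?mulr_ge0 ?(ltW h0)//.
  rewrite ExD; [|exact: L1Z|exact: L1Z].
  rewrite ExZ// ExD; [|exact: (L1_cst P 1)|exact: L1Z].
  rewrite (@Ex_cst _ _ _ P 1) !ExZ// /K4 lerD// ler_wpM2l ?exprn_ge0//.
  by rewrite lerD2l ler_wpM2l// exprn_ge0.
rewrite -ExB//.
(* [F] has mean zero and may be subtracted; what is left is bounded pointwise by [one_step]. *)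
have -> : Ex P (fun w => profile (t - (s + h)) (J w + dJ w) (pos (s + h) w) -
    profile (t - s) (J w) (pos s w)) =
  Ex P (fun w => profile (t - (s + h)) (J w + dJ w) (pos (s + h) w) -
    profile (t - s) (J w) (pos s w) - F w).
  by rewrite [RHS]ExB ?EF ?subr0//; exact: L1B.
apply: (@le_trans _ _ (Ex P (fun w => C * env w))).
  apply: le_norm_Ex; [by apply: L1B => //; exact: L1B|exact: L1Z|].
  move=> w.
  have posE : pos (s + h) w = fun j => B j s w + increment (fun r => B j r) s (s + h) w.
    by apply/funext => j; rewrite /increment; ring.
  have := hC (t - (s + h)) h (J w) (pos s w)
    (fun j => increment (fun r => B j r) s (s + h) w) tau0 (ltW h0).
  rewrite (_ : t - (s + h) + h = t - s); last by ring.
  rewrite gerBl s0 => /(_ isT); rewrite -posE -/(dJ w) => step.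
  have FE : F w = \sum_j coef1 (t - (s + h)) (J w) (pos s w) j *
       increment (fun r => B j r) s (s + h) w +
    \sum_i \sum_j coef2 (t - (s + h)) (J w) (pos s w) i j *
      (increment (fun r => B i r) s (s + h) w * increment (fun r => B j r) s (s + h) w
       - h *+ (i == j)).
    by rewrite /F (_ : s + h - s = h); last by ring.
  rewrite FE (le_trans step)// ler_wpM2l//.
  exact: (@moment_envelope R d (pos s w) (fun j => increment (fun r => B j r) s (s + h) w) h t h0 ht).
rewrite ExZ// -mulrA ler_wpM2l// (le_trans Eenv)// le_eqVlt; apply/orP; left; apply/eqP.
by ring.
Qed.

End DiscreteMartingale.

(** * Passage to the limit *)

Section RiemannLimit.
Context {disp : measure_display} {T : measurableType disp} {R : realType}.
Variable P : probability T R.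
Variables (d : nat) (B : 'I_d -> R -> {RV P >-> R}).
Hypothesis hB : brownian_motion B.
Variables (Theta Q : 'M[R]_d) (l : 'rV[R]_d).
Variables (gamma : 'cV[R]_d) (alpha t : R).
Hypothesis skewTheta : Theta^T = - Theta.
Hypothesis QQ : Q *m Q^T = 1%:M.
Hypothesis spec : Theta^T *m Theta = Q^T *m diag_mx l *m Q.
Hypothesis t0 : 0 < t.

(** Telescoping over the grid: [N] steps of size [C * h * sqrt h] with [N * h = t]. *)
Lemma riemann_mean : exists2 C : R, 0 <= C & forall N, (0 < N)%N ->
  `|Ex P (fun w => cos (phase gamma alpha
        (\sum_i \sum_j Theta i j * riemann_sum B t N i j w) (fun j => B j t w)))
    - profile Theta Q l gamma alpha t 0 (fun=> 0)| <= C * Num.sqrt (t / N%:R).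
Proof.
have [C C0 hC] := profile_step_mean hB gamma alpha skewTheta QQ spec t0.
exists (C * t); first by rewrite mulr_ge0// ltW.
move=> N N0; pose h := t / N%:R; pose s (i : nat) : R := i%:R * h.
have NR0 : 0 < N%:R :> R by rewrite ltr0n.
have h0 : 0 < h by rewrite divr_gt0.
have s0 i : 0 <= s i by rewrite mulr_ge0// ltW.
have sS i : s i.+1 = s i + h by rewrite /s -natr1 mulrDl mul1r.
have sN : s N = t by rewrite /s /h mulrCA divff ?mulr1// gt_eqF.
pose dJ i w := \sum_j (\sum_k Theta k j * B k (s i) w) *
   increment (fun r => B j r) (s i) (s i.+1) w.
pose J i w := \sum_(m < i) dJ m w.
have aJ i : adapted B (s i) (J i).
  apply: adapted_sum => m.
  have mi : s m.+1 <= s i by rewrite ler_pM2r// ler_nat ltn_ord.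
  have mm : s m <= s m.+1 by rewrite sS lerDl ltW.
  apply: adapted_sum => j; apply: adaptedM; last first.
    by apply: adapted_increment => //; exact: le_trans mi.
  apply: adapted_sum => k; apply: adaptedM; first exact: adapted_cst.
  by apply: adapted_B => //; exact: le_trans mi.
pose M i := Ex P (fun w => profile Theta Q l gamma alpha (t - s i) (J i w) (fun j => B j (s i) w)).
have step i : (i < N)%N -> `|M i.+1 - M i| <= C * (h * Num.sqrt h).
  move=> iN; have st : s i + h <= t by rewrite -sS -sN ler_pM2r// ler_nat.
  have := hC (s i) h (J i) (s0 i) h0 st (aJ i).
  rewrite -sS; congr (`|_ - _| <= _); apply: eq_Ex => w.
  by rewrite /J big_ord_recr.
have M0 : M 0%N = profile Theta Q l gamma alpha t 0 (fun=> 0).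
  have s00 : s 0%N = 0 by rewrite /s mul0r.
  have aJ0 : adapted B 0 (J 0%N) by rewrite -s00.
  (* The initial profile is the stated constant only almost surely, as [B j 0] is. *)
  rewrite /M s00 subr0 -[RHS](Ex_cst P); apply: ae_eq_Ex.
  - exact: (L1_measurable (L1_profile Theta Q l gamma alpha (lexx 0) aJ0 (ltW t0))).
  - exact: measurable_cst.
  - apply: filterS (bm_start hB) => w B0.
    rewrite /J big_ord0; congr (profile _ _ _ _ _ _ _ _).
    by apply/funext => j; rewrite B0.
have MN : M N = Ex P (fun w => cos (phase gamma alpha
        (\sum_i \sum_j Theta i j * riemann_sum B t N i j w) (fun j => B j t w))).
  apply: eq_Ex => w; rewrite sN subrr profile0; congr (cos (phase _ _ _ _)).
  rewrite /J /dJ /riemann_sum.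
  under [RHS]eq_bigr do under eq_bigr do rewrite mulr_sumr.
  under [RHS]eq_bigr do rewrite exchange_big /=.
  rewrite [RHS]exchange_big /=; apply: eq_bigr => m _.
  rewrite [RHS]exchange_big /=; apply: eq_bigr => j _.
  by rewrite mulr_suml; apply: eq_bigr => k _; rewrite mulrA.
move: M step M0 MN => M step M0 MN.
have tel i : (i <= N)%N -> `|M i - M 0%N| <= i%:R * (C * (h * Num.sqrt h)).
  elim: i => [_|i IH iN]; first by rewrite subrr normr0 mul0r.
  rewrite -natr1 mulrDl mul1r [leRHS]addrC.
  have -> : M i.+1 - M 0%N = (M i.+1 - M i) + (M i - M 0%N) by ring.
  apply: (le_trans (ler_normD _ _)); apply: lerD; first exact: step.
  exact: IH (ltnW iN).
have := tel N (leqnn N); rewrite MN M0 => /le_trans; apply.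
rewrite -/h (_ : N%:R * _ = C * (N%:R * h) * Num.sqrt h); last by ring.
by rewrite (_ : N%:R * h = t).
Qed.

Variable I : 'I_d -> 'I_d -> T -> R.
Hypothesis hI : forall j k : 'I_d,
  is_ito_integral P (natural_filtration (fun l s => B l s)) t
    (fun s => B k s) (fun s => B j s) (I j k).

(** Integrates [|X| <= X^2 / (2 e) + e / 2], which plays the part of the Cauchy-Schwarz
    inequality. *)
Lemma Ex_norm_le (X : T -> R) (e : R) : L2 P X -> 0 < e ->
  Ex P (fun w => X w ^+ 2) <= e ^+ 2 -> L1 P X /\ Ex P (fun w => `|X w|) <= e.
Proof.
move=> LX e0 Xe; have L1X := L2_L1 LX; split=> //.
have LY : L1 P (fun w => (2 * e)^-1 * X w ^+ 2 + e / 2).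
  by apply: L1D; [apply: L1Z; exact: (proj2 LX)|exact: (L1_cst P (e / 2))].
apply: (@le_trans _ _ (Ex P (fun w => (2 * e)^-1 * X w ^+ 2 + e / 2))).
  apply: le_Ex => //; first exact: L1_abs.
  move=> w; rewrite -(real_normK (num_real (X w))) -subr_ge0.
  have -> : (2 * e)^-1 * `|X w| ^+ 2 + e / 2 - `|X w| = (2 * e)^-1 * (`|X w| - e) ^+ 2.
    by field; rewrite gt_eqF.
  by rewrite mulr_ge0 ?sqr_ge0// invr_ge0 mulr_ge0// ltW.
rewrite ExD; [|by apply: L1Z; exact: (proj2 LX)|exact: (L1_cst P (e / 2))].
rewrite (@Ex_cst _ _ _ P (e / 2)) ExZ; last exact: (proj2 LX).
have e20 : 0 <= (2 * e)^-1 by rewrite invr_ge0 mulr_ge0// ltW.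
apply: (@le_trans _ _ ((2 * e)^-1 * e ^+ 2 + e / 2)).
  by rewrite lerD2r ler_wpM2l.
by rewrite le_eqVlt; apply/orP; left; apply/eqP; field; rewrite gt_eqF.
Qed.

Lemma cos_lipschitz (x y : R) : `|cos x - cos y| <= `|x - y|.
Proof.
wlog xy : x y / x <= y.
  by move=> h; have [/h//|/ltW/h] := leP x y; rewrite distrC (distrC y).
have [c _ e] := MVT_le xy (@is_derive_cos R).
by rewrite distrC e normrM normrN (distrC x) ler_piMl// sin_le_norm1.
Qed.

Theorem levy_area_cos : Ex P (fun w => cos (phase gamma alpha
    (\sum_i \sum_j Theta i j * I i j w) (fun j => B j t w)))
  = profile Theta Q l gamma alpha t 0 (fun=> 0).
Proof.
have [C C0 hC] := riemann_mean.
pose S := \sum_i \sum_j `|Theta i j|.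
have S0 : 0 <= S by apply: sumr_ge0 => i _; exact: sumr_ge0.
pose fI w := cos (phase gamma alpha (\sum_i \sum_j Theta i j * I i j w) (fun j => B j t w)).
pose fR N w := cos (phase gamma alpha
   (\sum_i \sum_j Theta i j * riemann_sum B t N i j w) (fun j => B j t w)).
have mcos (Z : 'I_d -> 'I_d -> T -> R) : (forall i j, measurable_fun [set: T] (Z i j)) ->
    L1 P (fun w => cos (phase gamma alpha (\sum_i \sum_j Theta i j * Z i j w)
      (fun j => B j t w))).
  move=> mZ; apply: (@L1_bounded _ _ _ P _ 1); last by move=> w; exact: cos_le_norm1.
  apply: (measurableT_comp (f := @cos R)).
    by apply: continuous_measurable_fun; exact: continuous_cos.
  apply: measurable_funD => //; apply: measurable_funD.
    apply: measurable_funM => //; apply: measurable_sum => i; apply: measurable_sum => j.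
    exact: measurable_funM.
  by apply: measurable_sum => j; exact: measurable_funM.
have LfI : L1 P fI by apply: mcos => i j; exact: (proj1 (ito_L2 (hI i j))).
have key N : (0 < N)%N -> `|Ex P fI - profile Theta Q l gamma alpha t 0 (fun=> 0)|
    <= (S * (2 * Num.sqrt t) + C) * Num.sqrt (t / N%:R).
  move=> N0.
  have LfR : L1 P (fR N).
    by apply: mcos => i j; exact: (proj1 (riemann_sum_L2 hB t0 N0 i j)).
  have NR0 : 0 < N%:R :> R by rewrite ltr0n.
  have h0 : 0 < t / N%:R by rewrite divr_gt0.
  (* The square root of the bound [4 * (t * h)] of [riemann_sum_ito]. *)
  pose e := 2 * (Num.sqrt t * Num.sqrt (t / N%:R)).
  have e0 : 0 < e by rewrite !mulr_gt0// sqrtr_gt0.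
  have eE : e ^+ 2 = 4 * (t * (t / N%:R)).
    by rewrite /e !exprMn !sqr_sqrtr ?ltW//; ring.
  have LD i j : L2 P (fun w => I i j w - riemann_sum B t N i j w).
    by apply: L2B; [exact: ito_L2 (hI i j)|exact: riemann_sum_L2].
  have hD i j := Ex_norm_le (LD i j) e0
    (eq_ind_r (fun x => _ <= x) (riemann_sum_ito hB t0 N0 (hI i j)) eE).
  have diff : `|Ex P fI - Ex P (fR N)| <= S * e.
    rewrite -ExB//.
    have Labs i j : L1 P (fun w => `|I i j w - riemann_sum B t N i j w|).
      by apply: L1_abs; exact: (proj1 (hD i j)).
    pose G w := \sum_i \sum_j `|Theta i j| * `|I i j w - riemann_sum B t N i j w|.
    have LGi i : L1 P (fun w => \sum_j `|Theta i j| * `|I i j w - riemann_sum B t N i j w|).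
      by apply: L1_sum => j _; exact: L1Z.
    have LG : L1 P G by apply: L1_sum => i _.
    apply: (@le_trans _ _ (Ex P G)).
      apply: le_norm_Ex => //; first exact: L1B.
      move=> w; rewrite /fI /fR (le_trans (cos_lipschitz _ _))//.
      rewrite /phase opprD addrACA subrr addr0 opprD addrACA subrr addr0.
      rewrite -mulrBl normrM (ger0_norm (_ : 0 <= 2^-1))//.
      apply: (@le_trans _ _ `|\sum_i \sum_j Theta i j * I i j w -
          \sum_i \sum_j Theta i j * riemann_sum B t N i j w|).
        by rewrite ler_piMr// invf_le1// ler1n.
      rewrite -sumrB /G; apply: ler_norm_sum_bound => i.
      rewrite -sumrB; apply: ler_norm_sum_bound => j.
      by rewrite -mulrBr normrM.
    rewrite /G Ex_sum// /S mulr_suml; apply: ler_sum => i _.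
    rewrite Ex_sum; last by move=> j _; exact: L1Z.
    rewrite mulr_suml; apply: ler_sum => j _; rewrite ExZ//.
    by rewrite ler_wpM2l//; exact: (proj2 (hD i j)).
  have -> : Ex P fI - profile Theta Q l gamma alpha t 0 (fun=> 0) =
    (Ex P fI - Ex P (fR N)) + (Ex P (fR N) - profile Theta Q l gamma alpha t 0 (fun=> 0)).
    by ring.
  rewrite (le_trans (ler_normD _ _))// mulrDl lerD//; last exact: hC.
  by rewrite -mulrA; rewrite /e mulrA in diff.
apply/eqP; rewrite -subr_eq0 -normr_le0 leNgt; apply/negP => x0.
set x := `|_| in x0 key; set K := (S * _ + C) in key.
have K0 : 0 <= K by rewrite addr_ge0 ?mulr_ge0// sqrtr_ge0.
(* For such an [N], [K * sqrt (t / N) < x], contradicting [key]. *)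
pose N := (Num.truncn (K ^+ 2 * t / x ^+ 2)).+1.
have x20 : 0 < x ^+ 2 by rewrite exprn_gt0.
have := key N isT; rewrite leNgt => /negP; apply.
have NR0 : 0 < N%:R :> R by rewrite ltr0n.
have Kt : K ^+ 2 * t / x ^+ 2 < N%:R by rewrite real_truncnS_gt// num_real.
rewrite -(ltr_pXn2r (_ : (0 < 2)%N)) ?nnegrE ?mulr_ge0 ?sqrtr_ge0 ?(ltW x0)//.
rewrite exprMn sqr_sqrtr; last by rewrite divr_ge0// ltW.
by rewrite mulrA ltr_pdivrMr// -ltr_pdivrMl// mulrC.
Qed.

End RiemannLimit.

Local Open Scope complex_scope.

(** * Complex exponentials and the closed formula *)

Section FinalFormula.
Variables (R : realType) (d : nat).

Lemma ln_prod (J : Type) (r : seq J) (Q : pred J) (c : J -> R) :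
  (forall k, Q k -> 0 < c k) ->
  ln (\prod_(k <- r | Q k) c k) = \sum_(k <- r | Q k) ln (c k).
Proof.
move=> c0; pose S (x y : R) := 0 < x /\ ln x = y.
suff : S (\prod_(k <- r | Q k) c k) (\sum_(k <- r | Q k) ln (c k)) by case.
apply: big_rec2 => [|k y x Qk [x0 <-]]; first by rewrite /S ln1 ltr01.
by split; [exact: mulr_gt0 (c0 k Qk) x0|rewrite lnM ?posrE ?c0].
Qed.

Lemma sum_upper_half (F : 'I_d -> 'I_d -> R) :
  (forall j k, F j k = F k j) -> (forall j, F j j = 0) ->
  \sum_(j < d) \sum_(k < d | (j < k)%N) F j k = 2^-1 * \sum_j \sum_k F j k.
Proof.
move=> symF F0.
have e : \sum_j \sum_k F j k =
  \sum_(j < d) \sum_(k < d | (j < k)%N) F j k + \sum_(j < d) \sum_(k < d | (k < j)%N) F j k.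
  rewrite -big_split; apply: eq_bigr => j _.
  rewrite (bigID (fun k : 'I_d => (j < k)%N))/=; congr (_ + _).
  rewrite (bigID (fun k : 'I_d => k == j))/= [X in X + _]big1 ?add0r => [|k /andP[_ /eqP->]//].
  by apply: eq_bigl => k; rewrite -leqNgt ltn_neqAle andbC.
have e2 : \sum_(j < d) \sum_(k < d | (k < j)%N) F j k = \sum_(j < d) \sum_(k < d | (j < k)%N) F j k.
  rewrite (exchange_big_dep xpredT)//=; apply: eq_bigr => k _.
  by apply: eq_bigr => j _; rewrite symF.
by rewrite e e2; field.
Qed.

Lemma cexp_i (x y : R) :
  cexp ('i * x%:C + 'i * y%:C) = cos (x + y) +i* sin (x + y).
Proof.
rewrite /cexp.
have -> : 'i * x%:C + 'i * y%:C = (0 +i* (x + y))%C :> R[i].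
  by apply/eqP; rewrite eq_complex /=; apply/andP; split; apply/eqP; ring.
rewrite /= expR0; apply/eqP; rewrite eq_complex /=.
by apply/andP; split; apply/eqP; ring.
Qed.

Lemma cexp_i2 (x y : R) :
  cexp ('i / 2 * x%:C + 'i * y%:C) = cos (x / 2 + y) +i* sin (x / 2 + y).
Proof.
have half : (x / 2)%:C = x%:C / 2.
  apply: (mulIf (_ : 2%:R != 0)); rewrite ?pnatr_eq0// divfK ?pnatr_eq0//.
  by rewrite -(rmorph_nat (real_complex R)) -rmorphM/= divfK ?pnatr_eq0.
by rewrite -cexp_i half -mulrA [2^-1 * _]mulrC.
Qed.

End FinalFormula.

Theorem theorem2p1 (R : realType) (disp : measure_display)
    (T : measurableType disp) (P : probability T R)
    (d : nat) (hd : (2 <= d)%N) (t : R) (ht : 0 < t)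
    (gamma : 'cV[R]_d) (Theta : 'M[R]_d) (hTheta : Theta^T = - Theta)
    (B : 'I_d -> R -> {RV P >-> R}) (hB : brownian_motion B)
    (I : 'I_d -> 'I_d -> T -> R)
    (hI : forall j k : 'I_d,
      is_ito_integral P (natural_filtration (fun l s => B l s)) t
        (fun s => B k s) (fun s => B j s) (I j k)) :
  let A := levy_area I in
  let Bt := fun w : T => \col_(j < d) B j t w in
  let C := mxfun cosh ((t / 2) *: mxmodulus Theta) in
  let S := mxfun sinch ((t / 2) *: mxmodulus Theta) in
  cexpectation P (fun w =>
      cexp ('i * (\sum_(j < d) \sum_(k < d | (j < k)%N) Theta j k * A w j k)%:C
            + 'i * (\sum_(j < d) gamma j 0 * B j t w)%:C))
    = cexpectation P (fun w =>
      cexp ('i / 2 * (\tr (Theta^T *m A w))%:C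
            + 'i * ((gamma^T *m Bt w) 0 0)%:C))
  /\ cexpectation P (fun w =>
      cexp ('i / 2 * (\tr (Theta^T *m A w))%:C
            + 'i * ((gamma^T *m Bt w) 0 0)%:C))
    = ((\det C) `^ (- 2^-1)
       * expR (- (t / 2) * (gamma^T *m (S *m invmx C) *m gamma) 0 0))%:C.
Proof.
move=> A Bt C S.
have symTT : (Theta^T *m Theta)^T = Theta^T *m Theta by rewrite trmx_mul trmxK.
have [Q [l [QQ spec]]] := symmetric_spectral symTT.
have skew i j : Theta j i = - Theta i j.
  by have := congr1 (fun M : 'M[R]_d => M i j) hTheta; rewrite !mxE.
have trA w : \tr (Theta^T *m A w) = \sum_i \sum_j Theta i j * A w i j.
  rewrite /mxtrace exchange_big /=; apply: eq_bigr => j _.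
  by rewrite mxE; apply: eq_bigr => i _; rewrite [X in X * _]mxE.
(* By skewness the two halves of the Levy area contribute equally, which cancels its factor one
   half. *)
have trI w : \tr (Theta^T *m A w) = \sum_i \sum_j Theta i j * I i j w.
  have h2 : \sum_i \sum_j Theta i j * A w i j =
    2^-1 * (\sum_i \sum_j Theta i j * I i j w - \sum_i \sum_j Theta i j * I j i w).
    rewrite mulrBr !mulr_sumr -sumrB; apply: eq_bigr => i _.
    by rewrite !mulr_sumr -sumrB; apply: eq_bigr => j _; rewrite mxE; ring.
  have h3 : \sum_i \sum_j Theta i j * I j i w = - \sum_i \sum_j Theta i j * I i j w.
    rewrite exchange_big /= -sumrN; apply: eq_bigr => i _; rewrite -sumrN.
    by apply: eq_bigr => j _; rewrite skew mulNr.
  by rewrite trA h2 h3; field.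
have gB w : (gamma^T *m Bt w) 0 0 = \sum_j gamma j 0 * B j t w.
  by rewrite mxE; apply: eq_bigr => j _; rewrite !mxE.
have half w : \sum_(j < d) \sum_(k < d | (j < k)%N) Theta j k * A w j k
    = \tr (Theta^T *m A w) / 2.
  rewrite (@sum_upper_half R d (fun j k => Theta j k * A w j k)).
  - by rewrite trA mulrC.
  - by move=> j k; rewrite (skew k j) !mxE; ring.
  - by move=> j; have := skew j j => h; rewrite mxE subrr !mulr0.
split.
  congr cexpectation; apply/funext => w.
  by rewrite cexp_i cexp_i2 half gB.
pose pos w := fun j => B j t w.
have cexpE w : cexp ('i / 2 * (\tr (Theta^T *m A w))%:C + 'i * ((gamma^T *m Bt w) 0 0)%:C)
  = cos (phase gamma 0 (\sum_i \sum_j Theta i j * I i j w) (pos w))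
    +i* cos (phase gamma (- (pi / 2)) (\sum_i \sum_j Theta i j * I i j w) (pos w)).
  by rewrite cexp_i2 trI gB /phase addr0 cosBpihalf.
under [X in cexpectation P X]eq_fun do rewrite cexpE.
rewrite /cexpectation unlock /=.
have fourier alpha := levy_area_cos hB gamma alpha hTheta QQ spec ht hI.
have phase00 alpha : phase gamma alpha 0 (fun=> 0) = alpha.
  by rewrite /phase mul0r big1 ?addr0 ?add0r// => j _; rewrite mulr0.
(* At the origin the phase is the constant [alpha]: the real part is the bare amplitude and the
   imaginary part carries the factor [cos (pi / 2) = 0]. *)
rewrite [X in X +i* _](fourier 0) [X in _ +i* X](fourier (- (pi / 2))).
rewrite /profile !phase00 cosN cos_pihalf cos0 mulr0 mulr1.
have cosh0 k : 0 < cosh (t / 2 * Num.sqrt (l 0 k)) by exact: cosh_gt0.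
congr (_ +i* _).
rewrite /C /S !(mxfun_modulus QQ spec) det_spectral// quad_spectral_div//; last first.
  by move=> k; rewrite mxE lt0r_neq0.
under eq_bigr do rewrite mxE.
rewrite /powR gt_eqF ?prodr_gt0// ln_prod// -expRD; congr expR.
(* At [b = 0] the vector is [2 * gamma], so [T y^2 / 4] is [T] times the square of a coordinate of
   [Q *m gamma], and [T] is [t / 2] times [sinch / cosh] by definition of [riccati]. *)
rewrite /expo; congr (_ + _); first by rewrite mulNr.
rewrite mulNr; congr (- _); rewrite !mulr_sumr; apply: eq_bigr => k _.
rewrite /ycoord big1 ?add0r => [|j _]; last by rewrite mulr0.
move: ((Q *m gamma) k 0) => v; rewrite !mxE /tanh_coef /riccati.
by field; exact: lt0r_neq0.
Qed.
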